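(* The quantitative reachability problem for $1\frac{1}{2}$-player stochastic timed games is undecidable for games with $4$ or more clocks. That is, there is no algorithm which, given a $1\frac{1}{2}$-player stochastic timed game $\mathcal{G}$ with at least $4$ clocks, a set $T$ of target locations, an initial state $s_0$, and a threshold $\bowtie p$ with $p\in(0,1)\cap\mathbb{Q}$ and $\bowtie\in\{<,\le,=,\ge,>\}$, decides whether Player $\Diamond$ has a strategy $\lambda_\Diamond$ such that the probability of the set of runs from $s_0$ that visit $T$ is $\bowtie p$.
   Context: Clocks are real-valued variables; a valuation $\nu$ assigns a non-negative real to each clock; $\nu+t$ adds $t$ to every clock and $\nu[X:=0]$ resets the clocks in $X$. A clock constraint is a finite conjunction of constraints $x\bowtie k$ with $k\in\mathbb{Z}_{\ge0}$, $\bowtie\in\{<,\le,=,>,\ge\}$. A timed automaton $\mathcal{A}=(L,\mathcal{X},E,\mathcal{I})$ has finitely many locations $L$, clocks $\mathcal{X}$, edges $E\subseteq L\times(\text{constraints})\times 2^{\mathcal{X}}\times L$, and invariants $\mathcal{I}$ assigning a clock constraint to each location. States are pairs $(\ell,\nu)$ with $\nu\models\mathcal{I}(\ell)$; a transition $(\ell,\nu)\xrightarrow{t,e}(\ell',\nu')$ for $e=(\ell,g,C,\ell')$ requires $\nu+t\models g$, $\nu+t'\models\mathcal{I}(\ell)$ for all $0\le t'\le t$, and $\nu'=(\nu+t)[C:=0]$. For a state $s$ and edge $e$, $I(s,e)=\{t\mid s\xrightarrow{t,e}s'\text{ for some }s'\}$ and $I(s)=\bigcup_e I(s,e)$. A stochastic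 timed game (STG) is $\mathcal{G}=(\mathcal{A},(L_\Box,L_\Diamond,L_\bigcirc),\omega,\mu)$ where $L_\Box,L_\Diamond,L_\bigcirc$ partition $L$ (locations of Player $\Box$, Player $\Diamond$, and the stochastic player), $\omega$ assigns a positive integer weight to each edge leaving $L_\bigcirc$, and $\mu$ assigns to each state $s$ with location in $L_\bigcirc$ a probability measure $\mu(s)$ on $I(s)$ such that, if $I(s)$ has positive Lebesgue measure, $\mu(s)$ and Lebesgue measure have the same null subsets of $I(s)$. From a stochastic state $s$ a delay $t$ is drawn according to $\mu(s)$, then an enabled edge $e$ in $s+t$ is chosen with probability $\omega(e)/\sum\{\omega(e')\mid e'\text{ enabled in }s+t\}$. A (deterministic) strategy for Player $\Diamond$ (resp. $\Box$) maps each finite run ending in a state whose location is in $L_\Diamond$ (resp. $L_\Box$) to a pair $(t,e)$ of a delay and an edge that can be taken; strategy profiles are required to be measurable, and a profile together with an initial state induces a probability measure on infinite runs. An STG with $L_\Box=\emptyset$ is a $1\frac12$-player STG. The (quantitative) reachability problem: given $\mathcal{G}$, targets $T$, initial state $s_0$ and threshold $\bowtie p$ with $0<p<1$, decide whether there is a strategy $\lambda_\Diamond$ such that for every strategy $\lambda_\Box$ the probability of reaching $T$ is $\bowtie p$. *)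

(* Defs.v *)
From HB Require Import structures.
From mathcomp Require Import all_boot all_order all_algebra.
From mathcomp Require Import all_classical all_reals all_analysis.
From mathcomp Require Import measurable_realfun.

Set Implicit Arguments.
Unset Strict Implicit.
Unset Printing Implicit Defensive.
Import Order.TTheory GRing.Theory Num.Theory.
Import numFieldNormedType.Exports.
Local Open Scope classical_set_scope.
Local Open Scope ring_scope.

Variant cmp := CLt | CLe | CEq | CGe | CGt.

Definition nat_of_cmp (c : cmp) : nat :=
  match c with CLt => 0 | CLe => 1 | CEq => 2 | CGe => 3 | CGt => 4 end.

Definition cmp_of_nat (i : nat) : option cmp :=
  nth None [:: Some CLt; Some CLe; Some CEq; Some CGe; Some CGt] i.

Lemma nat_of_cmpK : pcancel nat_of_cmp cmp_of_nat. Proof. by case. Qed.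

HB.instance Definition _ := Choice.copy cmp (pcan_type nat_of_cmpK).

Definition cmp_holds (R : realType) (c : cmp) (x y : R) : bool :=
  match c with
  | CLt => x < y | CLe => x <= y | CEq => x == y | CGe => x >= y | CGt => x > y
  end.

(* The clocks are 'I_k; the list [:: (x1, c1, m1); ...] is the conjunction of
   the constraints  x_i c_i m_i. *)
Definition constr (k : nat) := seq ('I_k * cmp * nat).

(* The locations are 'I_n.+1. *)
Record edge (n k : nat) := Edge {
  src : 'I_n.+1; guard : constr k; resets : {set 'I_k}; tgt : 'I_n.+1 }.

Definition tuple_of_edge n k (e : edge n k) :
    'I_n.+1 * seq ('I_k * cmp * nat) * {set 'I_k} * 'I_n.+1 :=
  (src e, guard e, resets e, tgt e).
Definition edge_of_tuple n k
    (u : 'I_n.+1 * seq ('I_k * cmp * nat) * {set 'I_k} * 'I_n.+1) : edge n k :=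
  Edge u.1.1.1 u.1.1.2 u.1.2 u.2.
Lemma tuple_of_edgeK n k : cancel (@tuple_of_edge n k) (@edge_of_tuple n k).
Proof. by case. Qed.

HB.instance Definition _ n k :=
  Choice.copy (edge n k) (can_type (@tuple_of_edgeK n k)).
(* Measurable types are pointed, hence the need for a default edge. *)
HB.instance Definition _ n k :=
  isPointed.Build (edge n k) (Edge ord0 [::] finset.set0 ord0).

(* The finite set of edges is given by a duplicate-free enumeration. *)
Record timed_automaton (n k : nat) := TimedAutomaton {
  edges : seq (edge n k);
  edges_uniq : uniq edges;
  inv : 'I_n.+1 -> constr k }.

Definition state (R : realType) (n k : nat) : Type :=
  ('I_n.+1 * k.-tuple R)%type.

Section Semantics.
Context {R : realType} {n k : nat}.
Implicit Types (v : k.-tuple R) (s : state R n k) (e : edge n k) (t : R).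
Implicit Type A : timed_automaton n k.

Definition sat v (g : constr k) : bool :=
  all (fun a => cmp_holds a.1.2 (tnth v a.1.1) a.2%:R) g.

Definition elapse v t : k.-tuple R := [tuple tnth v x + t | x < k].

Definition reset v (C : {set 'I_k}) : k.-tuple R :=
  [tuple if x \in C then 0 else tnth v x | x < k].

Definition is_state A s : Prop :=
  (forall x, 0 <= tnth s.2 x) /\ sat s.2 (inv A s.1).

Definition move s (m : R * edge n k) : state R n k :=
  (tgt m.2, reset (elapse s.2 m.1) (resets m.2)).

Definition trans A s t e s' : Prop :=
  [/\ e \in edges A /\ src e = s.1,
      is_state A s /\ 0 <= t,
      sat (elapse s.2 t) (guard e),
      forall u, 0 <= u <= t -> sat (elapse s.2 u) (inv A s.1) &
      s' = move s (t, e) /\ is_state A s'].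

Definition delays_of A s e : set R := [set t | exists s', trans A s t e s'].

Definition delays A s : set R := \bigcup_(e in [set` edges A]) delays_of A s e.

(* A run is represented by its initial state and its sequence of
   (delay, edge) steps, which determine all the intermediate states. *)
Fixpoint is_run A s (h : seq (R * edge n k)) : Prop :=
  match h with
  | [::] => is_state A s
  | m :: h' => trans A s m.1 m.2 (move s m) /\ is_run A (move s m) h'
  end.

Definition state_after s (h : seq (R * edge n k)) : state R n k :=
  foldl move s h.

End Semantics.

Variant owner_kind := PBox | PDiamond | Nature.

(* The partition of the locations is given by [owner]; [weight] is only
   meaningful on edges leaving Nature's locations, and [mu] on states at these
   locations.  The last field, the measurability of the delay distribution in
   the clock values, is what makes the measure induced on runs well defined. *)
Record stg (R : realType) (n k : nat) := STG {
  aut : timed_automaton n k;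
  owner : 'I_n.+1 -> owner_kind;
  weight : edge n k -> nat;
  mu : state R n k -> probability (measurableTypeR R) R;
  weight_gt0 : forall e,
    e \in edges aut -> owner (src e) = Nature -> (0 < weight e)%N;
  mu_delays : forall s, is_state aut s -> owner s.1 = Nature ->
    mu s (delays aut s) = 1%E;
  mu_lebesgue : forall s, is_state aut s -> owner s.1 = Nature ->
    (0 < lebesgue_measure (delays aut s))%E ->
    forall N : set (measurableTypeR R), measurable N -> N `<=` delays aut s ->
      mu s N = 0%E <-> lebesgue_measure N = 0%E;
  mu_measurable : forall l, owner l = Nature ->
    forall B : set (measurableTypeR R), measurable B ->
      measurable_fun
        [set v : k.-tuple (measurableTypeR R) | is_state aut (l, v)]
        (fun v => mu (l, v) B) }.

Section Game.
Context {R : realType} {n k : nat}.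
Variable G : stg R n k.
Implicit Types (s : state R n k) (h : seq (R * edge n k)).

Definition one_and_half_player : Prop := forall l, owner G l <> PBox.

(* The first argument is the initial state of the run, the second one its
   steps; only the values on runs ending in a location of the player matter. *)
Definition strategy := state R n k -> seq (R * edge n k) -> R * edge n k.

Definition run_of_player (pl : owner_kind) s h : Prop :=
  is_run (aut G) s h /\ owner G (state_after s h).1 = pl.

(* Measurability: along any fixed sequence of edges, the decision is a
   measurable function of the delays. *)
Definition is_strategy (pl : owner_kind) (lam : strategy) : Prop :=
  (forall s h, run_of_player pl s h ->
     delays_of (aut G) (state_after s h) (lam s h).2 (lam s h).1) /\
  (forall s (es : seq (edge n k)),
     let D := [set ts : (size es).-tuple (measurableTypeR R) |
                 run_of_player pl s (zip ts es)] in
     measurable_fun D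
       (fun ts => (lam s (zip ts es)).1 : measurableTypeR R) /\
     forall e, measurable (D `&` [set ts | (lam s (zip ts es)).2 = e])).

Definition enabled s (e : edge n k) : bool := `[< delays_of (aut G) s e 0 >].

Definition edge_prob s (e : edge n k) : R :=
  if enabled s e then
    (weight G e)%:R / (\sum_(e' <- edges (aut G) | enabled s e') weight G e')%:R
  else 0.

(* Probability that the step following the history h consists of a delay in B
   and of the edge e. *)
Definition step_prob (lamD lamB : strategy) s h
    (B : set (measurableTypeR R)) (e : edge n k) : \bar R :=
  let s' := state_after s h in
  match owner G s'.1 with
  | PDiamond => (\1_(B `*` [set e]) (lamD s h))%:E
  | PBox => (\1_(B `*` [set e]) (lamB s h))%:E
  | Nature =>
      (\int[mu G s']_(t in B) (edge_prob (s'.1, elapse s'.2 t) e)%:E)%E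
  end.

End Game.

Section Runs.
Variables (R : realType) (n k : nat).

Definition cylinder (N : nat) (B : nat -> set (measurableTypeR R))
    (es : nat -> edge n k) : set (nat -> R * edge n k) :=
  [set rho | forall i, (i < N)%N -> B i (rho i).1 /\ (rho i).2 = es i].

Definition cylinders : set (set (nat -> R * edge n k)) :=
  [set C | exists N B es,
     (forall i, measurable (B i)) /\ C = cylinder N B es].

(* Infinite sequences of steps, with the sigma-algebra generated by cylinders.
   Sequences that are not runs are null for the induced measures below. *)
Definition runs := g_sigma_algebraType cylinders.

End Runs.

Section Problem.
Context {R : realType} {n k : nat}.
Variable G : stg R n k.
Implicit Type s : state R n k.

(* The values on cylinders, computed inductively from the one-step
   distributions, characterize the measure. *)
Definition induced_measure (lamD lamB : strategy) s
    (P : probability (runs R n k) R) : Prop :=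
  forall (N : nat) (B : nat -> set (measurableTypeR R))
    (es : nat -> edge n k), (forall i, measurable (B i)) ->
    P (cylinder N.+1 B es) =
    (\int[P]_(rho in cylinder N B es)
        step_prob G lamD lamB s (mkseq rho N) (B N) (es N))%E.

Definition visits (T : {set 'I_n.+1}) s : set (runs R n k) :=
  [set rho | exists N, (state_after s (mkseq rho N)).1 \in T].

Definition reach_problem (T : {set 'I_n.+1}) s (c : cmp) (p : R) : Prop :=
  exists lamD, is_strategy G PDiamond lamD /\
    forall lamB, is_strategy G PBox lamB ->
      exists P : probability (runs R n k) R,
        induced_measure lamD lamB s P /\ cmp_holds c (fine (P (visits T s))) p.

(* Since delay sets are finite unions of intervals, a Lebesgue-null one is
   finite; the uniform distribution is then the discrete one. *)
Definition uniform_on (D : set R) (P : probability (measurableTypeR R) R) :=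
  ((0 < lebesgue_measure D < +oo)%E /\
   forall B : set (measurableTypeR R), measurable B ->
     (P B * lebesgue_measure D = lebesgue_measure (B `&` D))%E) \/
  (finite_set D /\
   forall B : set (measurableTypeR R), measurable B ->
     (P B * counting D = counting (B `&` D))%E).

Definition uniform_stg : Prop :=
  forall s, is_state (aut G) s -> owner G s.1 = Nature ->
    uniform_on (delays (aut G) s) (mu G s).

End Problem.

(* Goedel numbering of the finite data, through the bijection [CodeSeq.code]
   between lists of numbers and numbers. *)
Section Encoding.
Local Notation code := CodeSeq.code.

Definition code_constr k (g : constr k) : nat :=
  code [seq code [:: val a.1.1; nat_of_cmp a.1.2; a.2] | a <- g].

Definition code_set n (X : {set 'I_n}) : nat :=
  code [seq val x | x <- enum X].

Definition code_edge n k (e : edge n k) : nat :=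
  code [:: val (src e); code_constr (guard e); code_set (resets e);
           val (tgt e)].

Definition code_owner (o : owner_kind) : nat :=
  match o with PBox => 0 | PDiamond => 1 | Nature => 2 end.

Definition is_nature (o : owner_kind) : bool :=
  if o is Nature then true else false.

(* For nonnegative rationals. *)
Definition code_rat (q : rat) : nat := code [:: `|numq q|%N; `|denq q|%N].

(* Everything except the measures [mu]. *)
Definition code_stg (R : realType) n k (G : stg R n k) : nat :=
  code [:: n; k;
    code [seq code_edge e | e <- edges (aut G)];
    code [seq code_constr (inv (aut G) l) | l <- enum 'I_n.+1];
    code [seq code_owner (owner G l) | l <- enum 'I_n.+1];
    code [seq weight G e | e <- edges (aut G) & is_nature (owner G (src e))]].

(* d is the number presenting the measures of G. *)
Definition code_instance (R : realType) n k (G : stg R n k) (d : nat)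
    (T : {set 'I_n.+1}) (l0 : 'I_n.+1) (v0 : k.-tuple rat) (c : cmp) (p : rat)
    : nat :=
  code [:: code_stg G; d; code_set T; val l0;
           code [seq code_rat q | q <- v0]; nat_of_cmp c; code_rat p].

End Encoding.

Definition rat_state (R : realType) n k (l0 : 'I_n.+1) (v0 : k.-tuple rat) :
    state R n k :=
  (l0, [tuple ratr (tnth v0 x) | x < k]).

(* Algorithms are Minsky register machines: [Inc r] increments register r and
   continues with the next instruction; [Dec r q] jumps to instruction q if
   register r is zero, and otherwise decrements it and continues with the next
   instruction.  The machine halts when the program counter leaves the program;
   the input and the output are in register 0. *)
Variant instr := Inc of nat | Dec of nat & nat.

Definition config := (nat * (nat -> nat))%type.

Definition upd (m : nat -> nat) (r x : nat) : nat -> nat :=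
  fun i => if i == r then x else m i.

Definition mstep (M : seq instr) (c : config) : config :=
  match onth M c.1 with
  | None => c
  | Some (Inc r) => (c.1.+1, upd c.2 r (c.2 r).+1)
  | Some (Dec r q) =>
      if c.2 r is x.+1 then (c.1.+1, upd c.2 r x) else (q, c.2)
  end.

Definition computes (M : seq instr) (x y : nat) : Prop :=
  exists N, let c := iter N (mstep M) (0%N, upd (fun=> 0%N) 0 x) in
    (size M <= c.1)%N /\ c.2 0%N = y.

Definition answers (M : seq instr) (x : nat) (Q : Prop) : Prop :=
  (Q -> computes M x 1) /\ (~ Q -> computes M x 0).

(* Main.v *)
Require Import Defs.
From HB Require Import structures.
From mathcomp Require Import all_boot all_order all_algebra.
From mathcomp Require Import all_classical all_reals all_analysis.
From mathcomp Require Import measurable_realfun perm zify lra ring.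

Set Implicit Arguments.
Unset Strict Implicit.
Unset Printing Implicit Defensive.
Import Order.TTheory GRing.Theory Num.Theory.
Import numFieldNormedType.Exports.
Local Open Scope classical_set_scope.
Local Open Scope ring_scope.

(* Diagonalisation.  Given an alleged decision procedure M, there is a register
   machine D which, on input x, writes the code of the instance made of the game
   with code x and of a fixed shape of initial valuation holding 2^-x, runs M on
   it, and halts iff M answers 1.  A game G simulating D is constructed such that
   Player Diamond can keep the probability of [lose] at most 1/3 iff D diverges
   on the register content read off the initial valuation; x := code_stg G then
   contradicts M.

   The content c of a register is represented by a clock value 2^-c.  In each
   phase Player Diamond picks the instants at which a second set of clocks is
   reset, thereby guessing the contents y after one instruction from the contents
   x before; guards check the range of the guesses and the zero tests.  Then for
   each register Nature tosses two coins.  Either outcome of the first ends the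
   simulation or continues it; on ending, a uniformly random delay is drawn from
   a set of length 6 + e in which a part of length 2 leads to [lose]; for the
   second coin these lengths are 3 - e and 1.  Here the error e of the form
   a x - b y with a, b in {1, 2} vanishes iff the guess for this register is
   correct.  Since
     (1/2) 2/(6 + e) + (1/4) 1/(3 - e) >= (3/4) (1/3)
   with equality iff e = 0, correct guesses lose with probability exactly 1/3
   at each exit, and any wrong guess makes the probability exceed 1/3, as does
   reaching the end of D, where the play is lost. *)

(** * Register machines *)

(** The machine D carries constants describing an instance that is itself built from D. The circle
    is broken by making everything but the code of the game independent of D: the number of clocks
    is fixed from the registers of M alone, the initial location and the target have fixed numbers,
    and the code of the game is the input x.

    Two checks per register are needed because a single one is monotone in e and would reward errors
    of one sign. The lengths 6 and 3 and the weights 1/2 and 1/4 make the derivatives at e = 0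
    cancel, as -1/36 + 1/36, while convexity does the rest.

    A wrong guess cannot be repaid by later play: from the start of any later phase the conditional
    probability of losing is at least 1/3. Since plays may be endless, this bound is obtained as a
    limit, the probability of still being in the simulation tending to 0.

    The problem asks for an induced measure to exist, so in the diverging case one has to be built.
    Faithful play is random only in the coins and in the final draw, so a countable mixture replaces
    a general extension theorem. *)

Section Minsky.
Local Open Scope nat_scope.
Implicit Types (M : seq instr) (mu : nat -> nat) (a b d r n : nat).

Definition reaches M (c c' : config) := exists N, iter N (mstep M) c = c'.

Lemma reaches_refl M c : reaches M c c.
Proof. by exists 0. Qed.

Lemma reaches_trans M c1 c2 c3 :
  reaches M c1 c2 -> reaches M c2 c3 -> reaches M c1 c3.
Proof. by move=> [i <-] [j <-]; exists (j + i); rewrite iterD. Qed.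

Lemma reaches_step M c c' : reaches M (mstep M c) c' -> reaches M c c'.
Proof. by move=> [i <-]; exists i.+1; rewrite iterSr. Qed.

(* Jumps are absolute, so a program fragment depends on its address. *)
Definition prog := nat -> seq instr.

Definition runs_to (p : prog) mu mu' := forall pre post,
  reaches (pre ++ p (size pre) ++ post)
    (size pre, mu) (size pre + size (p (size pre)), mu').

Definition seqp (p q : prog) : prog := fun o => p o ++ q (o + size (p o)).

Definition incp r : prog := fun=> [:: Inc r].

Definition nilp : prog := fun=> [::].

Fixpoint incsp r n : prog := if n is n'.+1 then seqp (incp r) (incsp r n') else nilp.

(* Register 4 stays zero, so [Dec 4 o] is an unconditional jump. *)
Definition loopp r (p : prog) : prog := fun o =>
  Dec r (o + size (p o.+1) + 2) :: p o.+1 ++ [:: Dec 4 o].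

Lemma runs_seq p q mu1 mu2 mu3 :
  runs_to p mu1 mu2 -> runs_to q mu2 mu3 -> runs_to (seqp p q) mu1 mu3.
Proof.
move=> hp hq pre post; rewrite /seqp -catA.
apply: reaches_trans (hp pre _) _.
have := hq (pre ++ p (size pre)) post.
by rewrite !size_cat -!catA addnA.
Qed.

Lemma runs_nil mu : runs_to nilp mu mu.
Proof. by move=> pre post; rewrite addn0; exact: reaches_refl. Qed.

Lemma runs_inc r mu : runs_to (incp r) mu (upd mu r (mu r).+1).
Proof.
by move=> pre post; exists 1; rewrite /= /mstep /= onth_cat ltnn subnn /= addn1.
Qed.

Lemma upd_upd mu r a b : upd (upd mu r a) r b = upd mu r b.
Proof. by apply/funext => i; rewrite /upd; case: eqP. Qed.

Lemma upd_id mu r : upd mu r (mu r) = mu.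
Proof. by apply/funext => i; rewrite /upd; case: eqP => // ->. Qed.

Lemma runs_incs r n mu : runs_to (incsp r n) mu (upd mu r (mu r + n)).
Proof.
elim: n mu => [|n IHn] mu /=; first by rewrite addn0 upd_id; exact: runs_nil.
apply: runs_seq (runs_inc r mu) _.
have := IHn (upd mu r (mu r).+1).
by rewrite upd_upd /upd eqxx addSnnS.
Qed.

(** The invariant [I] is indexed by the value of the loop counter [r]: a pass of the body leads from
    [I k.+1], with [r] already decremented, to [I k]. The closing jump relies on register 4 being
    zero in every [I k]. *)
Lemma runs_loop r p (I : nat -> nat -> nat) n :
  (forall k, I k r = k) -> (forall k, I k 4 = 0) ->
  (forall k, k < n -> runs_to p (upd (I k.+1) r k) (I k)) ->
  runs_to (loopp r p) (I n) (I 0).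
Proof.
move=> Ir I4; elim: n => [|n IHn] hp pre post; apply: reaches_step.
  rewrite /mstep /= onth_cat ltnn subnn /= Ir size_cat /=.
  by exists 0; congr pair; rewrite /=; lia.
rewrite /mstep /= onth_cat ltnn subnn /= Ir.
set o := size pre; set B := p o.+1.
have := hp n (ltnSn n) (rcons pre (Dec r (o + size B + 2))) (Dec 4 o :: post).
rewrite size_rcons -/o -/B cat_rcons.
rewrite -!catA /= => /reaches_trans; apply.
have E : onth (pre ++ Dec r (o + size B + 2) :: B ++ Dec 4 o :: post)
    (o.+1 + size B) = Some (Dec 4 o).
  rewrite -cat_rcons catA -(size_rcons pre (Dec r (o + size B + 2))) -size_cat.
  by rewrite onth_cat ltnn subnn.
apply: reaches_step; rewrite /mstep E /= I4.
have h : forall k, k < n -> runs_to p (upd (I k.+1) r k) (I k).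
  by move=> k kn; apply: hp; exact: ltnW.
by have := IHn h pre post; rewrite /loopp /= -!catA.
Qed.

(** Registers from 4 on read the default 0, among them the one tested by the unconditional jumps. *)
Definition mem4 a b c d : nat -> nat := nth 0 [:: a; b; c; d].

Lemma mem4E x : upd (fun=> 0) 0 x = mem4 x 0 0 0.
Proof. by apply/funext => -[|[|[|[|[|i]]]]]. Qed.

Lemma upd_mem4 a b c d x :
  (upd (mem4 a b c d) 0 x = mem4 x b c d) *
  (upd (mem4 a b c d) 1 x = mem4 a x c d) *
  (upd (mem4 a b c d) 2 x = mem4 a b x d) *
  (upd (mem4 a b c d) 3 x = mem4 a b c x).
Proof. by do !split; apply/funext => -[|[|[|[|[|i]]]]]. Qed.

Lemma mem4_nth a b c d :
  (mem4 a b c d 0 = a) * (mem4 a b c d 1 = b) *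
  (mem4 a b c d 2 = c) * (mem4 a b c d 3 = d).
Proof. by []. Qed.

Definition movep r s := loopp r (incp s).

Lemma runs_move02 a b c d : runs_to (movep 0 2) (mem4 a b c d) (mem4 0 b (c + a) d).
Proof.
have /= := @runs_loop 0 (incp 2) (fun k => mem4 k b (c + a - k) d) a.
rewrite subn0 addnK; apply=> // k ka.
rewrite !upd_mem4 ?mem4_nth; have := @runs_inc 2 (mem4 k b (c + a - k.+1) d).
rewrite !upd_mem4 !mem4_nth; congr runs_to; congr mem4; lia.
Qed.

Lemma runs_move30 a b c d : runs_to (movep 3 0) (mem4 a b c d) (mem4 (a + d) b c 0).
Proof.
have /= := @runs_loop 3 (incp 0) (fun k => mem4 (a + d - k) b c k) d.
rewrite subn0 addnK; apply=> // k ka.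
rewrite !upd_mem4 ?mem4_nth; have := @runs_inc 0 (mem4 (a + d - k.+1) b c k).
rewrite !upd_mem4 !mem4_nth; congr runs_to; congr mem4; lia.
Qed.

Lemma runs_move12 a b c d : runs_to (movep 1 2) (mem4 a b c d) (mem4 a 0 (c + b) d).
Proof.
have /= := @runs_loop 1 (incp 2) (fun k => mem4 a k (c + b - k) d) b.
rewrite subn0 addnK; apply=> // k ka.
rewrite !upd_mem4 ?mem4_nth; have := @runs_inc 2 (mem4 a k (c + b - k.+1) d).
rewrite !upd_mem4 !mem4_nth; congr runs_to; congr mem4; lia.
Qed.

Definition copyp := loopp 0 (seqp (incp 1) (incp 2)).

Lemma runs_copy a : runs_to copyp (mem4 a 0 0 0) (mem4 0 a a 0).
Proof.
have /= := @runs_loop 0 (seqp (incp 1) (incp 2)) (fun k => mem4 k (a - k) (a - k) 0) a.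
rewrite subn0 subnn; apply=> // k ka.
rewrite !upd_mem4 ?mem4_nth; apply: runs_seq (runs_inc _ _) _.
rewrite !upd_mem4 !mem4_nth; have := @runs_inc 2 (mem4 k (a - k.+1).+1 (a - k.+1) 0).
rewrite !upd_mem4 !mem4_nth; congr runs_to; congr mem4; lia.
Qed.

Definition affp p q := seqp (loopp 0 (incsp 3 p)) (seqp (movep 3 0) (incsp 0 q)).

Lemma runs_aff p q a b c : runs_to (affp p q) (mem4 a b c 0) (mem4 (a * p + q) b c 0).
Proof.
apply: (@runs_seq _ _ _ (mem4 0 b c (a * p))).
  have /= := @runs_loop 0 (incsp 3 p) (fun k => mem4 k b c ((a - k) * p)) a.
  rewrite subn0 subnn mul0n; apply=> // k ka.
  rewrite !upd_mem4 ?mem4_nth; have := @runs_incs 3 p (mem4 k b c ((a - k.+1) * p)).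
  by rewrite !upd_mem4 !mem4_nth -mulSnr subnSK.
apply: runs_seq (runs_move30 _ _ _ _) _.
by have := @runs_incs 0 q (mem4 (a * p) b c 0); rewrite upd_mem4.
Qed.

Definition exp2p := loopp 2 (affp 2 0).

Lemma runs_exp2 a b c : runs_to exp2p (mem4 a b c 0) (mem4 (a * 2 ^ c) b 0 0).
Proof.
have /= := @runs_loop 2 (affp 2 0) (fun k => mem4 (a * 2 ^ (c - k)) b k 0) c.
rewrite subn0 subnn expn0 muln1; apply=> // k kc.
rewrite !upd_mem4 ?mem4_nth; have := @runs_aff 2 0 (a * 2 ^ (c - k.+1)) b k.
by rewrite addn0 -mulnA -expnSr subnSK.
Qed.

(** [CodeSeq.code (a :: s)] is [2 ^ a] times [2 * code s + 1]. Here the head is in register 0 and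
    the coded tail [t] is a constant. *)
Definition consp t := seqp (movep 0 2) (seqp (incsp 0 t.*2.+1) exp2p).

Lemma runs_cons a b s :
  runs_to (consp (CodeSeq.code s)) (mem4 a b 0 0) (mem4 (CodeSeq.code (a :: s)) b 0 0).
Proof.
apply: runs_seq (runs_move02 _ _ _ _) _.
apply: (runs_seq (runs_incs _ _ _)); rewrite !upd_mem4 !mem4_nth !add0n.
by have := @runs_exp2 (CodeSeq.code s).*2.+1 b a; rewrite mulnC.
Qed.

(** With a constant head [h] and the tail in register 0, the same formula is affine in the tail. *)
Definition precons h := affp (2 ^ h.+1) (2 ^ h).

Lemma runs_precons h b c s :
  runs_to (precons h) (mem4 (CodeSeq.code s) b c 0)
    (mem4 (CodeSeq.code (h :: s)) b c 0).
Proof.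
have := @runs_aff (2 ^ h.+1) (2 ^ h) (CodeSeq.code s) b c.
congr runs_to; congr mem4; rewrite /= expnS; lia.
Qed.

Local Notation code := CodeSeq.code.

(* The code of the instance whose game has the code x and whose first clock
   starts at 2^-x; hs, rest and tl are its components that do not depend on x. *)
Definition input_code hs rest tl x :=
  code (x :: hs ++ code (code [:: 1; 2 ^ x] :: rest) :: tl).

(** The input is copied because it is used twice: for [2 ^ x], the denominator of the first clock,
    and, kept in register 1 meanwhile, as the head of the outermost list. The last line performs
    that outermost cons directly, since neither its head nor its tail is a constant. *)
Definition inputp hs rest tl : prog :=
  seqp copyp (seqp (seqp (incp 0) exp2p) (seqp (consp (code [::]))
  (seqp (precons 1)
  (seqp (consp (code rest)) (seqp (consp (code tl))
  (seqp (foldr (fun h p => seqp p (precons h)) nilp hs)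
  (seqp (affp 2 1) (seqp (movep 1 2) exp2p)))))))).

Lemma runs_input hs rest tl x :
  runs_to (inputp hs rest tl) (mem4 x 0 0 0)
    (mem4 (input_code hs rest tl x) 0 0 0).
Proof.
apply: runs_seq (runs_copy _) _.
apply: (@runs_seq _ _ _ (mem4 (2 ^ x) x 0 0)).
  apply: (runs_seq (runs_inc _ _)); rewrite !upd_mem4 !mem4_nth.
  by have := @runs_exp2 1 x x; rewrite mul1n.
apply: runs_seq (runs_cons _ _ _) _.
apply: runs_seq (runs_precons _ _ _ _) _.
apply: runs_seq (runs_cons _ _ _) _.
apply: runs_seq (runs_cons _ _ _) _.
rewrite /input_code; move: (_ :: tl) => s.
apply: (@runs_seq _ _ _ (mem4 (code (hs ++ s)) x 0 0)).
  elim: hs => [|h hs IHhs] /=; first exact: runs_nil.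
  by apply: runs_seq IHhs _; exact: runs_precons.
apply: runs_seq (runs_aff _ _ _ _ _) _.
apply: runs_seq (runs_move12 _ _ _ _) _.
have := @runs_exp2 (code (hs ++ s) * 2 + 1) 0 x.
by congr runs_to; congr mem4; rewrite /= mulnC muln2 addn1.
Qed.

(** Relocation to address [o] of a program of length [n]. Jumps out of the program are clipped to
    [n], so that every way of halting leads to the one address just after the relocated copy. *)
Definition shift_instr o n (i : instr) :=
  if i is Dec r q then Dec r (o + minn q n) else i.

Lemma reaches_shift M pre post pc mu pc' mu' :
  reaches M (pc, mu) (pc', mu') ->
  reaches (pre ++ map (shift_instr (size pre) (size M)) M ++ post)
    (size pre + minn pc (size M), mu) (size pre + minn pc' (size M), mu').
Proof.
case=> N; elim: N pc mu => [|N IHN] pc mu.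
  by move=> [-> ->]; exact: reaches_refl.
rewrite iterSr; case E : (mstep M (pc, mu)) => [pc1 mu1] /IHN.
have [Mpc|pcM] := leqP (size M) pc.
  move: E; rewrite /mstep /= onth_default// => -[<- <-].
  by rewrite !(minn_idPr Mpc).
have := pcM; rewrite -onthTE; case Ei : (onth M pc) => [i|//] _.
move=> IH; apply: reaches_step; move: IH.
rewrite /mstep /= onth_cat ltnNge leq_addr /= addKn.
rewrite onth_cat size_map pcM onth_map Ei /=.
move: E; rewrite /mstep /= Ei; case: i Ei => [r|r q] Ei.
  by move=> [<- <-] /=; rewrite (minn_idPl pcM) addnS.
by rewrite /=; case: (mu r) => [|x] [<- <-] //=; rewrite (minn_idPl pcM) addnS.
Qed.

Definition halts M mu := exists N, size M <= (iter N (mstep M) (0, mu)).1.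

Lemma mstep_halted M (c : config) : size M <= c.1 -> mstep M c = c.
Proof. by move=> Mc; rewrite /mstep onth_default. Qed.

Definition instr_reg (i : instr) := match i with Inc r => r | Dec r _ => r end.

(* The final [Dec 0 N] loops when the answer is 0 and halts when it is 1. *)
Lemma diag_machine M (p : prog) (f : nat -> nat) :
  (forall x, runs_to p (mem4 x 0 0 0) (mem4 (f x) 0 0 0)) ->
  exists D, [/\ 0 < size D,
    forall b, 0 < b -> all (fun i => instr_reg i < b) (p 0) ->
      all (fun i => instr_reg i < b) M -> all (fun i => instr_reg i < b) D &
    forall x,
  (computes M (f x) 1 -> halts D (upd (fun=> 0) 0 x)) /\
  (computes M (f x) 0 -> ~ halts D (upd (fun=> 0) 0 x))].
Proof.
move=> hp; pose o := size (p 0).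
pose N := o + size M.
pose D := p 0 ++ map (shift_instr o (size M)) M ++ [:: Dec 0 N].
have sD : size D = N.+1 by rewrite /D !size_cat size_map addn1 addnS.
exists D; rewrite sD; split=> // [b b0 hp0 hM|x].
  rewrite /D !all_cat hp0 all_map /= b0 /= andbT; apply: sub_all hM => i.
  by case: i.
have run y : computes M (f x) y ->
    exists2 mu, mu 0 = y & reaches D (0, upd (fun=> 0) 0 x) (N, mu).
  case=> K; case E : (iter _ _ _) => [pc mu] [/= Mpc muy]; exists mu => //.
  rewrite mem4E; apply: (reaches_trans (hp x [::] _)).
  have := @reaches_shift M (p 0) [:: Dec 0 N] 0 _ pc mu (ex_intro _ K E).
  by rewrite min0n addn0 (minn_idPr Mpc) mem4E.
have DN mu : mstep D (N, mu) = if mu 0 is y.+1 then (N.+1, upd mu 0 y) else (N, mu).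
  rewrite /mstep /= /D catA onth_cat size_cat size_map -/o -/N ltnn subnn /=.
  by case: (mu 0).
split=> /run[mu mu0 [K EK]].
  by exists K.+1; rewrite iterS EK DN mu0 sD.
move=> [L]; set s0 := (0, _) in EK *; rewrite leqNgt => /negP; apply.
have stay j : iter j (mstep D) (N, mu) = (N, mu).
  by elim: j => //= j ->; rewrite DN mu0.
have halted j : size D <= (iter L (mstep D) s0).1 ->
    iter j (mstep D) (iter L (mstep D) s0) = iter L (mstep D) s0.
  by move=> h; elim: j => //= j ->; rewrite mstep_halted.
rewrite ltnNge; apply/negP => h.
(* After [K + L] steps the machine would be both frozen outside the program and still waiting at
   address [N]. *)
have := halted K h; rewrite -iterD addnC iterD EK stay => E.
by move: h; rewrite -E /= sD ltnn.
Qed.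

(** The constants in the input program depend on the number of clocks, hence on the number of
    registers of D. A bound on its registers that does not depend on these constants allows the
    number of clocks to be chosen beforehand. *)
Definition small_regs (p : prog) := forall o, all (fun i => instr_reg i < 5) (p o).

Lemma small_seq p q : small_regs p -> small_regs q -> small_regs (seqp p q).
Proof. by move=> hp hq o; rewrite /seqp all_cat hp hq. Qed.

Lemma small_incs r n : r < 5 -> small_regs (incsp r n).
Proof. by move=> r5; elim: n => //= n IHn; apply: small_seq => // o; rewrite /= r5. Qed.

Lemma small_loop r p : r < 5 -> small_regs p -> small_regs (loopp r p).
Proof. by move=> r5 hp o; rewrite /= r5 all_cat hp. Qed.

Lemma small_move r q : r < 5 -> q < 5 -> small_regs (movep r q).
Proof. by move=> r5 q5; apply: small_loop => // o; rewrite /= q5. Qed.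

Lemma small_aff p q : small_regs (affp p q).
Proof.
apply: small_seq; first by apply: small_loop => //; exact: small_incs.
by apply: small_seq; [exact: small_move|exact: small_incs].
Qed.

Lemma small_exp2 : small_regs exp2p.
Proof. by apply: small_loop => //; exact: small_aff. Qed.

Lemma small_cons t : small_regs (consp t).
Proof.
apply: small_seq; first exact: small_move.
by apply: small_seq; [exact: small_incs|exact: small_exp2].
Qed.

Lemma small_input hs rest tl : small_regs (inputp hs rest tl).
Proof.
apply: small_seq; first exact: small_loop.
apply: small_seq; first by apply: small_seq => //; exact: small_exp2.
apply: small_seq; first exact: small_cons.
apply: small_seq; first exact: small_aff.
apply: small_seq; first exact: small_cons.
apply: small_seq; first exact: small_cons.
apply: small_seq.
  by elim: hs => //= h hs IHhs; apply: small_seq IHhs _; exact: small_aff.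
apply: small_seq; first exact: small_aff.
by apply: small_seq; [exact: small_move|exact: small_exp2].
Qed.

Lemma regs_bound M : exists b, all (fun i => instr_reg i < b) M.
Proof.
elim: M => [|i M [b hb]]; first by exists 0.
exists (maxn b (instr_reg i).+1); rewrite /= leq_maxr; apply: sub_all hb => j jb.
by rewrite (leq_trans jb)// leq_maxl.
Qed.

End Minsky.

(** * Measurability in timed automata *)

Section Automata.
Context {R : realType} {n k : nat}.
Variable A : timed_automaton n k.
Implicit Types (v : k.-tuple R) (s : state R n k) (e : edge n k) (t u : R).

Lemma tnth_elapse v t x : tnth (elapse v t) x = tnth v x + t.
Proof. by rewrite tnth_mktuple. Qed.

Lemma tnth_reset v C x : tnth (reset v C) x = if x \in C then 0 else tnth v x.
Proof. by rewrite tnth_mktuple. Qed.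

Lemma elapse0 v : elapse v 0 = v.
Proof. by apply: eq_from_tnth => x; rewrite tnth_elapse addr0. Qed.

(** Constraints define convex sets of valuations, so an invariant holds during a whole delay as soon
    as it holds at both ends. This turns [trans] into the boolean [stepb], whose measurability is
    elementary. *)
Lemma sat_elapse_convex v g t u : 0 <= u <= t ->
  sat v g -> sat (elapse v t) g -> sat (elapse v u) g.
Proof.
move=> /andP[u0 ut]; elim: g => //= -[[x c] a] g IHg /andP[h1 h2] /andP[h3 h4].
rewrite IHg// andbT.
by move: h1 h3; rewrite /= !tnth_elapse; case: c => /=; lra.
Qed.

Definition stateb s := all (fun x => 0 <= tnth s.2 x) (enum 'I_k) && sat s.2 (Defs.inv A s.1).

Lemma statebP s : reflect (is_state A s) (stateb s).
Proof.
apply: (iffP andP) => -[h1 h2]; split=> //.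
  by move=> x; apply: (allP h1); rewrite mem_enum.
by apply/allP => x _; exact: h1.
Qed.

Definition stepb s e t := [&& e \in edges A, src e == s.1, stateb s, 0 <= t,
  sat (elapse s.2 t) (guard e), sat (elapse s.2 t) (Defs.inv A s.1) &
  stateb (move s (t, e))].

Lemma transP s t e s' : trans A s t e s' <-> stepb s e t /\ s' = move s (t, e).
Proof.
split=> [[[eA es] [/statebP h1 t0] h2 h3 [-> /statebP h4]]|].
  split=> //; rewrite /stepb eA es eqxx h1 t0 h2 h4 /= andbT.
  by apply: h3; rewrite t0 lexx.
case=> /and5P[eA /eqP es h1 t0 /and3P[h2 h3 h4]] ->; split=> //.
- by split=> //; exact/statebP.
- move=> u ut; apply: sat_elapse_convex h3 => //.
  by case/andP: h1.
- by split=> //; exact/statebP.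
Qed.

Lemma delays_ofP s e t : delays_of A s e t <-> stepb s e t.
Proof.
split=> [[s' /transP[]//]|h]; first by exists (move s (t, e)); apply/transP.
Qed.

Lemma delaysP s t : delays A s t <-> has (fun e => stepb s e t) (edges A).
Proof.
split=> [[e /= eA /delays_ofP h]|/hasP[e eA h]].
  by apply/hasP; exists e.
by exists e => //=; apply/delays_ofP.
Qed.

Lemma delays_of_sub s e : delays_of A s e `<=` delays A s.
Proof.
by move=> t h; exists e => //=; move/delays_ofP: h => /andP[].
Qed.

Lemma stateb_elapse s t u : 0 <= u <= t -> stateb s ->
  sat (elapse s.2 t) (Defs.inv A s.1) -> stateb (s.1, elapse s.2 u).
Proof.
move=> ut /andP[h1 h2] h3; apply/andP; split=> /=; last exact: sat_elapse_convex h3.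
apply/allP => x xk; rewrite tnth_elapse addr_ge0//; first exact: (allP h1).
by case/andP: ut.
Qed.

Lemma is_run_rcons s h m : is_run A s (rcons h m) <->
  is_run A s h /\ trans A (state_after s h) m.1 m.2 (move (state_after s h) m).
Proof.
elim: h s => [|m' h IHh] s /=; last by rewrite IHh; split=> [[? []]|[[]]].
split=> [[h1 h2]|[h1 h2]]; split=> //; first by case: h1 => _ [].
by case: h2 => _ _ _ _ [].
Qed.

Lemma is_run_state s h : is_run A s h -> is_state A (state_after s h).
Proof.
by elim: h s => //= m h IHh s [_] /IHh.
Qed.

Section Measurability.
Context d (W : measurableType d).
Implicit Types (w : W -> k.-tuple R) (f : W -> R).
Local Notation mclocks w := (forall x, measurable_fun setT (fun o => tnth (w o) x)).

Lemma measurable_sat w g : mclocks w -> measurable_fun setT (fun o => sat (w o) g).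
Proof.
move=> mw; elim: g => [|[[x c] a] g IHg] /=; first exact: measurable_cst.
apply: measurable_and => //.
by case: c => /=; [exact: measurable_fun_ltr|exact: measurable_fun_ler|
  exact: measurable_fun_eqr|exact: measurable_fun_ler|exact: measurable_fun_ltr].
Qed.

Lemma mclocks_elapse w f : mclocks w -> measurable_fun setT f ->
  mclocks (fun o => elapse (w o) (f o)).
Proof.
move=> mw mf x; under eq_fun do rewrite tnth_elapse.
exact: measurable_funD.
Qed.

Lemma mclocks_reset w C : mclocks w -> mclocks (fun o => reset (w o) C).
Proof.
move=> mw x; under eq_fun do rewrite tnth_reset.
by case: (x \in C) => /=; [exact: measurable_cst|exact: mw].
Qed.

Lemma measurable_stateb l w : mclocks w -> measurable_fun setT (fun o => stateb (l, w o)).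
Proof.
move=> mw; rewrite /stateb/=; apply: measurable_and; last exact: measurable_sat.
elim: (enum _) => [|x xs IHxs] /=; first exact: measurable_cst.
by apply: measurable_and => //; exact: measurable_fun_ler.
Qed.

Lemma measurable_stepb l w e f : mclocks w -> measurable_fun setT f ->
  measurable_fun setT (fun o => stepb (l, w o) e (f o)).
Proof.
move=> mw mf; rewrite /stepb/=.
have mE := mclocks_elapse mw mf.
apply: measurable_and; first exact: measurable_cst.
apply: measurable_and; first exact: measurable_cst.
apply: measurable_and; first exact: measurable_stateb.
apply: measurable_and; first exact: measurable_fun_ler.
apply: measurable_and; first exact: measurable_sat.
apply: measurable_and; first exact: measurable_sat.
apply: measurable_stateb; exact: mclocks_reset.
Qed.

Lemma measurable_delaysb l w f : mclocks w -> measurable_fun setT f ->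
  measurable_fun setT (fun o => has (fun e => stepb (l, w o) e (f o)) (edges A)).
Proof.
move=> mw mf; elim: (edges A) => [|e es IHes] /=; first exact: measurable_cst.
by apply: measurable_or => //; exact: measurable_stepb.
Qed.

Fixpoint runb s (h : seq (R * edge n k)) : bool :=
  if h is m :: h' then stepb s m.2 m.1 && runb (move s m) h' else stateb s.

Lemma runP s h : is_run A s h <-> runb s h.
Proof.
elim: h s => [|m h IHh] s /=; first by split=> /statebP.
rewrite IHh; split=> [[/transP[h1 _] ->]|/andP[h1 ->]]; first by rewrite h1.
by split=> //; apply/transP; split=> //; case: m h1.
Qed.

Lemma measurable_runb l w (fs : seq (W -> R)) (es : seq (edge n k)) :
  mclocks w -> (forall f, f \in fs -> measurable_fun setT f) ->
  measurable_fun setT (fun o => runb (l, w o) (zip [seq f o | f <- fs] es)).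
Proof.
elim: fs es l w => [|f fs IHfs] [|e es] l w mw mfs /=; try exact: measurable_stateb.
have mf : measurable_fun setT f by apply: mfs; rewrite mem_head.
apply: measurable_and; first exact: measurable_stepb.
apply: IHfs => [|g gfs]; last by apply: mfs; rewrite inE gfs orbT.
by apply: mclocks_reset; apply: mclocks_elapse.
Qed.

End Measurability.
End Automata.

Lemma measurable_inv {R : realType} : measurable_fun [set: R] (@GRing.inv R).
Proof.
have mE : measurable [set x : R | x != 0].
  by apply: open_measurable; exact: open_neq.
have -> : [set: R] = [set x | x != 0] `|` [set 0].
  apply/seteqP; split=> // x _ /=.
  by have [->|] := eqVneq x 0; [right|left].
apply/measurable_funU => //; split; last exact: measurable_fun_set1.
apply: open_continuous_measurable_fun; first exact: open_neq.
by move=> x; rewrite inE => x0; exact: inv_continuous.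
Qed.

(** * Games with uniform delay distributions *)

Section UniformGame.
Context {R : realType} {n k : nat}.
Variable A : timed_automaton n k.
Local Notation leb := (@lebesgue_measure R).

Lemma measurable_prop d (W : measurableType d) (b : W -> bool) (P : W -> Prop) :
  measurable_fun setT b -> (forall o, P o <-> b o) -> measurable [set o | P o].
Proof.
move=> mb Pb; have -> : [set o | P o] = setT `&` b @^-1` [set true].
  by rewrite setTI; apply/seteqP; split=> o /= /Pb.
exact: mb.
Qed.

Lemma measurable_delays_of (s : state R n k) e :
  measurable (delays_of A s e : set (measurableTypeR R)).
Proof.
apply: measurable_prop (fun t => delays_ofP A s e t).
by case: s => l v; apply: measurable_stepb.
Qed.

Lemma measurable_delays (s : state R n k) :
  measurable (delays A s : set (measurableTypeR R)).
Proof.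
apply: measurable_prop (fun t => delaysP A s t).
by case: s => l v; apply: measurable_delaysb.
Qed.

(** [mnormalize] falls back on the Dirac mass at 0 when the delay set has Lebesgue measure 0 or
    infinity. For a delay set reduced to 0 this is the discrete uniform distribution, so one formula
    serves all states of Nature. *)
Definition unif_mu (s : state R n k) : probability (measurableTypeR R) R :=
  mnormalize (mrestr leb (measurable_delays s)) (dirac (0 : measurableTypeR R)).

Lemma unif_muE s B : unif_mu s B =
  if (leb (delays A s) == 0%E) || (leb (delays A s) == +oo%E)
  then \d_(0 : measurableTypeR R) B
  else (leb (B `&` delays A s) * (fine (leb (delays A s)))^-1%:E)%E.
Proof. by rewrite /unif_mu /= /mnormalize /= /mrestr setTI; case: ifP. Qed.

Variable ow : 'I_n.+1 -> owner_kind.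
Hypothesis delaysP0 : forall s, is_state A s -> ow s.1 = Nature ->
  delays A s = [set 0] \/ (0 < leb (delays A s) < +oo)%E.

Lemma unif_mu_delays s : is_state A s -> ow s.1 = Nature ->
  unif_mu s (delays A s) = 1%E.
Proof.
move=> sA sN; rewrite unif_muE.
have [E|/andP[h1 h2]] := delaysP0 sA sN.
  by rewrite E lebesgue_measure_set1 eqxx /= diracE mem_set.
rewrite gt_eqF// lt_eqF//= setIid.
have f : leb (delays A s) \is a fin_num by rewrite ge0_fin_numE// ltW.
rewrite -{1}(fineK f) -EFinM mulfV//.
by rewrite fine_eq0// gt_eqF.
Qed.

Lemma unif_mu_lebesgue s : is_state A s -> ow s.1 = Nature ->
    (0 < leb (delays A s))%E ->
    forall N : set (measurableTypeR R), measurable N -> N `<=` delays A s ->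
      unif_mu s N = 0%E <-> leb N = 0%E.
Proof.
move=> sA sN p N mN ND; rewrite unif_muE.
have [E|/andP[h1 h2]] := delaysP0 sA sN.
  by move: p; rewrite E lebesgue_measure_set1 ltxx.
rewrite gt_eqF// lt_eqF//= (setIidl ND).
have f : leb (delays A s) \is a fin_num by rewrite ge0_fin_numE// ltW.
have f0 : fine (leb (delays A s)) != 0 by rewrite fine_eq0// gt_eqF.
split=> [/eqP|->]; last by rewrite mul0e.
by rewrite mule_eq0 => /orP[/eqP//|]; rewrite eqe invr_eq0 (negbTE f0).
Qed.

(** The pairs of a valuation and an admissible delay form a measurable set, and the measure of its
    sections is measurable, as in Fubini's theorem. *)
Lemma measurable_leb_delays l (B : set (measurableTypeR R)) : measurable B ->
  measurable_fun setT (fun v : k.-tuple (measurableTypeR R) =>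
    leb (B `&` delays A (l, v))).
Proof.
move=> mB.
pose E := [set vt : k.-tuple (measurableTypeR R) * measurableTypeR R |
  (B `&` delays A (l, vt.1)) vt.2].
have mE : measurable E.
  rewrite (_ : E = snd @^-1` B `&`
      [set vt | delays A (l, vt.1) vt.2]); last by apply/seteqP; split.
  apply: measurableI.
    by rewrite -[X in measurable X]setTI; exact: measurable_snd.
  apply: (measurable_prop _ (fun vt => delaysP A (l, vt.1) vt.2)).
  apply: measurable_delaysb => [x|]; last exact: measurable_snd.
  apply: (measurableT_comp (measurable_tnth x)); exact: measurable_fst.
have := measurable_fun_xsection leb mE.
congr measurable_fun; apply/funext => v /=; congr leb.
by apply/seteqP; split=> t /=; rewrite /xsection /= inE.
Qed.

Lemma unif_mu_measurable l : ow l = Nature ->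
    forall B : set (measurableTypeR R), measurable B ->
      measurable_fun
        [set v : k.-tuple (measurableTypeR R) | is_state A (l, v)]
        (fun v => unif_mu (l, v) B).
Proof.
move=> _ B mB; apply: measurable_funTS; under eq_fun do rewrite unif_muE.
have mT : measurable_fun setT (fun v : k.-tuple (measurableTypeR R) =>
    leb (delays A (l, v))).
  by have := @measurable_leb_delays l setT measurableT; under eq_fun do rewrite setTI.
apply: measurable_fun_ifT.
- apply: measurable_or.
    apply: (measurable_fun_bool true) => //.
    have -> : (fun v : k.-tuple (measurableTypeR R) => leb (delays A (l, v)) == 0%E)
       @^-1` [set true] = (fun v => leb (delays A (l, v))) @^-1` [set 0%E].
      by apply/seteqP; split=> v /= /eqP.
    by apply: mT => //; exact: emeasurable_set1.
  apply: (measurable_fun_bool true) => //.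
  have -> : (fun v : k.-tuple (measurableTypeR R) => leb (delays A (l, v)) == +oo%E)
     @^-1` [set true] = (fun v => leb (delays A (l, v))) @^-1` [set +oo%E].
    by apply/seteqP; split=> v /= /eqP.
  by apply: mT => //; exact: emeasurable_set1.
- exact: measurable_cst.
- apply: emeasurable_funM; first exact: measurable_leb_delays.
  apply/measurable_EFinP.
  apply: (measurableT_comp measurable_inv).
  exact: measurableT_comp.
Qed.

Definition uniform_game : stg R n k :=
  @STG R n k A ow (fun=> 1%N) unif_mu (fun _ _ _ => erefl) unif_mu_delays
    unif_mu_lebesgue unif_mu_measurable.

Lemma uniform_game_uniform : uniform_stg uniform_game.
Proof.
move=> s sA sN; have [E|D] := delaysP0 sA sN; [right|left].
  split=> [|B mB]; first by rewrite /= E; exact: finite_set1.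
  change (unif_mu s B * counting (delays A s) = counting (B `&` delays A s))%E.
  rewrite unif_muE E lebesgue_measure_set1 eqxx /= diracE.
  have [h|h] := boolP (0 \in B).
    rewrite mul1e (_ : B `&` [set 0] = [set 0])//.
    by apply/setIidr => _ ->; exact: set_mem.
  rewrite mul0e (_ : B `&` [set 0] = set0).
    by rewrite measure0.
  by apply/seteqP; split=> // x [Bx x0]; move/negP: h; apply; rewrite inE -x0.
split=> // B mB; rewrite /= unif_muE; case/andP: D => D0 Doo.
rewrite gt_eqF// lt_eqF//=.
have f : leb (delays A s) \is a fin_num by rewrite ge0_fin_numE// ltW.
have f0 : fine (leb (delays A s)) != 0 by rewrite fine_eq0// gt_eqF.
by rewrite -muleA -{2}(fineK f) -EFinM mulVf// mule1.
Qed.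
End UniformGame.

HB.instance Definition _ := Countable.copy cmp (pcan_type nat_of_cmpK).
HB.instance Definition _ n k :=
  Countable.copy (edge n k) (can_type (@tuple_of_edgeK n k)).

(** * Events determined by a finite prefix of the run *)

Section Runs.
Context {R : realType} {n k : nat}.
Implicit Types (h : seq (R * edge n k)) (s : state R n k) (rho : runs R n k).
Let e0 : edge n k := point.
Let m0 : R * edge n k := (0, e0).

Lemma measurable_cylinder N (B : nat -> set (measurableTypeR R)) (es : nat -> edge n k) :
  (forall i, measurable (B i)) -> measurable (cylinder N B es : set (runs R n k)).
Proof.
by move=> mB; apply: sub_sigma_algebra; exists N, B, es.
Qed.

(** Prefixes with exact delays suffice, because Player Diamond's moves and the coins are atomic; the
    diffuse draws at the checks are covered by the extra step with a set of delays in [ext]. *)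
Definition cyl h : set (runs R n k) := [set rho | mkseq rho (size h) = h].

Lemma cylE h : cyl h = cylinder (size h) (fun i => [set (nth m0 h i).1])
  (fun i => (nth m0 h i).2).
Proof.
apply/seteqP; split=> rho /=.
  by move=> <- i; rewrite size_mkseq => ih; rewrite nth_mkseq.
move=> H; apply: (@eq_from_nth _ m0); first by rewrite size_mkseq.
move=> i; rewrite size_mkseq => ih; rewrite nth_mkseq//.
by have [] := H i ih; case: (rho i) (nth m0 h i) => [a b] [c d] /= -> ->.
Qed.

Lemma measurable_cyl h : measurable (cyl h).
Proof. by rewrite cylE; apply: measurable_cylinder => i; exact: measurable_set1. Qed.

Definition ext h (B : set (measurableTypeR R)) e : set (runs R n k) :=
  cyl h `&` [set rho | B (rho (size h)).1 /\ (rho (size h)).2 = e].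

Lemma extE h B e : ext h B e = cylinder (size h).+1
  (fun i => if i == size h then B else [set (nth m0 h i).1])
  (fun i => if i == size h then e else (nth m0 h i).2).
Proof.
rewrite /ext cylE; apply/seteqP; split=> rho /=.
  case=> H1 H2 i; rewrite ltnS leq_eqVlt => /predU1P[->|ih]; first by rewrite eqxx.
  by rewrite ltn_eqF//; exact: H1.
move=> H; split=> [i ih|]; last by have := H _ (ltnSn _); rewrite eqxx.
by have := H i (ltnW ih); rewrite ltn_eqF.
Qed.

Lemma measurable_ext h B e : measurable B -> measurable (ext h B e).
Proof.
move=> mB; rewrite extE; apply: measurable_cylinder => i.
by case: ifP => // _; exact: measurable_set1.
Qed.

Lemma ext_cyl h m : ext h [set m.1] m.2 = cyl (rcons h m).
Proof.
apply/seteqP; split=> rho; rewrite /ext /cyl /= size_rcons mkseqS.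
  by case: m => a b [-> /= [<- <-]]; rewrite -surjective_pairing.
by move=> /rcons_inj[-> ->].
Qed.

Lemma cyl_nil : cyl [::] = setT.
Proof. by apply/seteqP; split. Qed.

Lemma state_after_loc s h : (state_after s h).1 = last s.1 [seq tgt m.2 | m <- h].
Proof. by elim: h s => //= m h IHh s; rewrite IHh. Qed.

Lemma state_after_rcons s h m : state_after s (rcons h m) = move (state_after s h) m.
Proof. by rewrite /state_after foldl_rcons. Qed.

(** The location reached depends only on the edges taken, and there are countably many finite
    sequences of edges. *)
Lemma measurable_visits (T : {set 'I_n.+1}) s : measurable (visits T s).
Proof.
rewrite (_ : visits T s = \bigcup_(l in [set l : seq (edge n k) |
    last s.1 [seq tgt e | e <- l] \in T])
  cylinder (size l) (fun=> setT) (nth e0 l)).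
  rewrite bigcup_mkcond; apply: countable_bigcupT_measurable => [|l].
    exact: countableP.
  by case: ifP => // _; apply: measurable_cylinder => i; exact: measurableT.
apply/seteqP; split=> rho /=.
  case=> N; rewrite state_after_loc => H.
  exists [seq (rho i).2 | i <- iota 0 N].
    by move: H; rewrite /= /mkseq -2!map_comp; exact.
  move=> i; rewrite size_map size_iota => iN; split=> //.
  by rewrite (nth_map 0%N) ?size_iota// nth_iota.
case=> l /= lT H; exists (size l); rewrite state_after_loc.
suff -> : [seq tgt m.2 | m <- mkseq rho (size l)] = [seq tgt e | e <- l] by [].
apply: (@eq_from_nth _ ord0); first by rewrite !size_map size_iota.
move=> i; rewrite !size_map size_iota => ih.
rewrite (nth_map m0) ?size_mkseq// nth_mkseq// (nth_map e0)//.
by have [_ ->] := H i ih.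
Qed.

Variable G : stg R n k.
Variables (lamD lamB : strategy (R := R) (n := n) (k := k)) (s : state R n k).
Variable P : probability (runs R n k) R.
Hypothesis Pind : induced_measure G lamD lamB s P.

(** The integrand of [induced_measure] depends only on the prefix of the run, so it is constant on
    [cyl h]. *)
Lemma P_ext h B e : measurable B ->
  P (ext h B e) = (step_prob G lamD lamB s h B e * P (cyl h))%E.
Proof.
move=> mB; rewrite extE Pind; last first.
  by move=> i; case: ifP => // _; exact: measurable_set1.
rewrite eqxx -integral_cst; last exact: measurable_cyl.
have -> : cylinder (size h) (fun i => if i == size h then B else [set (nth m0 h i).1])
  (fun i => if i == size h then e else (nth m0 h i).2) = cyl h.
  rewrite cylE; apply/seteqP; split=> rho /= H i ih; have := H i ih;
  by rewrite ltn_eqF.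
by apply: eq_integral => rho; rewrite inE /cyl /= => ->.
Qed.

End Runs.

Section NullSet.
Context d (X : measurableType d) (R : realType) (mu : {measure set X -> \bar R}).
Import HBNNSimple.

(* Unlike the library's [ge0_negligible_integral], f need not be measurable. *)
Lemma ge0_integral_null (D A : set X) (f : X -> \bar R) :
  measurable D -> measurable A -> A `<=` D -> mu (D `\` A) = 0%E ->
  (forall x, D x -> (0 <= f x)%E) ->
  (\int[mu]_(x in D) f x = \int[mu]_(x in A) f x)%E.
Proof.
move=> mD mA AD DA0 f0.
have fA0 x : A x -> (0 <= f x)%E by move=> /AD; exact: f0.
have mDA : measurable (D `\` A) by exact: measurableD.
rewrite !ge0_integralE//; apply/eqP; rewrite eq_le; apply/andP; split.
  (* A simple function below [f] on [D] is cut down to [A] by the indicator of [A], which leaves its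
     integral unchanged. *)
  apply: ge_ereal_sup => _ /= [h hf <-].
  have [h' h'E] : exists h' : {nnsfun X >-> R}, forall x, h' x = h x * \1_A x.
    by exists (proj_nnsfun h mA) => x; rewrite /= mindicE indicE.
  have hh' : sintegral mu h = sintegral mu h'.
    rewrite -!integralT_nnsfun.
    rewrite (ge0_negligible_integral mDA)//=; last 2 first.
      exact/measurable_EFinP/measurable_funTS.
      by move=> x _; rewrite lee_fin fun_ge0.
    rewrite [RHS](ge0_negligible_integral mDA)//=; last 2 first.
      exact/measurable_EFinP/measurable_funTS.
      by move=> x _; rewrite lee_fin fun_ge0.
    apply: eq_integral => x; rewrite inE => -[_ nDA]; congr EFin.
    rewrite h'E indicE; have [/set_mem xA|xA] := boolP (x \in A); first by rewrite mulr1.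
    rewrite mulr0; apply/eqP; rewrite eq_le fun_ge0 andbT -lee_fin.
    apply: le_trans (hf x) _; rewrite patchE ifF//.
    apply/negbTE/negP => /set_mem xD; apply: nDA; split=> //.
    by move=> xA'; move/negP: xA; apply; rewrite inE.
  apply: ereal_sup_ubound; exists h' => // x.
  rewrite h'E indicE patchE; have [xA|xA] := boolP (x \in A); last by rewrite mulr0.
  rewrite mulr1; apply: le_trans (hf x) _.
  by rewrite patchE ifT// inE; apply: AD; exact: set_mem.
apply: le_ereal_sup => _ /= [h hf <-]; exists h => // x.
apply: le_trans (hf x) _; rewrite !patchE.
have [xA|xA] := boolP (x \in A).
  by rewrite ifT// inE; apply: AD; exact: set_mem.
by case: ifP => // /set_mem; exact: f0.
Qed.

End NullSet.

Lemma eq_eseries_ge (R : realType) (f g : nat -> \bar R) N :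
  (forall j, (N <= j)%N -> f j = g j) ->
  (\sum_(N <= j <oo) f j = \sum_(N <= j <oo) g j)%E.
Proof.
move=> fg; apply/congr_lim/funext => M; apply: eq_big_nat => j /andP[Nj _].
exact: fg.
Qed.

(** * Mixtures of runs leaving a fixed run *)

Section Mixture.
Context {R : realType} {n k : nat}.
Local Notation E := (edge n k).
Local Notation step := (R * edge n k)%type.
Variables (sp dv : nat -> step) (nu : nat -> probability (measurableTypeR R) R).
Variables (ef : nat -> R -> E) (lp : E -> E) (S : nat -> R).
Hypothesis mef : forall j e, measurable [set t : measurableTypeR R | ef j t = e].
Hypothesis S0 : S 0 = 1.
Hypothesis Sdec : forall j, S j.+1 <= S j.
Hypothesis Slim : S @ \oo --> 0.

(* The run that leaves the spine [sp] at step j with [dv j], then draws the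
   delay t and ends in a loop. *)
Definition leave j (t : measurableTypeR R) : runs R n k := fun i =>
  if (i < j)%N then sp i else if i == j then dv j else
  if i == j.+1 then (t, ef j t) else (0, lp (ef j t)).

Lemma measurable_lp j e : measurable [set t : measurableTypeR R | lp (ef j t) = e].
Proof.
rewrite (_ : [set t | _] = \bigcup_(e' in [set e' | lp e' = e])
    [set t : measurableTypeR R | ef j t = e']).
  rewrite bigcup_mkcond; apply: countable_bigcupT_measurable => [|e'].
    exact: countableP.
  by case: ifP.
apply/seteqP; split=> t /=; first by move=> h; exists (ef j t).
by case=> e' /= <- <-.
Qed.

Lemma measurable_leave_coord j i (B : set (measurableTypeR R)) e : measurable B ->
  measurable [set t : measurableTypeR R | B (leave j t i).1 /\ (leave j t i).2 = e].
Proof.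
move=> mB.
have mP (Q : Prop) : measurable [set t : measurableTypeR R | Q].
  have [q|q] := pselect Q.
    by rewrite (_ : [set t | _] = setT)//; apply/seteqP; split.
  by rewrite (_ : [set t | _] = set0)//; apply/seteqP; split.
rewrite /leave; case: (i < j)%N; first exact: mP.
case: (i == j); first exact: mP.
case: (i == j.+1) => /=.
  rewrite (_ : [set t | _] = B `&` [set t | ef j t = e])//.
  exact: measurableI.
rewrite (_ : [set t | _] = [set t | B 0] `&` [set t | lp (ef j t) = e])//.
by apply: measurableI; [exact: mP|exact: measurable_lp].
Qed.

Lemma measurable_leave j : measurable_fun setT (leave j).
Proof.
apply: (@measurability _ _ (measurableTypeR R) (runs R n k) setT (leave j) (@cylinders R n k)) => //.
move=> _ [_ [N [B [es [mB ->]]]] <-]; rewrite setTI.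
rewrite (_ : _ @^-1` _ = \bigcap_(i in `I_N)
  [set t | B i (leave j t i).1 /\ (leave j t i).2 = es i]); last first.
  by apply/seteqP; split=> t /= h i; exact: h.
by apply: bigcap_measurableType => i _; exact: measurable_leave_coord.
Qed.

Lemma weight_ge0 j : 0 <= S j - S j.+1.
Proof. by rewrite subr_ge0. Qed.

HB.instance Definition _ j := isMeasurableFun.Build _ _ (measurableTypeR R)
  (runs R n k) (leave j) (measurable_leave j).

Definition mixture : set (runs R n k) -> \bar R := mseries (fun j =>
  mscale (NngNum (weight_ge0 j)) (distribution (nu j) (leave j))) 0.

HB.instance Definition _ := Measure.on mixture.

(** The sum telescopes and [S] tends to 0. *)
Lemma sum_weights N : (\sum_(N <= j <oo) (S j - S j.+1)%:E = (S N)%:E)%E.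
Proof.
apply/cvg_lim => //.
have E : \forall M \near \oo, (S N - S M)%:E = (\sum_(N <= j < M) (S j - S j.+1)%:E)%E.
  near=> M; rewrite sumEFin; congr EFin.
  rewrite -[LHS]opprB -telescope_sumr; last by near: M; exact: nbhs_infty_ge.
  by rewrite -sumrN; apply: eq_bigr => j _; rewrite opprB.
apply: cvg_trans (near_eq_cvg E) _; apply: cvg_EFin; first by near=> M.
rewrite -[X in _ --> X]subr0; apply: cvgB => //; exact: cvg_cst.
Unshelve. all: by end_near. Qed.

Lemma mixtureE B : mixture B =
  (\sum_(0 <= j <oo) ((S j - S j.+1)%:E * nu j (leave j @^-1` B)))%E.
Proof. by []. Qed.

Lemma mixture_setT : mixture setT = 1%E.
Proof.
rewrite mixtureE -[RHS]/(1%:E) -S0 -sum_weights; apply: eq_eseriesr => j _.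
by rewrite preimage_setT probability_setT mule1.
Qed.

HB.instance Definition _ := Measure_isProbability.Build _ _ _ mixture mixture_setT.

Definition mixture_prob : probability (runs R n k) R := mixture.

(** [f] stands for the one-step distribution. Its values are prescribed only on the histories that
    the mixture charges: prefixes of the spine, such a prefix followed by a departure, and runs that
    have reached their loop. *)
Variable f : seq step -> set (measurableTypeR R) -> E -> \bar R.
Local Notation H := (mkseq sp).
Local Notation ind m B e := (\1_(B `*` [set e]) m)%:E.
Hypothesis f_ge0 : forall h B e, (0 <= f h B e)%E.
Hypothesis f_fin : forall N B e, measurable B -> f (H N) B e \is a fin_num.
Hypothesis f_spine : forall N B e, measurable B -> ((S N)%:E * f (H N) B e =
  (S N - S N.+1)%:E * ind (dv N) B e + (S N.+1)%:E * ind (sp N) B e)%E.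
Hypothesis f_draw : forall N B e, measurable B -> S N.+1 < S N ->
  f (rcons (H N) (dv N)) B e = nu N (B `&` [set t | ef N t = e]).
Hypothesis f_tail : forall j t i B e, S j.+1 < S j -> (j.+1 < i)%N ->
  f (mkseq (leave j t) i) B e = ind (0, lp (ef j t)) B e.
Hypothesis f_meas : forall N B es, (forall i, measurable (B i)) ->
  measurable_fun (cylinder N B es : set (runs R n k))
    (fun rho : runs R n k => f (mkseq rho N) (B N) (es N)) \/
  (forall j t, (j.+1 < N)%N -> S j.+1 < S j -> ~ cylinder N B es (leave j t)).

Lemma leave_prefix j t N : (N <= j)%N -> mkseq (leave j t) N = H N.
Proof.
move=> Nj; apply: (@eq_from_nth _ point); rewrite !size_mkseq// => i iN.
by rewrite !nth_mkseq// /leave (leq_trans iN Nj).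
Qed.

Lemma leave_prefixS j t : mkseq (leave j t) j.+1 = rcons (H j) (dv j).
Proof. by rewrite mkseqS leave_prefix// /leave ltnn eqxx. Qed.

Lemma weight0 j : ~~ (S j.+1 < S j) -> (S j - S j.+1)%:E = 0%E.
Proof.
rewrite -leNgt => h; congr EFin; apply/eqP.
by rewrite subr_eq0 eq_le h Sdec.
Qed.

Section Induced.
Variables (N : nat) (B : nat -> set (measurableTypeR R)) (es : nat -> E).
Hypothesis mB : forall i, measurable (B i).
Let C : set (runs R n k) := cylinder N B es.
Let F (rho : runs R n k) := f (mkseq rho N) (B N) (es N).

Lemma mC : measurable C. Proof. exact: measurable_cylinder. Qed.

Lemma cylinderS : cylinder N.+1 B es =
  C `&` [set rho : runs R n k | (B N `*` [set es N]) (rho N)].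
Proof.
apply/seteqP; split=> rho /=.
  by move=> h; split; [move=> i iN; apply: h; exact: ltnW|exact: h].
by move=> [h1 h2] i; rewrite ltnS leq_eqVlt => /predU1P[->//|]; exact: h1.
Qed.

Lemma C_spine j t : (N <= j)%N -> C (leave j t) <-> C sp.
Proof.
move=> Nj; split=> h i iN; have := h i iN; by rewrite /leave (leq_trans iN Nj).
Qed.

(** If the integrand is not known to be measurable on [C], then no charged run in [C] is looping
    yet. Up to mass zero the history of length [N] is then a prefix of the spine or such a prefix
    with a departure as last step, and the integrand is constant in either case. *)
Lemma measurable_support : exists A : set (runs R n k),
  [/\ measurable A, A `<=` C, measurable_fun A F &
    forall j t, S j.+1 < S j -> C (leave j t) -> A (leave j t)].
Proof.
have [mF|tail] := f_meas N es mB; first by exists C; split=> //; exact: mC.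
pose X := cyl (H N); pose Y := cyl (rcons (H N.-1) (dv N.-1)).
have [N0|N0] := posnP N.
  exists C; split=> //; first exact: mC.
  apply: (eq_measurable_fun (cst (f [::] (B N) (es N)))); last exact: measurable_cst.
  by move=> rho _; rewrite /F N0.
exists (C `&` (X `|` Y)); split.
- by apply: measurableI; [exact: mC|apply: measurableU; exact: measurable_cyl].
- by move=> rho [].
- rewrite setIUr; apply/measurable_funU.
  + by apply: measurableI; [exact: mC|exact: measurable_cyl].
  + by apply: measurableI; [exact: mC|exact: measurable_cyl].
  split.
    apply: (eq_measurable_fun (cst (f (H N) (B N) (es N)))); last exact: measurable_cst.
    move=> rho; rewrite inE => -[_]; rewrite /X /cyl /= size_mkseq => E.
    by rewrite /F E.
  apply: (eq_measurable_fun (cst (f (rcons (H N.-1) (dv N.-1)) (B N) (es N)))); last exact: measurable_cst.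
  move=> rho; rewrite inE => -[_]; rewrite /Y /cyl /= size_rcons size_mkseq prednK// => E.
  by rewrite /F E.
- move=> j t Sj Ct; split=> //.
  have [Nj|] := leqP N j; first by left; rewrite /X /cyl /= size_mkseq leave_prefix.
  rewrite leq_eqVlt => /predU1P[jN|jN]; last by have := tail j t jN Sj.
  by right; rewrite /Y /cyl /= size_rcons size_mkseq -jN /= leave_prefixS.
Qed.

Lemma mixture_integral : (\int[mixture]_(rho in C) F rho =
  \sum_(0 <= j <oo) ((S j - S j.+1)%:E *
    \int[nu j]_(t in leave j @^-1` C) F (leave j t)))%E.
Proof.
have [A [mA AC mF CA]] := measurable_support.
have E j : S j.+1 < S j -> leave j @^-1` A = leave j @^-1` C.
  by move=> Sj; apply/seteqP; split=> t /=; [exact: AC|exact: CA].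
have A0 : mixture (C `\` A) = 0%E.
  rewrite mixtureE eseries0// => j _ _.
  have [Sj|/weight0->] := boolP (S j.+1 < S j); last by rewrite mul0e.
  have -> : leave j @^-1` (C `\` A) = set0.
    by apply/seteqP; split=> t //= [] /(CA _ _ Sj).
  by rewrite measure0 mule0.
rewrite (ge0_integral_null mC mA AC A0); last by move=> rho _; exact: f_ge0.
rewrite ge0_integral_measure_series//; last by move=> rho _; exact: f_ge0.
apply: eq_eseriesr => j _.
rewrite ge0_integral_mscale//=; last by move=> rho _; exact: f_ge0.
have [Sj|/weight0->] := boolP (S j.+1 < S j); last by rewrite !mul0e.
congr (_ * _)%E; rewrite -E//.
rewrite ge0_integral_pushforward//; last by move=> rho _; exact: f_ge0.
Qed.

Let D j : set (measurableTypeR R) := [set t | (B N `*` [set es N]) (leave j t N)].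

Lemma leaveC j : leave j @^-1` cylinder N.+1 B es = leave j @^-1` C `&` D j.
Proof. by rewrite cylinderS. Qed.

(** For [N = j + 1] the step to be taken is the draw itself and the integrand is constant; for
    larger [N] it is a forced loop step and the integrand is an indicator. *)
Lemma integral_tail j : (j < N)%N -> S j.+1 < S j ->
  (\int[nu j]_(t in leave j @^-1` C) F (leave j t) =
   nu j (leave j @^-1` cylinder N.+1 B es))%E.
Proof.
rewrite leq_eqVlt leaveC => /predU1P[jN|jN] Sj.
  have FE t : F (leave j t) = nu j (D j).
    rewrite /F -jN leave_prefixS f_draw//; congr (nu j _); rewrite jN.
    by rewrite /D; apply/seteqP; split=> u /=; rewrite /leave -jN ltnNge leqnSn /= gtn_eqF// eqxx.
  (* Membership in [C] concerns the first [j + 1] steps, which do not depend on the delay drawn. *)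
  have C_all t u : C (leave j t) -> C (leave j u).
    move=> h i iN; have := h i iN; rewrite /leave.
    case: ltngtP => // ji.
    by move: iN; rewrite -jN ltnS leqNgt ji.
  under eq_integral do rewrite FE.
  rewrite integral_cst; last first.
    by rewrite -[X in measurable X]setTI; apply: measurable_leave => //; exact: mC.
  have [[t Ct]|nC] := pselect (exists t, C (leave j t)).
    have -> : leave j @^-1` C = setT.
      by apply/seteqP; split=> // u _; exact: C_all Ct.
    by rewrite setTI -[RHS]mule1; congr (_ * _)%E; exact: probability_setT.
  have -> : leave j @^-1` C = set0.
    by apply/seteqP; split=> // u Cu; apply: nC; exists u.
  by rewrite measure0 mule0 set0I measure0.
rewrite setIC -integral_indic; last first.
- exact: measurable_leave_coord.
- by rewrite -[X in measurable X]setTI; apply: measurable_leave => //; exact: mC.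
apply: eq_integral => t _; rewrite /F f_tail// !indicE; congr ((nat_of_bool _)%:R%:E).
apply/idP/idP; rewrite !inE /D /leave /=;
  by rewrite ltnNge (ltnW (ltnW jN)) /= !gtn_eqF// ltnW.
Qed.

(** The runs are sorted by their departure [j]. For [j < N] both sides agree term by term; those
    with [N <= j] share the prefix [H N], and [f_spine] divides their total weight [S N] between
    leaving now and going on. *)
Lemma mixture_induced : (mixture (cylinder N.+1 B es) =
  \int[mixture]_(rho in C) f (mkseq rho N) (B N) (es N))%E.
Proof.
rewrite mixture_integral mixtureE.
rewrite (nneseries_split 0 N); last by move=> j _; rewrite mule_ge0// lee_fin weight_ge0.
rewrite [RHS](nneseries_split 0 N); last first.
  by move=> j _; rewrite mule_ge0 ?lee_fin ?weight_ge0// integral_ge0// => t _; exact: f_ge0.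
congr (_ + _)%E.
  rewrite !big_mkord; apply: eq_bigr => j _.
  have [Sj|/weight0->] := boolP (S j.+1 < S j); last by rewrite !mul0e.
  by rewrite integral_tail.
rewrite add0n.
have IE j : (N <= j)%N -> (\int[nu j]_(t in leave j @^-1` C) F (leave j t) =
    f (H N) (B N) (es N) * nu j (leave j @^-1` C))%E.
  move=> Nj; rewrite -integral_cst; last first.
    by rewrite -[X in measurable X]setTI; apply: measurable_leave => //; exact: mC.
  by apply: eq_integral => t _; rewrite /F leave_prefix.
have [Csp|nC] := pselect (C sp); last first.
  have C0 j : (N <= j)%N -> leave j @^-1` C = set0.
    by move=> Nj; apply/seteqP; split=> // t /(C_spine t Nj).
  rewrite !eseries0// => j Nj _; first by rewrite IE// C0// measure0 !mule0.
  by rewrite leaveC C0// set0I measure0 mule0.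
have CT j : (N <= j)%N -> leave j @^-1` C = setT.
  by move=> Nj; apply/seteqP; split=> // t _; exact/(C_spine t Nj).
have -> : (\sum_(N <= j <oo) (S j - S j.+1)%:E *
    \int[nu j]_(t in leave j @^-1` C) F (leave j t) =
    (S N)%:E * f (H N) (B N) (es N))%E.
  rewrite -sum_weights muleC -(fineK (f_fin N (es N) (mB N))) -nneseriesZl; last first.
    by move=> j _; rewrite lee_fin weight_ge0.
  apply: eq_eseries_ge => j Nj.
  by rewrite IE// CT// probability_setT mule1 fineK ?f_fin// muleC.
have D_cst j m : (forall t, leave j t N = m) -> nu j (D j) = ind m (B N) (es N).
  move=> Em; rewrite indicE; have [h|h] := boolP (m \in _).
    rewrite (_ : D j = setT) ?probability_setT//.
    by apply/seteqP; split=> // t _; rewrite /D /= Em; exact: set_mem.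
  rewrite (_ : D j = set0) ?measure0//.
  by apply/seteqP; split=> // t; rewrite /D /= Em => /mem_set; exact/negP.
(* The term [j = N] leaves the spine at this very step, whereas all later ones take [sp N]. *)
rewrite (nneseries_split _ 1); last first.
  by move=> j _; rewrite mule_ge0// lee_fin weight_ge0.
rewrite addn1 big_nat1 f_spine//; congr (_ + _)%E.
  rewrite leaveC CT// setTI (D_cst _ (dv N))// => t.
  by rewrite /leave ltnn eqxx.
rewrite -sum_weights muleC -nneseriesZl; last by move=> j _; rewrite lee_fin weight_ge0.
apply: eq_eseries_ge => j Nj; rewrite leaveC CT ?(ltnW Nj)// setTI muleC.
by rewrite (D_cst _ (sp N))// => t; rewrite /leave Nj.
Qed.

End Induced.
End Mixture.

(** * The game of a register machine *)

Section Clocks.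
Variable m' : nat.
Local Notation m := m'.+2.
Local Notation k := (m + m).+1.

(* In a phase of parity p, the clocks [clk p r] carry the registers: when zc = 0
   the content c of register r is represented by clk p r = r + 2^-c.  The clocks
   [clk (~~ p) r] receive the values for the next phase. *)
Definition clk (p : bool) (r : 'I_m) : 'I_k := inord (r + p * m).
Definition zc : 'I_k := ord_max.

Lemma val_clk p r : val (clk p r) = (r + p * m)%N.
Proof. rewrite /clk /= inordK//; case: p => /=; have := ltn_ord r; lia. Qed.

Lemma clk_inj p r p' r' : clk p r = clk p' r' -> p = p' /\ r = r'.
Proof.
move=> /(congr1 val); rewrite !val_clk => h.
have := ltn_ord r; have := ltn_ord r'; move: h.
by case: p; case: p' => /= h h1 h2; split; try apply: val_inj => /=; lia.
Qed.

Lemma clk_eq p r p' r' : (clk p r == clk p' r') = (p == p') && (r == r').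
Proof.
apply/eqP/andP => [/clk_inj[-> ->]//|[/eqP-> /eqP->]//].
Qed.

Lemma clk_zc p r : (clk p r == zc) = false.
Proof.
apply/eqP => /(congr1 val); rewrite val_clk /=; have := ltn_ord r.
by case: p => /=; lia.
Qed.

Lemma zc_clk p r : (zc == clk p r) = false.
Proof. by rewrite eq_sym clk_zc. Qed.

End Clocks.

Arguments zc {m'}.

Section Gadget.
Variables (D : seq instr) (m' : nat).
Local Notation m := m'.+2.
Local Notation k := (m + m).+1.
Hypothesis D0 : (0 < size D)%N.

(** Program counter, parity of the phase, and stage: either the number of new clocks still to be
    reset, or the branch, the register under examination, which of its two coins, and whether this
    coin has led to a check. *)
Definition place : finType :=
  ('I_(size D) * bool * ('I_m.+1 + bool * 'I_m * bool * bool))%type.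
Local Notation n := #|place|.+1.
Local Notation E := (edge n k).

Definition place0 : place := (Ordinal D0, false, inl ord_max).

Lemma card_place : (0 < #|place|)%N.
Proof. by apply/card_gt0P; exists place0. Qed.

(* The transposition gives the initial location the number 2: like the number 0
   of [lose], it occurs in the code of the instance and must not depend on D. *)
Definition swap0 : {perm 'I_#|place|} := tperm (enum_rank place0) (Ordinal card_place).

Definition enc (x : 'I_2 + place) : 'I_n.+1 :=
  match x with
  | inl i => lshift #|place| i
  | inr y => rshift 2 (swap0 (enum_rank y))
  end.

Definition dec (l : 'I_n.+1) : 'I_2 + place :=
  match fintype.split (l : 'I_(2 + #|place|)) with
  | inl i => inl i
  | inr j => inr (enum_val (swap0 j))
  end.

Lemma encK : cancel enc dec.
Proof.
case=> [i|y]; rewrite /dec /enc.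
  by rewrite (unsplitK (inl i)).
by rewrite (unsplitK (inr _)) tpermK enum_rankK.
Qed.

Lemma decK : cancel dec enc.
Proof.
move=> l; rewrite /dec /enc; case: splitP => j lj; apply: val_inj => //=.
by rewrite enum_valK tpermK.
Qed.

Definition lose := enc (inl ord0).
Definition win := enc (inl ord_max).
Definition guessing pc p j := enc (inr (pc, p, inl j)).
Definition coin pc p b q s := enc (inr (pc, p, inr (b, q, s, false))).
Definition check pc p b q s := enc (inr (pc, p, inr (b, q, s, true))).
Definition start := guessing (Ordinal D0) false ord_max.

Lemma val_lose : val lose = 0%N. Proof. by []. Qed.
Lemma val_start : val start = 2%N.
Proof. by rewrite /start /guessing /enc /= tpermL. Qed.

Definition ins (pc : 'I_(size D)) := nth (Inc 0) D pc.

(* In the branch b, the new value y and the old value x of register r must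
   satisfy [al * x = be * y]. *)
Definition al pc (b : bool) (r : nat) : nat :=
  if ins pc is Dec r0 _ then if (r0 == r) && ~~ b then 2 else 1 else 1.
Definition be pc (r : nat) : nat :=
  if ins pc is Inc r0 then if r0 == r then 2 else 1 else 1.

Definition jump (pc : 'I_(size D)) (b : bool) : nat :=
  if ins pc is Dec _ q then if b then q else pc.+1 else pc.+1.

(** The guard is evaluated when [zc = m]; at that instant the clock of a register shows [r0 + m + 1]
    if the content is 0, and less otherwise. *)
Definition test pc p (b : bool) : constr k :=
  if ins pc is Dec r0 _ then
    [:: (clk p (inord r0), if b then CEq else CLt, (r0 + 1 + m)%N)]
  else [::].

Definition jump_loc pc p b : 'I_n.+1 :=
  if insub (jump pc b) is Some pc' then guessing pc' (~~ p) ord_max else lose.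

Definition loop i : E := Edge (enc (inl i)) [::] finset.set0 (enc (inl i)).

(** In order to show [j + y] when [zc = m], the new clock [j] must be reset at [zc = m - j - y]. As
    [0 < y <= 1], these instants lie in disjoint windows, so the resets can be made in the fixed
    order of decreasing [j]. This is the purpose of the offset [r] in the value of the clock of
    register [r]. *)
Definition guess pc p (j : 'I_m) : E :=
  Edge (guessing pc p (lift ord0 j)) [::] (finset.set1 (clk (~~ p) j))
    (guessing pc p (widen_ord (leqnSn m) j)).

(** A strategy must have a move after every run, even when the guesses made can no longer pass
    [exit_guard]. Conceding is always possible and loses for certain. *)
Definition concede pc p : E := Edge (guessing pc p ord0) [::] finset.set0 lose.

Definition exit_guard pc p b : constr k :=
  (zc, CEq, m) :: test pc p b ++
  flatten [seq [:: (clk (~~ p) r, CGt, val r); (clk (~~ p) r, CLe, r.+1)]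
          | r <- enum 'I_m].

Definition exit pc p b : E :=
  Edge (guessing pc p ord0) (exit_guard pc p b) finset.set0
    (coin pc p b ord_max false).

(** The registers are examined from the last to the first. After the final coin [zc] is reset and
    the change of parity turns the new clocks into the old ones. *)
Definition cont pc p b (q : 'I_m) (s : bool) : E :=
  if ~~ s then Edge (coin pc p b q s) [::] finset.set0 (coin pc p b q true) else
  if q == ord0 then Edge (coin pc p b q s) [::] (finset.set1 zc) (jump_loc pc p b)
  else Edge (coin pc p b q s) [::] finset.set0 (coin pc p b (inord q.-1) false).

Definition inspect pc p b q s : E :=
  Edge (coin pc p b q s) [::] (finset.set1 zc) (check pc p b q s).

(* A delay belongs to the slot ((c, i), (d, j)) if it makes c > i and d <= j. *)
Definition slot := ('I_k * nat * ('I_k * nat))%type.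

(** For [s = false] the slots measuring [x] and [y] have total length [al x + be (1 - y)], followed
    by a filler of length [4 - be]; for [s = true] they have total length [al (1 - x) + be y] and
    the filler has length [2 - al]. The fillers compensate the integer parts, and are nonnegative
    since [al] and [be] are at most 2. *)
Definition fail_lo pc b (q : 'I_m) (s : bool) : nat :=
  if s then be pc q + 2 else al pc b q + 4.
Definition fail_hi pc b (q : 'I_m) (s : bool) : nat :=
  if s then be pc q + 3 else al pc b q + 6.

Definition fail_slot pc b q s : slot :=
  ((zc, fail_lo pc b q s), (zc, fail_hi pc b q s)).

(* When zc = 0, old = q + m + x and new = q + y, the slots are disjoint and have
   the total length 6 + (al x - be y) if s = false and 3 - (al x - be y) if
   s = true, while the failing one has length 2, resp. 1. *)
Definition slots pc p b (q : 'I_m) (s : bool) : seq slot :=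
  let a := al pc b q in let c := be pc q in
  let old := clk p q in let new := clk (~~ p) q in
  (if s then
     [seq ((zc, i), (old, (q + m + i.+1)%N)) | i <- iota 0 a] ++
     [seq ((new, (q + i.+1)%N), (zc, i.+1)) | i <- iota a c]
   else
     [seq ((old, (q + m + i.+1)%N), (zc, i.+1)) | i <- iota 0 a] ++
     [seq ((zc, i), (new, (q + i.+1)%N)) | i <- iota a c]) ++
  [:: ((zc, (a + c)%N), (zc, fail_lo pc b q s)); fail_slot pc b q s].

Definition draw pc p b q s (x : slot) : E :=
  Edge (check pc p b q s) [:: (x.1.1, CGt, x.1.2); (x.2.1, CLe, x.2.2)]
    finset.set0 (if x == fail_slot pc b q s then lose else win).

Definition out (x : 'I_2 + place) : seq E :=
  match x with
  | inl i => [:: loop i]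
  | inr (pc, p, inl j) =>
      if unlift ord0 j is Some j' then [:: guess pc p j'] else
      [:: concede pc p; exit pc p false; exit pc p true]
  | inr (pc, p, inr (b, q, s, false)) => [:: cont pc p b q s; inspect pc p b q s]
  | inr (pc, p, inr (b, q, s, true)) => [seq draw pc p b q s x | x <- slots pc p b q s]
  end.

Lemma src_out x e : e \in out x -> src e = enc x.
Proof.
case: x => [i|[[pc p] [j|[[[b q] s] []]]]] /=.
- by rewrite inE => /eqP->.
- case: unliftP => [j'|] ->; rewrite !inE; first by move/eqP->.
  by case/or3P => /eqP->.
- by case/mapP => x _ ->.
- rewrite !inE => /orP[] /eqP-> //=; rewrite /cont.
  by case: s => //=; case: eqP.
Qed.

Definition all_edges : seq E := undup (flatten [seq out x | x <- enum {: 'I_2 + place}]).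

(** At a coin the invariant leaves 0 as the only delay. At a check the strict bound leaves a part of
    the failing slot to every state, so the delay set has positive and finite measure. *)
Definition inv_of (x : 'I_2 + place) : constr k :=
  match x with
  | inr (_, _, inr (_, _, _, false)) => [:: (zc, CEq, m)]
  | inr (pc, _, inr (b, q, s, true)) => [:: (zc, CLt, fail_hi pc b q s)]
  | _ => [::]
  end.

Definition automaton : timed_automaton n k :=
  TimedAutomaton (undup_uniq _ : uniq all_edges) (fun l => inv_of (dec l)).

Lemma mem_edges e : (e \in edges automaton) = (e \in out (dec (src e))).
Proof.
rewrite mem_undup; apply/flatten_mapP/idP => [[x _ ex]|h].
  by rewrite (src_out ex) encK.
by exists (dec (src e)) => //; rewrite mem_enum.
Qed.

Definition owner_of (x : 'I_2 + place) : owner_kind :=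
  if x is inr (_, _, inr _) then Nature else PDiamond.

End Gadget.

(** * Transitions and delay sets of the game *)

Section Semantics.
Context {R : realType}.
Variables (D : seq instr) (m' : nat).
Local Notation m := m'.+2.
Local Notation k := (m + m).+1.
Hypothesis D0 : (0 < size D)%N.
Local Notation place := (place D m').
Local Notation n := #|place|.+1.
Local Notation E := (edge n k).
Local Notation A := (automaton m' D0).
Local Notation enc := (@enc D m' D0).
Local Notation dec := (@dec D m' D0).
Local Notation leb := (@lebesgue_measure R).
Implicit Types (v : k.-tuple R) (t u : R) (s : state R n k) (e : E).

Definition nonneg v := forall x, 0 <= tnth v x.

Lemma inv_enc x : Defs.inv A (enc x) = inv_of x.
Proof. by rewrite /= encK. Qed.

Lemma stateE x v : is_state A (enc x, v) <-> nonneg v /\ sat v (inv_of x).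
Proof. by rewrite /is_state /= encK. Qed.

Lemma nonneg_elapse v t : nonneg v -> 0 <= t -> nonneg (elapse v t).
Proof. by move=> v0 t0 x; rewrite tnth_elapse addr_ge0. Qed.

Lemma nonneg_reset v C : nonneg v -> nonneg (reset v C).
Proof. by move=> v0 x; rewrite tnth_reset; case: ifP. Qed.

Lemma reset0 v : reset v finset.set0 = v.
Proof. by apply: eq_from_tnth => x; rewrite tnth_reset inE. Qed.

Lemma stepP x v e t : stepb A (enc x, v) e t <->
  [/\ e \in out D0 x /\ is_state A (enc x, v), 0 <= t,
      sat (elapse v t) (guard e), sat (elapse v t) (inv_of x) &
      is_state A (move (enc x, v) (t, e))].
Proof.
rewrite /stepb mem_edges inv_enc; split.
  case/and5P => h1 /eqP h2 /statebP h3 h4 /and3P[h5 h6 /statebP h7].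
  by split=> //; split=> //; move: h1; rewrite h2 encK.
case=> -[h1 /statebP h3] h4 h5 h6 /statebP h7; apply/and5P; split=> //.
- by rewrite (src_out h1) encK.
- by rewrite (src_out h1).
- by rewrite h5 h6.
Qed.

Lemma guard_cont pc p b (q : 'I_m) sg : guard (cont D0 pc p b q sg) = [::].
Proof. by rewrite /cont; case: sg => //=; case: eqP. Qed.

Lemma src_cont pc p b (q : 'I_m) sg : src (cont D0 pc p b q sg) = coin D0 pc p b q sg.
Proof. by rewrite /cont; case: sg => //=; case: eqP. Qed.

Lemma coin_step s pc p b q sg e t : s.1 = coin D0 pc p b q sg ->
  is_state A s ->
  stepb A s e t <-> t = 0 /\ e \in out D0 (inr (pc, p, inr (b, q, sg, false))).
Proof.
case: s => l v /= -> sA; rewrite stepP.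
have [v0 /=] := (stateE _ _).1 sA; rewrite andbT => /eqP zm.
split=> [[[h1 _] _ _ /=]|[-> h]].
  by rewrite andbT tnth_elapse zm => /eqP; split=> //; lra.
split=> //.
- by move: h; rewrite !inE => /orP[]/eqP->; rewrite ?guard_cont.
- by rewrite elapse0 /= zm eqxx.
- rewrite /move /= elapse0; move: h; rewrite !inE /cont.
  case/orP => /eqP->.
    case: sg sA => sA /=; last by apply/stateE; rewrite reset0 /= zm eqxx.
    case: eqP => /= q0; last by apply/stateE; rewrite reset0 /= zm eqxx.
    rewrite /jump_loc; case: insubP => [pc' _ _|_]; apply/stateE; split=> //; exact: nonneg_reset.
  apply/stateE; split=> /=; first exact: nonneg_reset.
  by rewrite tnth_reset finset.in_set1 eqxx andbT ltr0n /fail_hi; case: (sg); rewrite addn_gt0 orbT.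
Qed.

Lemma coin_delays s pc p b q sg : s.1 = coin D0 pc p b q sg ->
  is_state A s -> delays A s = [set 0].
Proof.
move=> s1 sA; apply/seteqP; split=> t.
  by move=> /delaysP/hasP[e _ /(coin_step _ _ s1 sA)[]].
move=> ->; exists (cont D0 pc p b q sg) => /=.
  by rewrite /mkset mem_edges src_cont encK /= mem_head.
by apply/delays_ofP/(coin_step _ _ s1 sA); rewrite mem_head.
Qed.

Lemma draw_step s pc p b q sg x t : s.1 = check D0 pc p b q sg -> is_state A s ->
  x \in slots pc p b q sg ->
  stepb A s (draw D0 pc p b q sg x) t <->
  [/\ 0 <= t, tnth s.2 zc + t < (fail_hi pc b q sg)%:R,
    x.1.2%:R < tnth s.2 x.1.1 + t & tnth s.2 x.2.1 + t <= x.2.2%:R].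
Proof.
case: s => l v /= -> sA xs; rewrite stepP /= !andbT !tnth_elapse.
have [v0 _] := (stateE _ _).1 sA.
split=> [[_ t0 /andP[h1 h2] h3 _]|[t0 h3 h1 h2]]; first by split.
split=> //; first by split=> //; rewrite map_f.
  by rewrite h1 h2.
have h := nonneg_elapse v0 t0.
by rewrite /move /= reset0; case: ifP => _; apply/stateE.
Qed.

Lemma check_stepP s pc p b q sg e t : s.1 = check D0 pc p b q sg -> stepb A s e t ->
  exists2 x, x \in slots pc p b q sg & e = draw D0 pc p b q sg x.
Proof. by case: s => l v /= -> /stepP[[h _] _ _ _ _]; exact: (elimT mapP h). Qed.

Lemma fail_slot_in (pc : 'I_(size D)) p b (q : 'I_m) sg : fail_slot pc b q sg \in slots pc p b q sg.
Proof. by rewrite mem_cat !inE eqxx !orbT. Qed.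

Lemma fail_lohi (pc : 'I_(size D)) b (q : 'I_m) sg : (fail_lo pc b q sg < fail_hi pc b q sg)%N.
Proof. by rewrite /fail_lo /fail_hi; case: sg; lia. Qed.

Lemma check_delays s pc p b q sg : s.1 = check D0 pc p b q sg -> is_state A s ->
  (0 < leb (delays A s) < +oo)%E.
Proof.
move=> s1 sA; set lo : R := (fail_lo pc b q sg)%:R; set hi : R := (fail_hi pc b q sg)%:R.
have lohi : lo < hi by rewrite ltr_nat fail_lohi.
have [z0 zhi] : 0 <= tnth s.2 zc /\ tnth s.2 zc < hi.
  case: s s1 sA => l v /= -> /stateE[h /=]; rewrite andbT; split=> //.
have mD := measurable_delays A s.
apply/andP; split.
  pose a := Num.max 0 (lo - tnth s.2 zc).
  have ah : a < hi - tnth s.2 zc by rewrite gt_max subr_gt0 zhi ltrD2r.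
  apply: (@lt_le_trans _ _ (leb `]a, (hi - tnth s.2 zc)[)).
    by rewrite lebesgue_measure_itv /= lte_fin ah -EFinB lte_fin subr_gt0.
  apply: le_measure; rewrite ?inE//.
  move=> t /=; rewrite in_itv /= gt_max => /andP[/andP[t0 tl] th].
  apply: (@delays_of_sub _ _ _ _ _ (draw D0 pc p b q sg (fail_slot pc b q sg))).
  apply/delays_ofP/draw_step => //; first exact: fail_slot_in.
  by split=> //=; rewrite -/hi -/lo; lra.
apply: (@le_lt_trans _ _ (leb `[0, hi])); last first.
  by rewrite lebesgue_measure_itv /=; case: ifP => // _; rewrite -EFinB ltry.
apply: le_measure; rewrite ?inE//.
move=> t /delaysP/hasP[e _ he]; have [x xs ee] := check_stepP s1 he.
move: he; rewrite ee => /(draw_step _ s1 sA xs)[t0 th _ _].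
by rewrite /= in_itv /= t0 /=; move: th; rewrite -/hi; lra.
Qed.

Definition owner_at (l : 'I_n.+1) := owner_of (dec l).

Lemma nature_delays s : is_state A s -> owner_at s.1 = Nature ->
  delays A s = [set 0] \/ (0 < leb (delays A s) < +oo)%E.
Proof.
move=> sA; have := decK D0 s.1; rewrite /owner_at.
case: (dec s.1) => [i|[[pc p] [j|[[[b q] sg] [] ]]]] //= s1 _.
  by right; apply: check_delays sA; rewrite -s1.
by left; apply: coin_delays sA; rewrite -s1.
Qed.

Definition game : stg R n k := uniform_game nature_delays.

End Semantics.

Lemma count_enabled (T : choiceType) (es l : seq T) (P : pred T) :
  uniq es -> uniq l -> (forall e, (e \in es) && P e = (e \in l)) ->
  (\sum_(e <- es | P e) 1)%N = size l.
Proof.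
move=> ues ul H; rewrite sum1_count -size_filter; apply: perm_size.
by apply: uniq_perm => // [|e]; [exact: filter_uniq|rewrite mem_filter andbC H].
Qed.

Lemma leb_disjoint {R : realType} (I : Type) (s : seq I) (F : I -> set (measurableTypeR R)) :
  (forall x, measurable (F x)) -> pairwise (fun x y => `[< F x `&` F y = set0 >]) s ->
  lebesgue_measure [set t | has (fun x => `[< F x t >]) s] =
  (\sum_(x <- s) lebesgue_measure (F x))%E.
Proof.
move=> mF; elim: s => [_|x s IHs] /=.
  by rewrite big_nil (_ : [set t | _] = set0)//; apply/seteqP; split.
move=> /andP[xs /IHs IH]; rewrite big_cons -IH -measureU//.
- congr lebesgue_measure; apply/seteqP; split=> t /=.
    by move=> /orP[/asboolP|]; [left|right].
  by move=> [/asboolP->//|->]; rewrite orbT.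
- elim: s {xs IHs IH} => [|y s IHs] /=.
    by rewrite (_ : [set t | _] = set0)//; apply/seteqP; split.
  rewrite (_ : [set t | _] = F y `|` [set t | has (fun x => `[< F x t >]) s]).
    exact: measurableU.
  apply/seteqP; split=> t /=.
    by move=> /orP[/asboolP|]; [left|right].
  by move=> [/asboolP->//|->]; rewrite orbT.
- elim: s xs {IHs IH} => [_|y s IHs] /=.
    by apply/seteqP; split=> // t [].
  move=> /andP[/asboolP xy /IHs E]; apply/seteqP; split=> // t [Fx /orP[/asboolP Fy|h]].
    by rewrite -xy.
  by rewrite -E.
Qed.

(** * One-step distributions at coins and checks *)

Section StepProb.
Context {R : realType}.
Variables (D : seq instr) (m' : nat).
Local Notation m := m'.+2.
Local Notation k := (m + m).+1.
Hypothesis D0 : (0 < size D)%N.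
Local Notation place := (place D m').
Local Notation n := #|place|.+1.
Local Notation E := (edge n k).
Local Notation A := (automaton m' D0).
Local Notation G := (@game R D m' D0).
Local Notation enc := (@enc D m' D0).
Local Notation leb := (@lebesgue_measure R).
Implicit Types (v : k.-tuple R) (t u : R) (s : state R n k) (e : E).
Implicit Types (pc : 'I_(size D)) (q r : 'I_m).

Lemma owner_enc x : owner G (enc x) = owner_of x.
Proof. by rewrite /= /owner_at encK. Qed.

Lemma enabledP s e : enabled G s e = stepb A s e 0.
Proof. by apply/asboolP/idP => /delays_ofP. Qed.

Lemma edge_probE s e l : uniq l ->
  (forall e', stepb A s e' 0 = (e' \in l)) ->
  edge_prob G s e = if e \in l then (size l)%:R^-1 else 0.
Proof.
move=> ul H; rewrite /edge_prob enabledP H; case: ifP => // _.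
rewrite (_ : weight G e = 1%N)// mul1r; congr (_%:R^-1).
apply: count_enabled => //; first exact: undup_uniq.
move=> e'; rewrite enabledP H; apply: andb_idl => e'l.
by have := H e'; rewrite e'l => /andP[].
Qed.

Lemma edge_prob0 s e : ~~ stepb A s e 0 -> edge_prob G s e = 0.
Proof. by move=> h; rewrite /edge_prob enabledP (negbTE h). Qed.

Lemma step_prob_nature lamD lamB s0 h (F : set (measurableTypeR R)) (c : R)
  (B : set (measurableTypeR R)) e :
  owner G (state_after s0 h).1 = Nature -> 0 <= c -> measurable F -> measurable B ->
  (forall t, edge_prob G ((state_after s0 h).1, elapse (state_after s0 h).2 t) e = c * \1_F t) ->
  step_prob G lamD lamB s0 h B e = (c%:E * unif_mu A (state_after s0 h) (F `&` B))%E.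
Proof.
move=> oN c0 mF mB H; rewrite /step_prob oN.
under eq_integral do rewrite H EFinM.
rewrite ge0_integralZl//; last first.
  exact/measurable_EFinP/measurable_indic.
by rewrite integral_indic.
Qed.

Lemma coin_target pc p b q sg : tgt (cont D0 pc p b q sg) != tgt (inspect D0 pc p b q sg).
Proof.
apply/eqP; rewrite /inspect /cont /=.
case: sg => /=; last by move/(can_inj (@encK D m' D0)).
case: eqP => _ /=; last by move/(can_inj (@encK D m' D0)).
rewrite /jump_loc; case: insubP => [pc' _ _|_] /=.
  by move/(can_inj (@encK D m' D0)).
by move/(can_inj (@encK D m' D0)).
Qed.

Lemma coin_step_prob lamD lamB s0 h pc p b q sg B e :
  (state_after s0 h).1 = coin D0 pc p b q sg -> is_state A (state_after s0 h) ->
  measurable B ->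
  step_prob G lamD lamB s0 h B e =
    (2^-1 * \1_(B `*` [set e]) (0, cont D0 pc p b q sg) +
     2^-1 * \1_(B `*` [set e]) (0, inspect D0 pc p b q sg))%:E.
Proof.
set s := state_after s0 h => s1 sA mB.
pose l := [:: cont D0 pc p b q sg; inspect D0 pc p b q sg].
have ci : cont D0 pc p b q sg != inspect D0 pc p b q sg.
  by apply: contraNneq (coin_target pc p b q sg) => ->.
have ul : uniq l by rewrite /= inE ci.
have H t : edge_prob G (s.1, elapse s.2 t) e =
    (if e \in l then 2^-1 else 0) * \1_[set 0] t.
  rewrite indicE; have [->|t0] := eqVneq t 0.
    rewrite mem_set// mulr1 elapse0 (@edge_probE _ _ l)// => e'.
    by rewrite -surjective_pairing; apply/idP/idP => [/(coin_step _ _ s1 sA)[]|h1];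
      last apply/(coin_step _ _ s1 sA).
  rewrite memNset; last by apply/eqP.
  rewrite mulr0; apply: edge_prob0; apply/negP => /and5P[_ _ /statebP st _ _].
  move: st sA; rewrite s1 (surjective_pairing s) /= s1 => /stateE[_ /=].
  rewrite andbT tnth_elapse => /eqP h1 /stateE[_ /=]; rewrite andbT => /eqP h2.
  by move/eqP: t0; apply; lra.
rewrite (step_prob_nature _ _ _ _ _ mB H)//; last 2 first.
- by rewrite -/s s1 owner_enc.
- by case: ifP.
rewrite -/s unif_muE (coin_delays s1 sA) lebesgue_measure_set1 eqxx /=.
rewrite diracE !indicE.
have -> : (0 \in [set 0] `&` B) = (0 \in B).
  by rewrite in_setI [X in X && _]mem_set.
have inD (c : E) : ((0, c) \in B `*` [set e]) = (0 \in B) && (c == e).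
  apply/idP/andP => [|[/set_mem Bz /eqP->]]; last by rewrite inE.
  by rewrite inE => -[/= Bz ->]; rewrite eqxx mem_set.
rewrite !inD !inE ![in RHS](eq_sym _ e).
have [->|] := eqVneq e (cont D0 pc p b q sg).
  by rewrite (negbTE ci) andbT andbF mulr0 addr0 EFinM.
have [->|] /= := eqVneq e (inspect D0 pc p b q sg); last first.
  by rewrite !andbF !mulr0 addr0 mul0e.
by rewrite andbT andbF mulr0 add0r EFinM.
Qed.

Section Check.
Variables (s : state R n k) (pc : 'I_(size D)) (p b : bool) (q : 'I_m) (sg : bool).
Hypothesis s1 : s.1 = check D0 pc p b q sg.
Hypothesis sA : is_state A s.
Hypothesis z0 : tnth s.2 zc = 0.
Variables x y : R.
Hypothesis old_x : tnth s.2 (clk p q) = (q + m)%:R + x.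
Hypothesis new_y : tnth s.2 (clk (~~ p) q) = q%:R + y.
Hypothesis x01 : 0 < x <= 1.
Hypothesis y01 : 0 < y <= 1.

Local Notation sl := (slots pc p b q sg).
Local Notation dr := (draw D0 pc p b q sg).
Let lo (w : slot m') : R := w.1.2%:R - tnth s.2 w.1.1.
Let hi (w : slot m') : R := w.2.2%:R - tnth s.2 w.2.1.
Let error : R := (al pc b q)%:R * x - (be pc q)%:R * y.

Definition check_len : R := if sg then 3 - error else 6 + error.

Lemma al12 : al pc b q = 1%N \/ al pc b q = 2%N.
Proof. by rewrite /al; case: ins => [|r0 q0]; [left|case: ifP; [right|left]]. Qed.

Lemma be12 : be pc q = 1%N \/ be pc q = 2%N.
Proof. by rewrite /be; case: ins => [r0|]; [case: ifP; [right|left]|left]. Qed.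

Lemma check_len_gt0 : 0 < check_len.
Proof.
rewrite /check_len /error; case/andP: x01 => ? ?; case/andP: y01 => ? ?.
by case: al12 => ->; case: be12 => ->; case: sg; lra.
Qed.

Lemma pairwise_slots : pairwise (fun a c => hi a <= lo c) sl.
Proof.
case/andP: x01 => ? ?; case/andP: y01 => ? ?.
rewrite /slots /fail_slot /fail_lo /fail_hi /hi /lo.
by case: al12 => ->; case: be12 => ->; case: (sg) => /=;
  rewrite ?old_x ?new_y ?z0 !natrD ?addn0 ?natrD; lra.
Qed.

Lemma slots_bounds : all (fun a => [&& 0 <= lo a, lo a <= hi a &
   (hi a <= (fail_lo pc b q sg)%:R) || (a == fail_slot pc b q sg)]) sl.
Proof.
case/andP: x01 => ? ?; case/andP: y01 => ? ?.
rewrite /slots !all_cat /= eqxx !orbT /fail_slot /fail_lo /fail_hi /hi /lo.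
by case: al12 => ->; case: be12 => ->; case: (sg) => /=;
  rewrite ?old_x ?new_y ?z0 !natrD ?addn0 ?natrD; lra.
Qed.

Let D_ (a : slot m') : set (measurableTypeR R) :=
  `]lo a, hi a] `&` `[0, (fail_hi pc b q sg)%:R[.

Lemma draw_delays a : a \in sl -> delays_of A s (dr a) = D_ a.
Proof.
move=> aS; apply/seteqP; split=> t.
  move=> /delays_ofP/(draw_step _ s1 sA aS); rewrite z0 add0r => -[h1 h2 h3 h4].
  by rewrite /D_ /lo /hi /=; split; rewrite /= in_itv /=; lra.
move=> [/=]; rewrite !in_itv /= /lo /hi => h1 h2.
by apply/delays_ofP/(draw_step _ s1 sA aS); rewrite z0 add0r; split; lra.
Qed.

Lemma leb_D a : a \in sl -> leb (D_ a) = (hi a - lo a)%:E.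
Proof.
move=> aS; have /and3P[l0 lh h] := allP slots_bounds a aS.
have F01 : (fail_lo pc b q sg)%:R < (fail_hi pc b q sg)%:R :> R by rewrite ltr_nat fail_lohi.
have [af|af] := eqVneq a (fail_slot pc b q sg).
  have -> : D_ a = [set` `]lo a, hi a[].
    have hE : hi a = (fail_hi pc b q sg)%:R by rewrite af /hi /= z0 subr0.
    by apply/seteqP; split=> t /=; rewrite /D_ /= !in_itv /=; [move=> [h1 h2]|move=> h1; split]; lra.
  by rewrite lebesgue_measure_itv /= lte_fin; case: ltP => [_|hl]; [by rewrite EFinB|congr EFin; lra].
have -> : D_ a = [set` `]lo a, hi a]].
  move: h; rewrite (negbTE af) orbF => h.
  by apply/seteqP; split=> t /=; rewrite /D_ /= !in_itv /=; [move=> [h1 h2]|move=> h1; split]; lra.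
by rewrite lebesgue_measure_itv /= lte_fin; case: ltP => [_|hl]; [by rewrite EFinB|congr EFin; lra].
Qed.

Lemma delays_slots : delays A s = [set t | has (fun a => `[< D_ a t >]) sl].
Proof.
apply/seteqP; split=> t /=.
  move=> /delaysP/hasP[e _ he]; have [a aS ea] := check_stepP s1 he.
  apply/hasP; exists a => //; apply/asboolP; rewrite -draw_delays// -ea.
  exact/delays_ofP.
move=> /hasP[a aS /asboolP]; rewrite -draw_delays//; exact: delays_of_sub.
Qed.

Lemma slot_disjoint a c t : D_ a t -> D_ c t -> hi a <= lo c -> False.
Proof. by move=> [/= + _] [/= + _]; rewrite !in_itv /=; lra. Qed.

Lemma leb_delays : leb (delays A s) = check_len%:E.
Proof.
rewrite delays_slots leb_disjoint; first last.
- apply: sub_pairwise pairwise_slots => a c h; apply/asboolP.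
  by apply/seteqP; split=> // t [Da Dc]; case: (slot_disjoint Da Dc h).
- by move=> a; apply: measurableI; exact: measurable_itv.
rewrite (eq_big_seq (fun a => (hi a - lo a)%:E)); last by move=> a /leb_D.
rewrite sumEFin; congr EFin.
rewrite /slots /check_len /error /fail_slot /fail_lo /fail_hi /hi /lo.
by case: al12 => ->; case: be12 => ->; case: (sg) => /=;
  rewrite !big_cons big_nil /= ?old_x ?new_y ?z0 !natrD ?addn0 ?natrD; lra.
Qed.

Lemma slot_unique a c t : a \in sl -> c \in sl -> D_ a t -> D_ c t -> a = c.
Proof.
move=> aS cS Da Dc; apply/eqP/negPn/negP => ac.
have : forall l, pairwise (fun a c => hi a <= lo c) l -> a \in l -> c \in l -> False.
  elim=> //= d l IH /andP[/allP h1 h2]; rewrite !inE.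
  case/predU1P => [ad|al] /predU1P[cd|cl].
  - by move: ac; rewrite ad cd eqxx.
  - by apply: slot_disjoint Da Dc _; rewrite ad; exact: h1.
  - by apply: slot_disjoint Dc Da _; rewrite cd; exact: h1.
  - exact: IH.
by move/(_ _ pairwise_slots aS cS).
Qed.

Lemma stepb_shift e t : stepb A (s.1, elapse s.2 t) e 0 = stepb A s e t.
Proof.
have E1 : move (s.1, elapse s.2 t) (0, e) = move s (t, e).
  by rewrite /move /= elapse0.
have E2 : elapse (elapse s.2 t) 0 = elapse s.2 t by exact: elapse0.
rewrite /stepb E1 /= E2 lexx; congr [&& _, _ & _].
(* A negative [t] makes [zc] negative, so the shifted valuation is no state. *)
have [t0|t0] := leP 0 t; last first.
  rewrite andbF andbC; apply/negP => /andP[_ /statebP[/(_ zc)]].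
  by rewrite tnth_elapse z0; lra.
have -> : stateb A s by exact/statebP.
apply/andP/andP => -[h1]; first by [].
move=> h2; split=> //; case/and4P: (h2) => _ _ h3 _.
by apply: (@stateb_elapse _ _ _ _ _ t); [rewrite t0 lexx|exact/statebP|exact: h3].
Qed.

Lemma stepb_unique e e' t : stepb A s e t -> stepb A s e' t -> e = e'.
Proof.
move=> et e't.
have [a aS ea] := check_stepP s1 et; have [c cS ec] := check_stepP s1 e't.
rewrite ea ec; congr draw; apply: (slot_unique aS cS (t := t));
  rewrite -draw_delays//; apply/delays_ofP; by rewrite -?ea -?ec.
Qed.

(** The slots are disjoint, so a delay enables at most one edge, which is then taken with
    probability 1. *)
Lemma check_edge_prob e t :
  edge_prob G (s.1, elapse s.2 t) e = 1 * \1_(delays_of A s e) t.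
Proof.
rewrite mul1r indicE; have [et|et] := boolP (stepb A s e t); last first.
  rewrite memNset; last by move/delays_ofP; exact/negP.
  by apply: edge_prob0; rewrite stepb_shift.
rewrite mem_set; last exact/delays_ofP.
rewrite (@edge_probE _ _ [:: e]) ?mem_seq1 ?eqxx ?invr1// => e'.
rewrite stepb_shift mem_seq1; apply/idP/eqP => [e't|->//].
exact: stepb_unique e't et.
Qed.

Lemma fail_prob : unif_mu A s (delays_of A s (dr (fail_slot pc b q sg))) =
  (((fail_hi pc b q sg)%:R - (fail_lo pc b q sg)%:R) / check_len)%:E.
Proof.
rewrite unif_muE leb_delays /= eqe gt_eqF ?check_len_gt0//=.
rewrite setIidl; last exact: delays_of_sub.
rewrite draw_delays ?fail_slot_in// leb_D ?fail_slot_in//.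
by rewrite /hi /lo /= z0 !subr0 EFinM.
Qed.

End Check.

Lemma check_step_prob lamD lamB s0 h pc p b q sg x y B e :
  let s := state_after s0 h in
  s.1 = check D0 pc p b q sg -> is_state A s -> tnth s.2 zc = 0 ->
  tnth s.2 (clk p q) = (q + m)%:R + x -> tnth s.2 (clk (~~ p) q) = q%:R + y ->
  0 < x <= 1 -> 0 < y <= 1 -> measurable B ->
  step_prob G lamD lamB s0 h B e = unif_mu A s (delays_of A s e `&` B).
Proof.
move=> s s1 sA z0 ox ny x01 y01 mB.
rewrite (@step_prob_nature _ _ _ _ (delays_of A s e) 1) ?mul1e//.
- by rewrite -/s s1 owner_enc.
- exact: measurable_delays_of.
- by move=> t; rewrite (check_edge_prob s1 sA z0 ox ny x01 y01).
Qed.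

End StepProb.

(** * Halting machines *)

Section Arithmetic.
Context {R : realFieldType}.

Lemma nat_diff1 (a : nat) : (a + 3)%:R - (a + 2)%:R = 1 :> R.
Proof. by rewrite !natrD; ring. Qed.

Lemma nat_diff2 (a : nat) : (a + 6)%:R - (a + 4)%:R = 2 :> R.
Proof. by rewrite !natrD; ring. Qed.

Lemma coin_gain (p e q0 q1 q2 q3 q4 : R) : -2 <= e <= 2 ->
  2 / (6 + e) * (p / 2) <= q1 -> 1 / (3 - e) * (p / 2 / 2) <= q3 ->
  q2 + q1 <= q0 -> q4 + q3 <= q2 ->
  q4 - p / 4 / 3 + p * (1 / (6 + e) + 1 / (4 * (3 - e)) - 1 / 4) <= q0 - p / 3.
Proof.
move=> /andP[e1 e2].
have -> : 2 / (6 + e) * (p / 2) = p * (1 / (6 + e)) by field; lra.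
have -> : 1 / (3 - e) * (p / 2 / 2) = p * (1 / (4 * (3 - e))) by field; lra.
lra.
Qed.

End Arithmetic.

Section Lower.
Context {R : realType}.
Variables (D : seq instr) (m' : nat).
Local Notation m := m'.+2.
Local Notation k := (m + m).+1.
Hypothesis D0 : (0 < size D)%N.
Local Notation place := (place D m').
Local Notation n := #|place|.+1.
Local Notation E := (edge n k).
Local Notation A := (automaton m' D0).
Local Notation G := (@game R D m' D0).
Local Notation dec := (@dec D m' D0).
Implicit Types (v : k.-tuple R) (t u : R) (s : state R n k) (e : E).
Implicit Types (pc : 'I_(size D)) (q r : 'I_m) (h : seq (R * E)) (xs ys : 'I_m -> R).

Variables (lamD lamB : strategy (R := R) (n := n) (k := k)) (s0 : state R n k).
Variable P : probability (runs R n k) R.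
Hypothesis lamDP : is_strategy G PDiamond lamD.
Hypothesis Pind : induced_measure G lamD lamB s0 P.

Local Notation st h := (state_after s0 h).
Local Notation lost := (visits [set (lose m' D0)]%SET s0).

(** The halting case rests on the potential [qr h - pr h / 3]. It never increases over a phase,
    decreases strictly over a phase with a wrong guess, is nonnegative at the start of every phase,
    and is positive once D has halted; so it is positive at the initial state. *)
Definition pr h : R := fine (P (cyl h)).
Definition qr h : R := fine (P (lost `&` cyl h)).

Lemma measurable_lost h : measurable (lost `&` cyl h).
Proof. by apply: measurableI; [exact: measurable_visits|exact: measurable_cyl]. Qed.

Lemma fine_mono (X Y : set (runs R n k)) : measurable X -> measurable Y ->
  X `<=` Y -> fine (P X) <= fine (P Y).
Proof.
move=> mX mY XY; apply: fine_le; [exact: fin_num_measure|exact: fin_num_measure|].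
by apply: le_measure => //; rewrite inE.
Qed.

Lemma pr_ge0 h : 0 <= pr h.
Proof. by rewrite fine_ge0. Qed.

Lemma qr_ge0 h : 0 <= qr h.
Proof. by rewrite fine_ge0. Qed.

Lemma qr_le_pr h : qr h <= pr h.
Proof.
by apply: fine_mono; [exact: measurable_lost|exact: measurable_cyl|exact: subIsetr].
Qed.

Lemma cyl_rcons h mv : cyl (rcons h mv) `<=` cyl h.
Proof. by rewrite -ext_cyl => rho []. Qed.

Lemma qr_rcons h mv : qr (rcons h mv) <= qr h.
Proof.
by apply: fine_mono; [exact: measurable_lost|exact: measurable_lost|by apply: setIS; exact: cyl_rcons].
Qed.

Lemma qr_lose h : (st h).1 = lose m' D0 -> qr h = pr h.
Proof.
move=> hl; congr (fine (P _)); apply/setIidr => rho hrho.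
by exists (size h); rewrite [mkseq _ _]hrho hl finset.in_set1.
Qed.

Lemma fine_ext h (B : set (measurableTypeR R)) e c : measurable B ->
  step_prob G lamD lamB s0 h B e = c%:E -> fine (P (ext h B e)) = c * pr h.
Proof.
move=> mB H; rewrite (P_ext Pind)// H -(fineK (fin_num_measure P _ (measurable_cyl h))).
by rewrite -EFinM.
Qed.

Lemma pr_rcons h mv c : step_prob G lamD lamB s0 h [set mv.1] mv.2 = c%:E ->
  pr (rcons h mv) = c * pr h.
Proof.
by move=> H; rewrite -(fine_ext (measurable_set1 _) H) ext_cyl.
Qed.

(** The strategy is deterministic, so its move extends the history without loss of probability. *)
Lemma diamond_move h : is_run A s0 h -> owner_of (dec (st h).1) = PDiamond ->
  let mv := lamD s0 h in
  [/\ pr (rcons h mv) = pr h, is_run A s0 (rcons h mv),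
      stepb A (st h) mv.2 mv.1 & st (rcons h mv) = move (st h) mv].
Proof.
move=> hr ho mv.
have hs : stepb A (st h) mv.2 mv.1.
  by apply/delays_ofP; apply: (lamDP.1 s0 h); split.
split=> //; last exact: state_after_rcons.
  rewrite (@pr_rcons _ _ 1) ?mul1r// /step_prob [owner _ _]ho.
  by rewrite indicE mem_set.
by apply/is_run_rcons; split=> //; apply/transP; case: mv hs.
Qed.

Lemma coin_moves h pc p b q sg : is_run A s0 h -> (st h).1 = coin D0 pc p b q sg ->
  let hc := rcons h (0, cont D0 pc p b q sg) in
  let hi := rcons h (0, inspect D0 pc p b q sg) in
  [/\ pr hc = pr h / 2, pr hi = pr h / 2, qr hc + qr hi <= qr h,
      is_run A s0 hc & is_run A s0 hi].
Proof.
move=> hr h1 hc hi.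
have hA := is_run_state hr.
have ci : cont D0 pc p b q sg != inspect D0 pc p b q sg.
  by apply: contraNneq (coin_target D0 pc p b q sg) => ->.
split.
- rewrite (@pr_rcons _ _ 2^-1) 1?mulrC// (coin_step_prob _ _ _ h1)//; congr EFin.
  rewrite !indicE mem_set// memNset; first by rewrite mulr1 mulr0 addr0.
  by move=> [_ /= e]; move: ci; rewrite e eqxx.
- rewrite (@pr_rcons _ _ 2^-1) 1?mulrC// (coin_step_prob _ _ _ h1)//; congr EFin.
  rewrite !indicE addrC mem_set// memNset; first by rewrite mulr1 mulr0 addr0.
  by move=> [_ /= e]; move: ci; rewrite e eqxx.
- rewrite /qr -fineD ?fin_num_measure//; try exact: measurable_lost.
  rewrite -measureU; try exact: measurable_lost.
    apply: fine_mono; [|exact: measurable_lost|].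
      by apply: measurableU; exact: measurable_lost.
    by move=> rho [[? /cyl_rcons ?]|[? /cyl_rcons ?]].
  apply/seteqP; split=> // rho [[_ c1] [_ c2]].
  move: c1; rewrite /cyl /= size_rcons => c1.
  move: c2; rewrite /cyl /= size_rcons c1 => /rcons_inj[e].
  by move: ci; rewrite e eqxx.
- apply/is_run_rcons; split=> //; apply/transP; split=> //.
  by apply/(coin_step _ _ h1 hA); rewrite mem_head.
- apply/is_run_rcons; split=> //; apply/transP; split=> //.
  by apply/(coin_step _ _ h1 hA); rewrite !inE eqxx orbT.
Qed.

(** Drawing any delay of the failing slot leads straight to [lose]; the probability of this one
    extension is the lower bound. *)
Lemma check_lost h pc p b q sg x y : is_run A s0 h ->
  (st h).1 = check D0 pc p b q sg -> tnth (st h).2 zc = 0 ->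
  tnth (st h).2 (clk p q) = (q + m)%:R + x -> tnth (st h).2 (clk (~~ p) q) = q%:R + y ->
  0 < x <= 1 -> 0 < y <= 1 ->
  ((fail_hi pc b q sg)%:R - (fail_lo pc b q sg)%:R) / check_len pc b q sg x y * pr h
    <= qr h.
Proof.
move=> hr h1 z0 ox ny x01 y01.
have hA := is_run_state hr.
rewrite -(@fine_ext h setT (draw D0 pc p b q sg (fail_slot pc b q sg)))//; last first.
  by rewrite (check_step_prob _ _ _ h1 hA z0 ox ny) ?setIT// (fail_prob h1 hA z0 ox ny).
apply: fine_mono; [exact: measurable_ext|exact: measurable_lost|].
move=> rho [hrho [_ e]]; split=> //; exists (size h).+1.
by rewrite mkseqS state_after_loc map_rcons last_rcons e /= eqxx finset.in_set1.
Qed.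

Definition coin_state v p xs ys :=
  tnth v zc = m%:R /\
  forall r, [/\ tnth v (clk p r) = (r + m)%:R + xs r, tnth v (clk (~~ p) r) = r%:R + ys r,
    0 < xs r <= 1 & 0 < ys r <= 1].

Definition err pc b xs ys r : R := (al pc b r)%:R * xs r - (be pc r)%:R * ys r.

Lemma err_bound pc b xs ys r : 0 < xs r <= 1 -> 0 < ys r <= 1 ->
  -2 <= err pc b xs ys r <= 2.
Proof.
rewrite /err => /andP[? ?] /andP[? ?].
by case: (al12 pc b r) => ->; case: (be12 pc r) => ->; lra.
Qed.

(* The sum exceeds 1/4 by e^2 / (4 (6 + e) (3 - e)). *)
Lemma coin_penalty (e : R) : -2 <= e <= 2 ->
  1 / 4 <= 1 / (6 + e) + 1 / (4 * (3 - e)) /\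
  (e != 0 -> 1 / 4 < 1 / (6 + e) + 1 / (4 * (3 - e))).
Proof.
move=> /andP[h1 h2].
have E1 : 1 / (6 + e) + 1 / (4 * (3 - e)) - 1 / 4 = e ^+ 2 / (4 * (6 + e) * (3 - e)).
  by field; lra.
have d0 : 0 < 4 * (6 + e) * (3 - e).
  by rewrite !mulr_gt0//; lra.
split; first by rewrite -subr_ge0 E1 divr_ge0 ?sqr_ge0// ltW.
by move=> e0; rewrite -subr_gt0 E1 divr_gt0// exprn_even_gt0.
Qed.

(** A single edge leaves each guessing stage but the last, so any strategy makes the resets in order
    and only chooses the instants; meanwhile the old clocks keep their distance to [zc]. *)
Lemma guess_all h pc p j xs : is_run A s0 h -> (st h).1 = guessing D0 pc p j ->
  (forall r, tnth (st h).2 (clk p r) = r%:R + xs r + tnth (st h).2 zc) ->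
  exists h', [/\ is_run A s0 h', pr h' = pr h, qr h' <= qr h,
    (st h').1 = guessing D0 pc p ord0 &
    forall r, tnth (st h').2 (clk p r) = r%:R + xs r + tnth (st h').2 zc].
Proof.
have [N Nj] := ubnP (val j); elim: N => // N IHN in h j Nj * => hr h1 hx.
have [jj|j0] := unliftP ord0 j; last by exists h; split=> //; rewrite h1 j0.
move=> ej; have ho : owner_of (dec (st h).1) = PDiamond by rewrite h1 encK.
have := diamond_move hr ho; set mv := lamD s0 h => /= -[pm rm]; rewrite {1}[st h]surjective_pairing h1.
move=> /stepP[[]]; rewrite /= ej liftK inE => /eqP emv _ t0 _ _ _ ms.
have [||r|h' [r' p' q' l' x']] := IHN (rcons h mv) (widen_ord (leqnSn m) jj) _ rm.
- by move: Nj; rewrite ej /= /bump /= add1n ltnS.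
- by rewrite ms /= emv.
- rewrite ms /move /= emv /= !tnth_reset !finset.in_set1 zc_clk clk_eq.
  have -> : (p == ~~ p) = false by case: (p).
  by rewrite /= !tnth_elapse hx addrA.
exists h'; split=> //; first by rewrite p'.
by apply: le_trans q' _; exact: qr_rcons.
Qed.

Definition branch_ok pc (b : bool) xs : Prop :=
  if ins pc is Dec r0 _ then if b then xs (inord r0) = 1 else xs (inord r0) < 1
  else True.

Hypothesis regs : all (fun i => instr_reg i < m)%N D.

Lemma ins_reg pc : (instr_reg (ins pc) < m)%N.
Proof. exact: (elimT (all_nthP (Inc 0)) regs). Qed.

Lemma exit_phase h pc p xs : is_run A s0 h -> (st h).1 = guessing D0 pc p ord0 ->
  (forall r, tnth (st h).2 (clk p r) = r%:R + xs r + tnth (st h).2 zc) ->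
  (forall r, 0 < xs r <= 1) ->
  qr h = pr h \/ exists b ys h', [/\ is_run A s0 h', pr h' = pr h, qr h' <= qr h,
     (st h').1 = coin D0 pc p b ord_max false &
     coin_state (st h').2 p xs ys /\ branch_ok pc b xs].
Proof.
move=> hr h1 hx x01; have ho : owner_of (dec (st h).1) = PDiamond by rewrite h1 encK.
have := diamond_move hr ho; set mv := lamD s0 h => /= -[pm rm]; rewrite {1}[st h]surjective_pairing h1.
move=> /stepP[[]]; rewrite /= unlift_none => emv _ t0 hg _ _ ms.
move: emv; rewrite inE => /predU1P[emv|emv].
  left; apply/eqP; rewrite eq_le qr_le_pr -pm -(@qr_lose (rcons h mv)) ?qr_rcons//.
  by rewrite ms /= emv.
right; have {emv} [b emv] : exists b, mv.2 = exit m' D0 pc p b.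
  by move: emv; rewrite !inE => /orP[]/eqP ->; [exists false|exists true].
move: hg; rewrite emv /= /sat all_cat => /and3P[/= /eqP zm /= ht /allP hf].
(* The guess is read off the new clocks at the instant [zc = m]. *)
exists b, (fun r => tnth (elapse (st h).2 mv.1) (clk (~~ p) r) - r%:R), (rcons h mv).
have ev : (st (rcons h mv)).2 = elapse (st h).2 mv.1.
  by rewrite ms /move /= emv /= reset0.
have el : (st (rcons h mv)).1 = coin D0 pc p b ord_max false by rewrite ms /= emv.
have ex r : tnth (elapse (st h).2 mv.1) (clk p r) = (r + m)%:R + xs r.
  by move: zm; rewrite !tnth_elapse hx natrD => zm; rewrite -zm; ring.
split=> //; first exact: qr_rcons.
split.
  rewrite ev; split=> // r; split=> //; first by rewrite addrC subrK.
  have hin c : c \in [:: (clk (~~ p) r, CGt, val r); (clk (~~ p) r, CLe, r.+1)] ->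
      cmp_holds c.1.2 (tnth (elapse (st h).2 mv.1) c.1.1) c.2%:R.
    by move=> cin; apply: hf; apply/flatten_mapP; exists r => //; rewrite mem_enum.
  have /= h2 := hin _ (mem_head _ _).
  have /= h3 : cmp_holds CLe (tnth (elapse (st h).2 mv.1) (clk (~~ p) r)) r.+1%:R.
    by apply: (hin (_, CLe, _)); rewrite !inE eqxx orbT.
  by move: h3; rewrite -natr1; lra.
move: ht; rewrite /branch_ok /test; have := ins_reg pc.
case: (ins pc) => //= r0 _ r0m; rewrite andbT ex inordK// !natrD.
by case: (b) => /= [/eqP|]; lra.
Qed.

(** Induction on the register examined, from [q] down to 0: each register divides the probability of
    the history by 4 and lowers the potential by its penalty. *)
Lemma coins pc p b xs ys q h : is_run A s0 h ->
  (st h).1 = coin D0 pc p b q false -> coin_state (st h).2 p xs ys ->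
  exists h', [/\ is_run A s0 h', (st h').1 = jump_loc m' D0 pc p b,
    tnth (st h').2 zc = 0 /\ forall r, tnth (st h').2 (clk (~~ p) r) = r%:R + ys r,
    pr h' = pr h / 4 ^+ q.+1 &
    qr h' - pr h' / 3 <= qr h - pr h / 3 /\
    (0 < pr h -> (exists2 r : 'I_m, (r <= q)%N & err pc b xs ys r != 0) ->
     qr h' - pr h' / 3 < qr h - pr h / 3)].
Proof.
have [N Nq] := ubnP (val q); elim: N => // N IHN in q Nq h * => hr h1 [zm cs].
have [oq nq xq yq] := cs q.
have [pc1 pi1 q1 rc1 ri1] := coin_moves hr h1.
set hc := rcons h _ in pc1 q1 rc1; set hi := rcons h _ in pi1 q1 ri1.
have sc : st hc = (coin D0 pc p b q true, (st h).2).
  by rewrite /hc state_after_rcons /move /= reset0 elapse0.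
have [pc2 pi2 q2 rc2 ri2] := coin_moves rc1 (congr1 fst sc).
set hcc := rcons hc _ in pc2 q2 rc2; set hci := rcons hc _ in pi2 q2 ri2.
have si (h0 : seq (R * E)) sg : (st h0).2 = (st h).2 ->
    let v := (st (rcons h0 (0, inspect D0 pc p b q sg))).2 in
    [/\ tnth v zc = 0, tnth v (clk p q) = (q + m)%:R + xs q &
        tnth v (clk (~~ p) q) = q%:R + ys q].
  rewrite state_after_rcons /move /= => ->; rewrite !tnth_reset !finset.in_set1 eqxx.
  by rewrite !clk_zc !tnth_elapse !addr0.
have [zi oi ni] := si h false erefl.
have := check_lost ri1 (congr1 fst (state_after_rcons _ _ _)) zi oi ni xq yq.
have [zi' oi' ni'] := si hc true (congr1 snd sc).
have := check_lost ri2 (congr1 fst (state_after_rcons _ _ _)) zi' oi' ni' xq yq.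
rewrite -/hi -/hci pi2 pi1 pc1 /fail_hi /fail_lo /check_len nat_diff1 nat_diff2 -[_ * _ - _]/(err pc b xs ys q).
set e := err pc b xs ys q => l2 l1.
have [eb1 eb2] := andP (err_bound pc b xq yq : -2 <= e <= 2).
have [pen pens] := coin_penalty (err_bound pc b xq yq : -2 <= e <= 2).
have pcc : pr hcc = pr h / 4 by rewrite pc2 pc1; lra.
have gain : qr hcc - pr hcc / 3 + pr h * (1 / (6 + e) + 1 / (4 * (3 - e)) - 1 / 4)
    <= qr h - pr h / 3.
  by rewrite pcc; exact: coin_gain (err_bound pc b xq yq) l1 l2 q1 q2.
have gain_ge : qr hcc - pr hcc / 3 <= qr h - pr h / 3.
  by apply: le_trans gain; rewrite lerDl mulr_ge0 ?pr_ge0// subr_ge0.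
have gain_gt : 0 < pr h -> e != 0 -> qr hcc - pr hcc / 3 < qr h - pr h / 3.
  by move=> p0 e0; apply: lt_le_trans gain; rewrite ltrDl mulr_gt0// subr_gt0 pens.
have [q0|q0] := eqVneq q ord0.
  exists hcc; split=> //.
  - by rewrite /hcc state_after_rcons sc /cont /= q0 eqxx.
  - rewrite /hcc state_after_rcons sc /cont /= q0 eqxx /=; split=> [|r].
      by rewrite tnth_reset finset.in_set1 eqxx.
    rewrite tnth_reset finset.in_set1 clk_zc elapse0.
    by have [] := cs r.
  - by rewrite pcc q0 expr1.
  - split=> // p0 [r rq er]; apply: gain_gt => //.
    rewrite /e; suff -> : q = r by [].
    by apply: val_inj; move: rq; rewrite q0 /= leqn0 => /eqP.
have scc : st hcc = (coin D0 pc p b (inord q.-1) false, (st h).2).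
  by rewrite /hcc state_after_rcons sc /cont /= (negbTE q0) /move /= reset0 elapse0.
have qpos : (0 < q)%N by rewrite lt0n; apply: contra q0 => /eqP q0; apply/eqP/val_inj.
have vq : val (inord q.-1 : 'I_m) = q.-1.
  by rewrite /= inordK//; apply: leq_ltn_trans (leq_pred _) (ltn_ord q).
have [|||h' [r' l' c' p' [g' g'']]] := IHN (inord q.-1) _ hcc rc2.
- by rewrite vq -ltnS prednK.
- by rewrite scc.
- by rewrite scc.
exists h'; split=> //.
- rewrite p' vq prednK// pcc exprS; field; exact: expf_neq0.
- split=> [|p0 [r rq er]]; first exact: le_trans gain_ge.
  have [rr|rr] := eqVneq r q.
    by apply: le_lt_trans g' _; apply: gain_gt => //; rewrite /e -rr.
  apply: lt_le_trans gain_ge; apply: g''; first by rewrite pcc divr_gt0.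
  by exists r => //; rewrite vq -ltnS prednK// ltn_neqAle rq andbT.
Qed.

Lemma phase h pc p xs : is_run A s0 h -> (st h).1 = guessing D0 pc p ord_max ->
  tnth (st h).2 zc = 0 -> (forall r, tnth (st h).2 (clk p r) = r%:R + xs r) ->
  (forall r, 0 < xs r <= 1) ->
  qr h = pr h \/ exists b ys h', [/\ is_run A s0 h', (st h').1 = jump_loc m' D0 pc p b,
    [/\ tnth (st h').2 zc = 0, forall r, tnth (st h').2 (clk (~~ p) r) = r%:R + ys r &
      forall r, 0 < ys r <= 1],
    branch_ok pc b xs /\ pr h' = pr h / 4 ^+ m &
    qr h' - pr h' / 3 <= qr h - pr h / 3 /\
    (0 < pr h -> (exists r, err pc b xs ys r != 0) ->
     qr h' - pr h' / 3 < qr h - pr h / 3)].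
Proof.
move=> hr h1 z0 hx x01.
have hx' r : tnth (st h).2 (clk p r) = r%:R + xs r + tnth (st h).2 zc.
  by rewrite hx z0 addr0.
have [h2 [r2 p2 q2 l2 x2]] := guess_all hr h1 hx'.
have [e|[b [ys [h3 [r3 p3 q3 l3 [c3 b3]]]]]] := exit_phase r2 l2 x2 x01.
  by left; apply/eqP; rewrite eq_le qr_le_pr -p2 -e.
right; have [h' [r' l' [z' c'] p' [g' g'']]] := coins r3 l3 c3.
have y01 r : 0 < ys r <= 1 by have [_ /(_ r)[]] := c3.
exists b, ys, h'; split=> //.
- by split=> //; rewrite p' p3 p2.
- rewrite p3 p2 in g' g''; split=> [|p0 [r er]]; first by lra.
  have rm : exists2 r : 'I_m, (r <= (ord_max : 'I_m))%N & err pc b xs ys r != 0.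
    by exists r => //; rewrite -ltnS.
  by have := g'' p0 rm; lra.
Qed.

Definition phase_start h pc p xs :=
  [/\ is_run A s0 h, (st h).1 = guessing D0 pc p ord_max, tnth (st h).2 zc = 0,
    forall r, tnth (st h).2 (clk p r) = r%:R + xs r & forall r, 0 < xs r <= 1].

Lemma phase_next h pc p xs : phase_start h pc p xs ->
  qr h = pr h \/ exists b ys h',
    [/\ branch_ok pc b xs, pr h' = pr h / 4 ^+ m,
      qr h' = pr h' \/ exists2 pc' : 'I_(size D), jump pc b = pc' & phase_start h' pc' (~~ p) ys,
      (size D <= jump pc b)%N -> qr h' = pr h' &
    qr h' - pr h' / 3 <= qr h - pr h / 3 /\
    (0 < pr h -> (exists r, err pc b xs ys r != 0) ->
     qr h' - pr h' / 3 < qr h - pr h / 3)].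
Proof.
case=> hr h1 z0 hx x01.
have [->|[b [ys [h' [r' l' [z' y' y01] [ok p'] g]]]]] := phase hr h1 z0 hx x01; first by left.
right; exists b, ys, h'; move: l'; rewrite /jump_loc.
case: insubP => [pc' lt_pc' e|nlt] l'; split=> //.
- by right; exists pc'.
- by rewrite leqNgt lt_pc'.
- by left; exact: qr_lose.
- by move=> _; exact: qr_lose.
Qed.

Lemma pow4 h h' : pr h' = pr h / 4 ^+ m -> pr h' <= pr h / 2 /\ (0 < pr h -> 0 < pr h').
Proof.
move=> ->; have p4 : 2 <= 4 ^+ m :> R.
  by apply: (@le_trans _ _ 4); [lra|rewrite -[leLHS]expr1 ler_eXn2l//; lra].
split=> [|p0]; last by rewrite divr_gt0//; lra.
by rewrite ler_wpM2l ?pr_ge0// lef_pV2// posrE; lra.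
Qed.

(** After [N] phases the undecided part of the probability is at most [pr h / 2 ^ N], and the
    potential of a history is never below minus its probability. *)
Lemma weak_bound_pow N h pc p xs : phase_start h pc p xs ->
  - (pr h / 2 ^+ N) <= qr h - pr h / 3.
Proof.
elim: N h pc p xs => [|N IHN] h pc p xs hp; have p0 := pr_ge0 h; have q0 := qr_ge0 h.
  by rewrite expr0; lra.
have p2 : 0 <= pr h / 2 ^+ N.+1 by rewrite divr_ge0// exprn_ge0.
have [->|[b [ys [h' [_ p' j _ [g _]]]]]] := phase_next hp; first by lra.
have [ph _] := pow4 p'.
have ph0 := pr_ge0 h'.
apply: le_trans g; case: j => [->|[pc' _ /IHN g]]; first by lra.
apply: le_trans g; rewrite lerN2 exprS invfM mulrA ler_wpM2r//.
Qed.

Lemma weak_bound h pc p xs : phase_start h pc p xs -> pr h / 3 <= qr h.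
Proof.
move=> hp; rewrite leNgt; apply/negP => lt.
have d0 : 0 < pr h / 3 - qr h by lra.
pose N := Num.bound (pr h / (pr h / 3 - qr h)).
have : pr h / (pr h / 3 - qr h) < 2 ^+ N.
  apply: lt_le_trans (archi_boundP _) _; first by rewrite divr_ge0 ?pr_ge0// ltW.
  by rewrite -natrX ler_nat ltnW// ltn_expl.
rewrite ltr_pdivrMr// mulrC -ltr_pdivrMr ?exprn_gt0//.
by move/lt_geF; rewrite -opprB lerNl (weak_bound_pow N hp).
Qed.

Definition code_val (mu : nat -> nat) (r : nat) : R := 2^-1 ^+ mu r.

Lemma code_val01 mu (r : nat) : 0 < code_val mu r <= 1.
Proof. by rewrite exprn_gt0 ?exprn_ile1//; lra. Qed.

Lemma code_val1 mu (r : nat) : (code_val mu r == 1) = (mu r == 0%N).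
Proof.
rewrite /code_val pexprn_eq1 ?invr_ge0//; case: (mu r) => //= a.
by rewrite invr_eq1 (eqr_nat R 2 1).
Qed.

Lemma mstep_ins pc mu : mstep D (val pc, mu) =
  match ins pc with
  | Inc r => (pc.+1, upd mu r (mu r).+1)
  | Dec r q => if mu r is x.+1 then (pc.+1, upd mu r x) else (q, mu)
  end.
Proof.
rewrite /mstep /= /ins -odflt_onth; have : (pc < size D)%N by [].
by rewrite -onthTE; case: (onth D pc).
Qed.

(** The guards force the right branch, and vanishing errors then force the guessed values to be
    those of the successor configuration. *)
Lemma step_encoded pc b ys mu : branch_ok pc b (fun r => code_val mu r) ->
  (forall r, err pc b (fun r => code_val mu r) ys r = 0) ->
  exists mu', mstep D (val pc, mu) = (jump pc b, mu') /\
    forall r, ys r = code_val mu' r.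
Proof.
rewrite mstep_ins /err /branch_ok /jump /al /be; have := ins_reg pc.
case: (ins pc) => /= [r0|r0 q0] r0m.
  move=> _ H; exists (upd mu r0 (mu r0).+1); split=> // r.
  have := H r; rewrite /code_val /upd mul1r eq_sym; case: eqP => [->|_].
    by rewrite exprS; lra.
  by lra.
rewrite inordK//; case: b => [/eqP|] /=.
  rewrite code_val1 => /eqP -> H; exists mu; split=> // r.
  by have := H r; rewrite andbF !mul1r; lra.
move=> lt1; have : code_val mu r0 != 1 by rewrite lt_eqF.
rewrite code_val1; case E : (mu r0) => [//|x] _ H.
exists (upd mu r0 x); split=> // r.
have := H r; rewrite /code_val /upd mul1r andbT eq_sym; case: eqP => [->|_].
  by rewrite E exprS; lra.
by lra.
Qed.

(** Induction on the number of steps left before halting. If all errors vanish, the next phase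
    starts from the true successor configuration; otherwise the drop of the potential is strict and
    the weak bound suffices for the remaining play. *)
Lemma strict_bound N mu h pc p xs : phase_start h pc p xs -> 0 < pr h ->
  (forall r, xs r = code_val mu r) ->
  (size D <= (iter N (mstep D) (val pc, mu)).1)%N -> pr h / 3 < qr h.
Proof.
elim: N mu h pc p xs => [|N IHN] mu h pc p xs hp p0 hx.
  by rewrite /= leqNgt ltn_ord.
rewrite iterSr => hN.
have [->|[b [ys [h' [ok p' j jD [g g']]]]]] := phase_next hp; first by lra.
have [_ /(_ p0) ph0] := pow4 p'.
have xE : xs = (fun r => code_val mu r) by apply/funext.
have [H|] := pselect (forall r, err pc b xs ys r = 0); last first.
  move=> /existsNP[r /eqP er]; have g1 := g' p0 (ex_intro _ r er).
  suff : 0 <= qr h' - pr h' / 3 by lra.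
  by case: j => [->|[pc' _ /weak_bound]]; lra.
suff : pr h' / 3 < qr h' by lra.
rewrite xE in ok H; have [mu' [e ey]] := step_encoded ok H.
rewrite e in hN.
case: j => [->|[pc' ej hp']]; first by lra.
by apply: (IHN mu' h' pc' _ ys hp') => //; move: hN; rewrite ej.
Qed.

Theorem lower_bound mu p : s0.1 = guessing D0 (Ordinal D0) p ord_max ->
  is_state A s0 -> tnth s0.2 zc = 0 ->
  (forall r, tnth s0.2 (clk p r) = r%:R + code_val mu r) ->
  halts D mu -> 1 / 3 < fine (P lost).
Proof.
move=> h1 hA z0 hx [N hN].
have p1 : pr [::] = 1 by rewrite /pr cyl_nil probability_setT.
have -> : fine (P lost) = qr [::] by rewrite /qr cyl_nil setIT.
suff : pr [::] / 3 < qr [::] by rewrite p1.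
apply: (@strict_bound N mu [::] (Ordinal D0) p (fun r : 'I_m => code_val mu r)) => //.
  by split=> // r; exact: code_val01.
by rewrite p1.
Qed.

End Lower.

(** * Diverging machines *)

Section Spine.
Context {R : realType}.
Variables (D : seq instr) (m' : nat).
Local Notation m := m'.+2.
Local Notation k := (m + m).+1.
Hypothesis D0 : (0 < size D)%N.
Local Notation place := (place D m').
Local Notation n := #|place|.+1.
Local Notation E := (edge n k).
Local Notation step := (R * E)%type.
Local Notation A := (automaton m' D0).
Implicit Types (v : k.-tuple R) (t u : R) (s : state R n k) (e : E).
Implicit Types (pc : 'I_(size D)) (q r : 'I_m) (h : seq step).

Hypothesis regs : all (fun i => instr_reg i < m)%N D.

Definition branch pc (mu : nat -> nat) : bool :=
  if ins pc is Dec r0 _ then mu r0 == 0%N else false.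

Definition next_mu pc mu : nat -> nat := (mstep D (val pc, mu)).2.

Lemma next_step pc mu :
  let b := branch pc mu in
  [/\ mstep D (val pc, mu) = (jump pc b, next_mu pc mu),
    branch_ok pc b (fun r : 'I_m => code_val mu r : R) &
    forall r : 'I_m, err pc b (fun r : 'I_m => code_val mu r : R)
      (fun r => code_val (next_mu pc mu) r) r = 0].
Proof.
rewrite /next_mu mstep_ins /branch /jump /branch_ok /err /al /be.
have := ins_reg regs pc.
case: (ins pc) => /= [r0|r0 q0] r0m.
  split=> // r; rewrite /code_val /upd mul1r eq_sym; case: eqP => [->|_].
    by rewrite exprS; lra.
  by lra.
rewrite inordK//; case E0 : (mu r0) => [|x] /=.
  split=> //; first by rewrite /code_val E0.
  by move=> r; rewrite andbF !mul1r subrr.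
split=> //.
  rewrite lt_neqAle code_val1 E0 /=; by have /andP[] := @code_val01 R mu r0.
move=> r; rewrite /code_val /upd mul1r andbT eq_sym; case: eqP => [->|_].
  by rewrite E0 exprS; lra.
by lra.
Qed.

(* A point of the spine: program counter, registers, parity of the phase, and
   stage of the phase. *)
Record spot := Spot { s_pc : 'I_(size D); s_mu : nat -> nat; s_par : bool;
  s_stage : 'I_m.+1 + 'I_m * bool }.
Implicit Type c : spot.

Definition old_val c r : R := code_val (s_mu c) r.
Definition new_val c r : R := code_val (next_mu (s_pc c) (s_mu c)) r.
Definition s_branch c := branch (s_pc c) (s_mu c).

Definition s_move c v : step :=
  match s_stage c with
  | inl j => if unlift ord0 j is Some j' then
      (m%:R - j'%:R - new_val c j' - tnth v zc, guess D0 (s_pc c) (s_par c) j')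
      else (m%:R - tnth v zc, exit m' D0 (s_pc c) (s_par c) (s_branch c))
  | inr (q, sg) => (0, cont D0 (s_pc c) (s_par c) (s_branch c) q sg)
  end.

(** As the machine does not halt on a good spot, its next program counter is below [size D] and
    [insubd] returns it unchanged. *)
Definition s_next c : spot :=
  let goto x := Spot (s_pc c) (s_mu c) (s_par c) x in
  let next := mstep D (val (s_pc c), s_mu c) in
  match s_stage c with
  | inl j => if unlift ord0 j is Some j' then goto (inl (widen_ord (leqnSn m) j'))
      else goto (inr (ord_max, false))
  | inr (q, sg) => if ~~ sg then goto (inr (q, true)) else
      if q == ord0 then
        Spot (insubd (s_pc c) next.1) next.2 (~~ s_par c) (inl ord_max)
      else goto (inr (inord q.-1, false))
  end.

Definition s_loc c : 'I_n.+1 :=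
  match s_stage c with
  | inl j => guessing D0 (s_pc c) (s_par c) j
  | inr (q, sg) => coin D0 (s_pc c) (s_par c) (s_branch c) q sg
  end.

(** In stage [inl j] the new clocks from [j] on have been reset at the instants that make them show
    [r + y] when [zc = m]. The bound on [zc] makes the next delay nonnegative. *)
Definition s_clocks c v : Prop :=
  match s_stage c with
  | inl j => [/\ tnth v zc <= m%:R - j%:R,
      forall r, tnth v (clk (s_par c) r) = r%:R + old_val c r + tnth v zc &
      forall r, (j <= r)%N ->
        tnth v (clk (~~ s_par c) r) = r%:R + new_val c r + tnth v zc - m%:R]
  | inr _ => coin_state v (s_par c) (old_val c) (new_val c)
  end.

Definition s_running c :=
  forall N, ((iter N (mstep D) (val (s_pc c), s_mu c)).1 < size D)%N.

Definition s_good c s := [/\ is_state A s, s.1 = s_loc c, s_clocks c s.2 & s_running c].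

Lemma new_val01 c r : 0 < new_val c r <= 1.
Proof. exact: code_val01. Qed.

Lemma old_val01 c r : 0 < old_val c r <= 1.
Proof. exact: code_val01. Qed.

Lemma nonneg_move l v t e : nonneg v -> 0 <= t -> nonneg (move (l, v) (t, e)).2.
Proof. by move=> v0 t0; apply: nonneg_reset; exact: nonneg_elapse. Qed.

Lemma negb_eq (p : bool) : (p == ~~ p) = false.
Proof. by case: p. Qed.

Definition good_step c v := stepb A (s_loc c, v) (s_move c v).2 (s_move c v).1 /\
  s_good (s_next c) (move (s_loc c, v) (s_move c v)).

Lemma good_guess pc mu p (j : 'I_m) v (c := Spot pc mu p (inl (lift ord0 j))) :
  s_good c (s_loc c, v) -> good_step c v.
Proof.
case=> hA _ [zj ox nx] hn; rewrite /good_step /s_move /s_next /= !liftK.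
have [v0 _] := (stateE _ _ _).1 hA.
set t := _ - _ - _ - _; set e := guess _ _ _ _.
have vj : (lift ord0 j)%:R = j%:R + 1 :> R by rewrite /= /bump /= add1n natr1.
have [y0 y1] := andP (new_val01 c j).
have t0 : 0 <= t by rewrite /t; move: zj; rewrite vj; lra.
have hS : is_state A (move (s_loc c, v) (t, e)).
  by apply/stateE; split=> //; exact: nonneg_move.
split.
  by apply/stepP; split=> //; split=> //; rewrite /= liftK mem_head.
split=> //; split=> [|r|r jr].
- rewrite /= tnth_reset finset.in_set1 zc_clk tnth_elapse /t; lra.
- rewrite /= !tnth_reset !finset.in_set1 zc_clk clk_eq negb_eq /= !tnth_elapse.
  by rewrite ox -!addrA.
- rewrite /= !tnth_reset !finset.in_set1 zc_clk clk_eq eqxx /= !tnth_elapse.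
  case: eqP => [->|/eqP rj]; first by rewrite /t; lra.
  rewrite nx; first by rewrite /new_val /=; lra.
  by rewrite /= /bump /= add1n ltn_neqAle eq_sym rj.
Qed.

Lemma good_exit pc mu p v (c := Spot pc mu p (inl ord0)) :
  s_good c (s_loc c, v) -> good_step c v.
Proof.
case=> hA _ [/= zj ox nx] hn; rewrite /good_step /s_move /s_next /= !unlift_none.
have [v0 _] := (stateE _ _ _).1 hA.
set t := _ - _; set e := exit _ _ _ _ _.
have t0 : 0 <= t by move: zj; rewrite /t subr0; lra.
have zt : tnth (elapse v t) zc = m%:R by rewrite tnth_elapse /t addrC subrK.
have ot r : tnth (elapse v t) (clk p r) = (r + m)%:R + old_val c r.
  by rewrite tnth_elapse ox natrD /t; ring.
have nt r : tnth (elapse v t) (clk (~~ p) r) = r%:R + new_val c r.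
  by rewrite tnth_elapse nx// /t; ring.
have hS : is_state A (move (s_loc c, v) (t, e)).
  by apply/stateE; rewrite /= reset0 zt eqxx; split=> //; exact: nonneg_elapse.
split.
  apply/stepP; split=> //.
    by split=> //; rewrite /= unlift_none !inE /e; case: (s_branch c); rewrite eqxx ?orbT.
  rewrite /= zt eqxx /= /sat all_cat; apply/andP; split.
    have [_ bo _] := next_step pc mu.
    move: bo; rewrite /branch_ok /test /s_branch /=; have := ins_reg regs pc.
    case: (ins pc) => //= r0 q0 r0m; rewrite andbT ot inordK// /old_val /= inordK//.
    by case: (branch pc mu) => /= [->|]; rewrite !natrD; [apply/eqP; ring|lra].
  apply/allP => a /flatten_mapP[r _]; rewrite !inE => /orP[]/eqP -> /=;
    rewrite nt; have := new_val01 c r; rewrite -?natr1; lra.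
split=> //; rewrite /= reset0; split=> //= r; split=> //.
  exact: old_val01.
exact: new_val01.
Qed.

Lemma good_coin pc mu p q sg v (c := Spot pc mu p (inr (q, sg))) :
  s_good c (s_loc c, v) -> good_step c v.
Proof.
case=> hA _ hc hn; rewrite /good_step /s_move /s_next /=.
have [v0 _] := (stateE _ _ _).1 hA.
have hs : stepb A (s_loc c, v) (cont D0 pc p (s_branch c) q sg) 0.
  by apply/(coin_step (s := (s_loc c, v)) _ _ erefl hA); rewrite mem_head.
split=> //.
have hS : is_state A (move (s_loc c, v) (0, cont D0 pc p (s_branch c) q sg)).
  by case/and5P: hs => _ _ _ _ /and3P[_ _ /statebP].
move: hS hs; rewrite /cont /c; case: sg @c hA hc hn => c hA hc hn /=; last first.
  by move=> hS hs; split=> //; rewrite /= reset0 elapse0.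
case: eqP => q0 hS hs; last first.
  by split=> //; rewrite /= reset0 elapse0.
have [st bo eo] := next_step pc mu.
have lt : (jump pc (branch pc mu) < size D)%N by have := hn 1%N; rewrite /= st.
have [zm cs] := hc.
split=> //.
- by rewrite /= /jump_loc insubT /s_loc /= st /insubd insubT.
- rewrite /s_clocks /=; split=> [|r|r].
  + by rewrite tnth_reset finset.in_set1 eqxx subrr.
  + rewrite !tnth_reset !finset.in_set1 clk_zc eqxx elapse0 addr0.
    by have [_ -> _ _] := cs r.
  + by rewrite leqNgt ltn_ord.
- move=> N; have := hn N.+1; rewrite iterSr /= st /insubd insubT /=.
  by rewrite /next_mu st.
Qed.

Lemma s_good_next c s : s_good c s ->
  stepb A s (s_move c s.2).2 (s_move c s.2).1 /\
  s_good (s_next c) (move s (s_move c s.2)).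
Proof.
case: s => l v hg; have [_ /= el _ _] := hg; subst l.
case: c hg => pc mu p [j|[q sg]]; last exact: good_coin.
by have [j' ->|->] := unliftP ord0 j; [exact: good_guess|exact: good_exit].
Qed.

End Spine.

Lemma measurable_head d (W : measurableType d) (T : eqType) (l : seq T) (x0 x : T) (b : T -> W -> bool) :
  (forall a, measurable_fun setT (b a)) ->
  measurable_fun setT (fun w => head x0 [seq a <- l | b a w] == x).
Proof.
move=> mb; elim: l => [|a l IHl] /=; first exact: measurable_cst.
rewrite (_ : (fun w => _) = (fun w => if b a w then a == x else
    head x0 [seq a <- l | b a w] == x)); last by apply/funext => w; case: (b a w).
by apply: measurable_fun_ifT.
Qed.

Lemma halving_cvg0 {R : realType} (S : nat -> R) : (forall j, 0 <= S j) ->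
  (forall j, S j.+1 <= S j) -> (forall j, exists i, S i <= S j / 2) -> S @ \oo --> 0.
Proof.
move=> Sge0 Sdec Shalf.
have Smono i j : (i <= j)%N -> S j <= S i.
  move=> /subnK <-; elim: (j - i)%N => // a IHa; rewrite addSn.
  exact: le_trans (Sdec _) IHa.
have Sp K : exists i, S i <= S 0 / 2 ^+ K.
  elim: K => [|K [i Si]]; first by exists 0%N; rewrite expr0 divr1.
  have [i' Si'] := Shalf i; exists i'; apply: le_trans Si' _.
  by rewrite exprSr invfM mulrA ler_wpM2r.
apply/cvgr0Pnorm_lt => e e0.
have [i Si] := Sp (Num.bound (S 0 / e)).
near=> j; rewrite ger0_norm//; apply: (@le_lt_trans _ _ (S i)).
  by apply: Smono; near: j; exact: nbhs_infty_ge.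
apply: (le_lt_trans Si); rewrite ltr_pdivrMr ?exprn_gt0// mulrC -ltr_pdivrMr//.
apply: lt_le_trans (archi_boundP _) _; first by rewrite divr_ge0// ltW.
by rewrite -natrX ler_nat ltnW// ltn_expl.
Unshelve. all: by end_near. Qed.

(** * Faithful simulation as a strategy *)

Section GoodStrategy.
Context {R : realType}.
Variables (D : seq instr) (m' : nat).
Local Notation m := m'.+2.
Local Notation k := (m + m).+1.
Hypothesis D0 : (0 < size D)%N.
Local Notation place := (place D m').
Local Notation n := #|place|.+1.
Local Notation E := (edge n k).
Local Notation step := (R * E)%type.
Local Notation A := (automaton m' D0).
Local Notation G := (@game R D m' D0).
Local Notation enc := (@enc D m' D0).
Local Notation dec := (@dec D m' D0).
Implicit Types (v : k.-tuple R) (t u : R) (s : state R n k) (e : E).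
Implicit Types (pc : 'I_(size D)) (q r : 'I_m) (h : seq step).

Hypothesis regs : all (fun i => instr_reg i < m)%N D.
Variables (c0 : spot D m') (s0 : state R n k).
Hypothesis good0 : s_good D0 c0 s0.

(* Nature's coins continue along the spine with probability 1/2, so the spine
   has measure zero and the induced measure is a mixture over the coin at which
   the run leaves it. *)
Definition trail i : spot D m' * state R n k :=
  iter i (fun x => (s_next x.1, move x.2 (s_move D0 x.1 x.2.2))) (c0, s0).
Local Notation cf i := (trail i).1.
Local Notation ss i := (trail i).2.
Definition sp i : step := s_move D0 (cf i) (ss i).2.
Local Notation H := (mkseq sp).

Lemma trail_good i : s_good D0 (cf i) (ss i).
Proof. by elim: i => //= i IHi; have [_] := s_good_next regs IHi. Qed.

Lemma trail_state i : state_after s0 (H i) = ss i.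
Proof. by elim: i => // i IHi; rewrite mkseqS state_after_rcons IHi. Qed.

Lemma trail_step i : stepb A (ss i) (sp i).2 (sp i).1.
Proof. by have [] := s_good_next regs (trail_good i). Qed.

Definition dv i : step :=
  let c := cf i in
  match s_stage c with
  | inr (q, sg) => (0, inspect D0 (s_pc c) (s_par c) (s_branch c) q sg)
  | _ => (0, point)
  end.

Definition is_coin (c : spot D m') := if s_stage c is inr _ then true else false.

(** The probability of having followed the spine for [i] steps, which only the coins reduce. *)
Fixpoint surv i : R :=
  if i is i'.+1 then if is_coin (cf i') then surv i' / 2 else surv i' else 1.

Lemma surv_gt0 i : 0 < surv i.
Proof. by elim: i => //= i IHi; case: ifP => // _; rewrite divr_gt0. Qed.

Lemma surv_dec i : surv i.+1 <= surv i.
Proof. by rewrite /=; case: ifP => // _; have := surv_gt0 i; lra. Qed.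

Lemma surv_coin i : surv i.+1 < surv i -> is_coin (cf i).
Proof. by rewrite /=; case: ifP => //; rewrite ltxx. Qed.

Lemma next_coin i : exists2 j, (i <= j)%N & is_coin (cf j).
Proof.
case E1 : (s_stage (cf i)) => [j|x]; last by exists i => //; rewrite /is_coin E1.
have [N Nj] := ubnP (val j); elim: N => // N IHN in i j Nj E1 *.
have [j' ej|ej] := unliftP ord0 j; last first.
  by exists i.+1 => //; rewrite /is_coin /= /s_next E1 ej unlift_none.
have [||a ia ca] := IHN i.+1 (widen_ord (leqnSn m) j').
- by move: Nj; rewrite ej /= /bump /= add1n ltnS.
- by rewrite /= /s_next E1 ej liftK.
by exists a => //; exact: ltnW.
Qed.

Lemma surv_lim : surv @ \oo --> 0.
Proof.
apply: halving_cvg0 => [i|i|i]; [exact/ltW/surv_gt0|exact: surv_dec|].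
have [j ij cj] := next_coin i; exists j.+1; rewrite /= cj ler_wpM2r//.
move/subnK: ij => <-; elim: (j - i)%N => // a IHa; rewrite addSn.
exact: le_trans (surv_dec _) IHa.
Qed.

Definition chk i : state R n k := move (ss i) (dv i).

Lemma trail_chk i : state_after s0 (rcons (H i) (dv i)) = chk i.
Proof. by rewrite state_after_rcons trail_state. Qed.

(** At a coin, the edge of the check selected by the drawn delay. For [t] outside the delay set,
    which is null for the draw, the default is still an edge of the same check, so the run ends in
    [lose] or [win] for every [t]. *)
Definition ef i (t : R) : E :=
  let c := cf i in
  match s_stage c with
  | inr (q, sg) =>
      let d := draw D0 (s_pc c) (s_par c) (s_branch c) q sg in
      head (d (fail_slot (s_pc c) (s_branch c) q sg))
        [seq e <- map d (slots (s_pc c) (s_par c) (s_branch c) q sg) | stepb A (chk i) e t]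
  | _ => point
  end.

Definition lp (e : E) : E := loop m' D0 (if tgt e == lose m' D0 then ord0 else ord_max).

Lemma measurable_ef i e : measurable [set t : measurableTypeR R | ef i t = e].
Proof.
rewrite /ef; case: (s_stage (cf i)) => [j|[q sg]].
  have [->|pe] := pselect (point = e).
    by rewrite (_ : [set t | _] = setT)//; apply/seteqP; split.
  by rewrite (_ : [set t | _] = set0)//; apply/seteqP; split.
apply: measurable_prop; last by move=> t; apply: (rwP eqP).
apply: measurable_head => a; case: (chk i) => l v.
exact: measurable_stepb.
Qed.

(** An unguarded edge is available without delay in every location of Player Diamond; it makes the
    strategy total off the spine, and at [lose] and [win] it is the loop. *)
Definition fallback (x : 'I_2 + place) : E :=
  match x with
  | inl i => loop m' D0 i
  | inr (pc, p, inl j) =>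
      if unlift ord0 j is Some j' then guess D0 pc p j' else concede m' D0 pc p
  | _ => loop m' D0 ord0
  end.

Lemma fallback_out x : owner_of x = PDiamond ->
  [/\ fallback x \in out D0 x, guard (fallback x) = [::], inv_of x = [::] &
    exists2 y, tgt (fallback x) = enc y & inv_of y = [::]].
Proof.
case: x => [i|[[pc p] [j|//]]] _ /=.
  by rewrite mem_head; split=> //; exists (inl i).
by have [j' ej|ej] := unliftP ord0 j; rewrite mem_head; split=> //; eexists.
Qed.

Lemma fallback_step s : is_state A s -> owner_of (dec s.1) = PDiamond ->
  stepb A s (fallback (dec s.1)) 0.
Proof.
case: s => l v; rewrite -[l](decK D0 l) encK; set x := dec l => hA ho.
have [v0 _] := (stateE _ _ _).1 hA.
have [fo fg ix [y fy iy]] := fallback_out ho.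
apply/stepP; rewrite fg ix; split=> //.
rewrite /move fy; apply/stateE; rewrite iy; split=> //.
exact: nonneg_reset (nonneg_elapse v0 (lexx 0)).
Qed.

Definition lam_good : strategy (R := R) (n := n) (k := k) := fun s h =>
  if `[< s = s0 >] && (h == H (size h)) then sp (size h)
  else (0, fallback (dec (state_after s h).1)).

Lemma lam_good_spine i : lam_good s0 (H i) = sp i.
Proof.
by rewrite /lam_good size_mkseq eqxx andbT; case: asboolP.
Qed.

(** Along a fixed sequence of edges the decision takes only two values, according to whether
    finitely many delays are those of the spine. *)
Lemma lam_good_strategy : is_strategy G PDiamond lam_good.
Proof.
split=> [s h [hr ho]|s es D1].
  apply/delays_ofP; rewrite /lam_good; case: ifP => [/andP[/asboolP-> /eqP e]|_].
    by rewrite {1}e trail_state; exact: trail_step.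
  exact: fallback_step (is_run_state hr) ho.
have mcoord : forall f, f \in [seq (fun u : (size es).-tuple (measurableTypeR R) => tnth u i : measurableTypeR R)
    | i <- enum 'I_(size es)] -> measurable_fun setT f.
  by move=> f /mapP[i _ ->]; exact: measurable_tnth.
have zipE (ts : (size es).-tuple (measurableTypeR R)) : zip ts es =
    zip [seq f ts | f <- [seq (fun u : (size es).-tuple (measurableTypeR R) => tnth u i) | i <- enum 'I_(size es)]] es.
  by rewrite -map_comp -[in LHS](map_tnth_enum ts).
have locE (ts : (size es).-tuple (measurableTypeR R)) :
    (state_after s (zip ts es)).1 = last s.1 [seq tgt e | e <- es].
  rewrite state_after_loc; congr last.
  rewrite -[in RHS](@unzip2_zip _ _ ts es) ?size_tuple// /unzip2 -map_comp.
  by [].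
have mD1 : measurable D1.
  have [ho|ho] := pselect (owner G (last s.1 [seq tgt e | e <- es]) = PDiamond); last first.
    rewrite (_ : D1 = set0)//; apply/seteqP; split=> // ts [_].
    by rewrite locE.
  apply: measurable_prop; last first.
    move=> ts; rewrite /run_of_player locE; split=> [[/runP h _]|h]; first exact: h.
    by split=> //; apply/runP; exact: h.
  have -> : (fun ts : (size es).-tuple (measurableTypeR R) => runb (aut G) s (zip ts es)) =
    (fun ts => runb A (s.1, s.2) (zip [seq f ts | f <- [seq (fun u : (size es).-tuple (measurableTypeR R) => tnth u i) | i <- enum 'I_(size es)]] es)).
    by apply/funext => ts; rewrite -zipE -surjective_pairing.
  exact: measurable_runb.
pose N := size es.
pose on (ts : (size es).-tuple (measurableTypeR R)) := `[< s = s0 >] && (zip ts es == H N).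
have mon : measurable_fun setT on.
  apply: measurable_and; first exact: measurable_cst.
  have -> : (fun ts : (size es).-tuple (measurableTypeR R) => zip ts es == H N) =
      (fun ts => all (fun i : 'I_(size es) => tnth ts i == (sp i).1) (enum 'I_(size es)) && (es == unzip2 (H N))).
    apply/funext => ts; apply/eqP/andP => [e|[/allP h1 /eqP h2]].
      split; last by rewrite -e unzip2_zip// size_tuple.
      apply/allP => i _; have : nth (0, point) (zip ts es) i = nth (0, point) (H N) i by rewrite e.
      rewrite nth_mkseq// nth_zip ?size_tuple// (tnth_nth 0) => <-.
      by rewrite eqxx.
    apply: (@eq_from_nth _ (0, point)).
      by rewrite size_zip size_tuple minnn size_mkseq.
    move=> i; rewrite size_zip size_tuple minnn => iN.
    rewrite nth_zip ?size_tuple// nth_mkseq// (surjective_pairing (sp i)).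
    congr pair; first by have /eqP := h1 (Ordinal iN) (mem_enum _ _); rewrite (tnth_nth 0).
    apply: (etrans (congr1 (fun l => nth point l i) h2)).
    by rewrite (nth_map (0, point)) ?size_mkseq// nth_mkseq.
  apply: measurable_and; last exact: measurable_cst.
  elim: (enum _) => [|i l IHl] /=; first exact: measurable_cst.
  apply: measurable_and => //; apply: measurable_fun_eqr; last exact: measurable_cst.
  exact: measurable_tnth.
have lamE (ts : (size es).-tuple (measurableTypeR R)) : lam_good s (zip ts es) = if on ts then sp N else
    (0, fallback (dec (last s.1 [seq tgt e | e <- es]))).
  by rewrite /lam_good /on size_zip size_tuple minnn locE.
split.
  apply: measurable_funTS; under eq_fun do rewrite lamE.
  rewrite (_ : (fun _ => _) = (fun ts => if on ts then (sp N).1 else 0)); last first.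
    by apply/funext => ts; case: (on ts).
  by apply: measurable_fun_ifT.
move=> e; apply: measurableI => //.
apply: (@measurable_prop _ _ (fun ts => (if on ts then (sp N).2 == e
    else fallback (dec (last s.1 [seq tgt e | e <- es])) == e))).
  by apply: measurable_fun_ifT.
by move=> ts /=; rewrite lamE; case: (on ts); apply: (rwP eqP).
Qed.

Lemma chk_facts i q sg : s_stage (cf i) = inr (q, sg) ->
  let c := cf i in
  [/\ (chk i).1 = check D0 (s_pc c) (s_par c) (s_branch c) q sg, is_state A (chk i),
    tnth (chk i).2 zc = 0,
    tnth (chk i).2 (clk (s_par c) q) = (q + m)%:R + old_val c q &
    tnth (chk i).2 (clk (~~ s_par c) q) = q%:R + new_val c q].
Proof.
move=> Ei c; have [hA hl hc _] := trail_good i.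
rewrite /s_loc Ei in hl; rewrite /s_clocks Ei in hc; have [_ cs] := hc.
have [oq nq _ _] := cs q.
have hs : stepb A (ss i) (inspect D0 (s_pc c) (s_par c) (s_branch c) q sg) 0.
  by apply/(coin_step _ _ hl hA); rewrite !inE eqxx orbT.
rewrite /chk /dv Ei; split=> //.
- by case/and5P: hs => _ _ _ _ /and3P[_ _ /statebP].
- by rewrite /= tnth_reset finset.in_set1 eqxx.
- by rewrite /= tnth_reset finset.in_set1 clk_zc elapse0.
- by rewrite /= tnth_reset finset.in_set1 clk_zc elapse0.
Qed.

Lemma err0 i q : err (s_pc (cf i)) (s_branch (cf i)) (old_val (cf i)) (new_val (cf i)) q = 0 :> R.
Proof. by have [_ _] := @next_step R _ _ regs (s_pc (cf i)) (s_mu (cf i)); exact. Qed.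

(** With vanishing error the failing proportions are 2/6 and 1/3. *)
Lemma nu_fail i q sg (c := cf i) : s_stage c = inr (q, sg) ->
  unif_mu A (chk i) (delays_of A (chk i)
    (draw D0 (s_pc c) (s_par c) (s_branch c) q sg (fail_slot (s_pc c) (s_branch c) q sg)))
  = (1 / 3)%:E.
Proof.
move=> Ei; have [h1 hA z0 ox ny] := chk_facts Ei.
rewrite (fail_prob h1 hA z0 ox ny (old_val01 _ _) (new_val01 _ _)); congr EFin.
rewrite /check_len -[_ * _ - _]/(err _ _ _ _ _) err0 /fail_hi /fail_lo.
by case: (sg); rewrite ?nat_diff1 ?nat_diff2 ?subr0 ?addr0; lra.
Qed.

Lemma ef_draw i q sg t (c := cf i) : s_stage c = inr (q, sg) ->
  exists2 a, a \in slots (s_pc c) (s_par c) (s_branch c) q sg &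
    ef i t = draw D0 (s_pc c) (s_par c) (s_branch c) q sg a.
Proof.
move=> Ei; rewrite /ef -/c Ei; set d := draw _ _ _ _ _ _; set l := [seq e <- _ | _].
case El : l => [|e l'] /=.
  by exists (fail_slot (s_pc c) (s_branch c) q sg) => //; exact: fail_slot_in.
have : e \in l by rewrite El mem_head.
by rewrite mem_filter => /andP[_ /mapP[a aS ->]]; exists a.
Qed.

Lemma ef_step i q sg t e : s_stage (cf i) = inr (q, sg) ->
  delays A (chk i) t -> delays_of A (chk i) e t <-> ef i t = e.
Proof.
move=> Ei /delaysP/hasP[e' _ e't].
have [h1 hA z0 ox ny] := chk_facts Ei.
have un := stepb_unique h1 hA z0 ox ny (old_val01 _ _) (new_val01 _ _).
suff efE : ef i t = e'.
  by rewrite efE; split=> [/delays_ofP et|<-]; [exact: un e't et|exact/delays_ofP].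
have [a aS ea] := check_stepP h1 e't.
rewrite /ef Ei; set d := draw _ _ _ _ _ _; set l := [seq e <- _ | _].
have : e' \in l by rewrite mem_filter e't ea map_f.
case El : l => [|e2 l'] //= _.
have : e2 \in l by rewrite El mem_head.
by rewrite mem_filter => /andP[e2t _]; exact: un e2t e't.
Qed.

Definition nu i : probability (measurableTypeR R) R := unif_mu A (chk i).

Lemma nu_ef i q sg (B : set (measurableTypeR R)) e : s_stage (cf i) = inr (q, sg) ->
  nu i (B `&` [set t | ef i t = e]) = unif_mu A (chk i) (delays_of A (chk i) e `&` B).
Proof.
move=> Ei; have [h1 hA z0 ox ny] := chk_facts Ei.
rewrite /nu !unif_muE (leb_delays h1 hA z0 ox ny (old_val01 _ _) (new_val01 _ _)) /= eqe.
rewrite gt_eqF ?check_len_gt0 ?old_val01 ?new_val01//=; congr (lebesgue_measure _ * _)%E.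
apply/seteqP; split=> t /=.
  by move=> [[Bt et] dt]; split=> //; split=> //; apply/(ef_step _ Ei dt).
by move=> [[et Bt] dt]; split=> //; split=> //; apply/(ef_step _ Ei dt).
Qed.

Variable lamB : strategy (R := R) (n := n) (k := k).
Local Notation f := (step_prob G lam_good lamB s0).
Local Notation leave := (leave sp dv ef lp).
Local Notation ind mv B e := (\1_(B `*` [set e]) mv : R).

Lemma step_prob_ge0 h B e : (0 <= f h B e)%E.
Proof.
rewrite /step_prob; case: (owner _ _); try by rewrite lee_fin indicE.
apply: integral_ge0 => t _; rewrite lee_fin /edge_prob; case: ifP => // _.
Qed.

Lemma step_spine N B e : measurable B -> f (H N) B e =
  (if is_coin (cf N) then 2^-1 * ind (sp N) B e + 2^-1 * ind (dv N) B e
   else ind (sp N) B e)%:E.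
Proof.
move=> mB; have [hA hl hc _] := trail_good N.
rewrite /is_coin; case EN : (s_stage (cf N)) => [j|[q sg]]; rewrite /s_loc EN in hl.
  by rewrite /step_prob trail_state hl owner_enc /= lam_good_spine.
rewrite (coin_step_prob (s0 := s0) _ _ _ (pc := s_pc (cf N)) (p := s_par (cf N))
  (b := s_branch (cf N)) (q := q) (sg := sg)) ?trail_state//.
by rewrite /sp /s_move /dv EN.
Qed.

Lemma coin_stage i : is_coin (cf i) -> exists q sg, s_stage (cf i) = inr (q, sg).
Proof. by rewrite /is_coin; case: (s_stage _) => [//|[q sg]] _; exists q, sg. Qed.

Lemma dv_sp i : is_coin (cf i) -> dv i <> sp i.
Proof.
move=> /coin_stage[q [sg Ei]]; rewrite /dv /sp /s_move Ei => -[e].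
by have := coin_target D0 (s_pc (cf i)) (s_par (cf i)) (s_branch (cf i)) q sg; rewrite -e eqxx.
Qed.

Lemma step_draw N B e : measurable B -> surv N.+1 < surv N ->
  f (rcons (H N) (dv N)) B e = nu N (B `&` [set t | ef N t = e]).
Proof.
move=> mB /surv_coin/coin_stage[q [sg EN]]; rewrite (nu_ef _ _ EN).
have [h1 hA z0 ox ny] := chk_facts EN.
rewrite (check_step_prob (s0 := s0) _ _ _ (pc := s_pc (cf N)) (p := s_par (cf N))
  (b := s_branch (cf N)) (q := q) (sg := sg) (x := old_val (cf N) q) (y := new_val (cf N) q));
  rewrite ?trail_chk ?old_val01 ?new_val01//.
Qed.

Lemma tail_loc j t i : is_coin (cf j) -> (j.+1 < i)%N ->
  (state_after s0 (mkseq (leave j t) i)).1 =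
  if tgt (ef j t) == lose m' D0 then lose m' D0 else win m' D0.
Proof.
move=> /coin_stage[q [sg Ej]]; case: i => // i; rewrite ltnS leq_eqVlt mkseqS state_after_rcons /=.
rewrite /leave => /predU1P[<-|ji].
  rewrite ltnNge leqnSn /= gtn_eqF// eqxx /=.
  by have [a _ ->] := ef_draw t Ej; rewrite /draw /=; case: ifP => _; rewrite ?eqxx//; case: ifP => // /eqP.
rewrite ltnNge (ltnW (ltnW ji)) /= !gtn_eqF ?(ltnW ji)//= /lp.
by case: ifP.
Qed.

Lemma step_tail j t i B e : surv j.+1 < surv j -> (j.+1 < i)%N ->
  f (mkseq (leave j t) i) B e = (ind (0, lp (ef j t)) B e)%:E.
Proof.
move=> /surv_coin cj ji; have hl := tail_loc t cj ji.
rewrite /step_prob; have -> : owner G (state_after s0 (mkseq (leave j t) i)).1 = PDiamond.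
  by rewrite hl; case: ifP => _; rewrite owner_enc.
congr (\1_ _ _)%:E; rewrite /lam_good size_mkseq hl ifF.
  by rewrite /lp; case: ifP => _; rewrite encK.
apply/negbTE; rewrite negb_and; apply/orP; right; apply/eqP => e1.
have := congr1 (fun l => nth point l j) e1.
rewrite !nth_mkseq ?(ltnW ji)//.
by rewrite /leave ltnn eqxx; exact: dv_sp.
Qed.

End GoodStrategy.

(** * The measure induced by the faithful strategy *)

Section GoodMeasure.
Context {R : realType}.
Variables (D : seq instr) (m' : nat).
Local Notation m := m'.+2.
Local Notation k := (m + m).+1.
Hypothesis D0 : (0 < size D)%N.
Local Notation place := (place D m').
Local Notation n := #|place|.+1.
Local Notation E := (edge n k).
Local Notation step := (R * E)%type.
Local Notation G := (@game R D m' D0).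
Local Notation dec := (@dec D m' D0).
Implicit Types (v : k.-tuple R) (t u : R) (s : state R n k) (e : E).
Implicit Types (pc : 'I_(size D)) (q r : 'I_m) (h : seq step).

Hypothesis regs : all (fun i => instr_reg i < m)%N D.
Variables (c0 : spot D m') (s0 : state R n k).
Hypothesis good0 : s_good D0 c0 s0.

Local Notation cf i := (trail D0 c0 s0 i).1.
Local Notation sp := (sp D0 c0 s0).
Local Notation dv := (dv D0 c0 s0).
Local Notation ef := (ef D0 c0 s0).
Local Notation nu := (nu D0 c0 s0).
Local Notation lp := (lp D0).
Local Notation surv := (surv D0 c0 s0).
Local Notation lam_good := (lam_good D0 c0 s0).
Local Notation H := (mkseq sp).
Variable lamB : strategy (R := R) (n := n) (k := k).
Local Notation f := (step_prob G lam_good lamB s0).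
Local Notation leave := (leave sp dv ef lp).
Local Notation lost := (visits [set (lose m' D0)]%SET s0).

Lemma step_spine_fin N B e : measurable B -> f (H N) B e \is a fin_num.
Proof. by move=> mB; rewrite (step_spine regs good0 lamB). Qed.

Lemma step_spine_surv N B e : measurable B -> ((surv N)%:E * f (H N) B e =
  (surv N - surv N.+1)%:E * (\1_(B `*` [set e]) (dv N))%:E +
  (surv N.+1)%:E * (\1_(B `*` [set e]) (sp N))%:E)%E.
Proof.
move=> mB; rewrite (step_spine regs good0 lamB)// -!EFinM -EFinD; congr EFin.
by rewrite /=; case: ifP => _; [field|ring].
Qed.

(** The edges of the cylinder determine the location reached. If Player Diamond owns it, the
    integrand takes two values, according to whether the history is the spine; if Nature owns it,
    the cylinder contains no looping run, since these stay in [lose] or [win]. *)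
Lemma step_meas N (B : nat -> set (measurableTypeR R)) (es : nat -> E) :
  (forall i, measurable (B i)) ->
  measurable_fun (cylinder N B es : set (runs R n k))
    (fun rho : runs R n k => f (mkseq rho N) (B N) (es N)) \/
  (forall j t, (j.+1 < N)%N -> surv j.+1 < surv j -> ~ cylinder N B es (leave j t)).
Proof.
move=> mB; pose l := last s0.1 [seq tgt (es i) | i <- iota 0 N].
have locE (rho : nat -> step) : cylinder N B es rho -> (state_after s0 (mkseq rho N)).1 = l.
  move=> hrho; rewrite state_after_loc; congr last; rewrite -map_comp.
  by apply/eq_in_map => i; rewrite mem_iota => /andP[_ iN]; have [_ <-] := hrho i iN.
case ow : (owner G l).
- by move: ow; rewrite /= /owner_at; case: (dec l) => [i|[[pc p] [j|[[[b q] sg] z]]]].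
- left; pose b (rho : runs R n k) := `[< cyl (H N) rho >].
  apply: (eq_measurable_fun (fun rho => if b rho then
      (\1_(B N `*` [set es N]) (sp N))%:E else
      (\1_(B N `*` [set es N]) (0, fallback D0 (dec l)))%:E)).
    move=> rho; rewrite inE => hrho; rewrite /step_prob (locE _ hrho) ow.
    rewrite /lam_good (locE _ hrho) size_mkseq; case: asboolP => // _ /=.
    rewrite (_ : b rho = (mkseq rho N == H N)); first by case: ifP.
    by apply/asboolP/eqP; rewrite /cyl /= size_mkseq.
  apply: measurable_funTS; apply: measurable_fun_ifT => //.
  apply: (measurable_fun_bool true).
  rewrite (_ : _ @^-1` _ = cyl (H N)); last by apply/seteqP; split=> rho /= /asboolP.
  by rewrite setTI; exact: measurable_cyl.
- right => j t jN /surv_coin cj /locE; rewrite (tail_loc t cj jN) => e.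
  by move: ow; rewrite -e; case: ifP => _; rewrite owner_enc.
Qed.

Definition good_prob : probability (runs R n k) R :=
  mixture_prob sp dv nu lp (measurable_ef D0 c0 s0) (erefl : surv 0 = 1)
    (surv_dec D0 c0 s0) (@surv_lim R D m' D0 c0 s0).

Lemma good_induced : induced_measure G lam_good lamB s0 good_prob.
Proof.
move=> N B es mB.
apply: (mixture_induced (measurable_ef D0 c0 s0) (surv_dec D0 c0 s0)
  (@surv_lim R D m' D0 c0 s0) (f := f)) => //.
- exact: step_prob_ge0.
- exact: step_spine_fin.
- exact: step_spine_surv.
- exact: step_draw.
- exact: step_tail.
- exact: step_meas.
Qed.

(** Neither the spine nor the checks meet [lose], so it can only be entered through the failing
    slot. *)
Lemma lost_leave j t q sg (c := cf j) : s_stage c = inr (q, sg) -> lost (leave j t) ->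
  ef j t = draw D0 (s_pc c) (s_par c) (s_branch c) q sg (fail_slot (s_pc c) (s_branch c) q sg).
Proof.
move=> Ej [N]; rewrite finset.in_set1 => /eqP.
have cj : is_coin (cf j) by rewrite /is_coin Ej.
have [Nj|] := leqP N j.
  rewrite leave_prefix// trail_state; have [_ -> _ _] := trail_good regs good0 N.
  by rewrite /s_loc; case: (s_stage _) => [i|[r b]] /(can_inj (@encK D m' D0)).
rewrite leq_eqVlt => /predU1P[<-|jN].
  rewrite leave_prefixS trail_chk; have [-> _ _ _ _] := chk_facts regs good0 Ej.
  by move=> /(can_inj (@encK D m' D0)).
rewrite (tail_loc t cj jN); case: eqP => [+ _|_ /(can_inj (@encK D m' D0))//].
have [a _ ->] := ef_draw t Ej => h; congr draw; move: h; rewrite /draw /=.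
by case: eqP => // _ /(can_inj (@encK D m' D0)).
Qed.

(** Given the coin at which the run leaves the spine, it loses with probability at most 1/3, and the
    weights of the departures sum to 1. *)
Lemma good_lost : fine (good_prob lost) <= 1 / 3.
Proof.
have mlost : measurable lost by exact: measurable_visits.
rewrite -lee_fin fineK ?fin_num_measure//.
rewrite -[good_prob _]/(mixture sp dv nu lp (measurable_ef D0 c0 s0) (surv_dec D0 c0 s0) lost) mixtureE.
apply: (@le_trans _ _ (\sum_(0 <= j <oo) ((1 / 3)%:E * (surv j - surv j.+1)%:E))%E).
  apply: lee_nneseries => j _.
    by rewrite mule_ge0// lee_fin subr_ge0 surv_dec.
  rewrite [leRHS]muleC; have [cj|cj] := boolP (is_coin (cf j)); last first.
    by rewrite /= (negbTE cj) subrr !mul0e.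
  rewrite lee_wpmul2l ?lee_fin ?subr_ge0 ?surv_dec//.
  have [q [sg Ej]] := coin_stage cj.
  rewrite -(nu_fail regs good0 Ej) -[X in (_ <= unif_mu _ _ X)%E]setIT.
  rewrite -(nu_ef regs good0 _ _ Ej) setTI; apply: le_measure; rewrite ?inE.
  - by rewrite -[X in measurable X]setTI; apply: measurable_leave => //; exact: measurable_ef.
  - exact: measurable_ef.
  - by move=> t /(lost_leave Ej).
rewrite nneseriesZl; last by move=> j _; rewrite lee_fin subr_ge0 surv_dec.
by rewrite (sum_weights (@surv_lim R D m' D0 c0 s0)) mule1.
Qed.

End GoodMeasure.

(** * The reduction *)

Section Reduction.
Context {R : realType}.
Variables (D : seq instr) (m' : nat).
Local Notation m := m'.+2.
Local Notation k := (m + m).+1.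
Hypothesis D0 : (0 < size D)%N.
Hypothesis regs : all (fun i => instr_reg i < m)%N D.
Local Notation place := (place D m').
Local Notation A := (automaton m' D0).
Local Notation G := (@game R D m' D0).

(** Register 0 holds [x], while the other registers hold 0 and are thus represented by [i + 1]. *)
Definition init_clock (x i : nat) : rat :=
  if i == 0%N then 2^-1 ^+ x else if (i < m)%N then i.+1%:R else 0.

Definition init_clocks x : k.-tuple rat := [tuple init_clock x i | i < k].

Lemma code_rat_pow x : code_rat (2^-1 ^+ x) = CodeSeq.code [:: 1%N; (2 ^ x)%N].
Proof.
pose i : int := (2 ^ x)%N.
have i0 : i != 0 by rewrite /i -lt0n expn_gt0.
have -> : 2^-1 ^+ x = i%:~R^-1 :> rat by rewrite exprVn -natrX.
have dE := denqVz i0.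
rewrite /code_rat dE; congr CodeSeq.code; congr [:: _; _].
have := numqE (i%:~R^-1 : rat); rewrite dE (ger0_norm (_ : 0 <= i))// mulVf ?intr_eq0//.
by move=> h; rewrite (_ : numq _ = 1)//; apply: (@intr_inj rat).
Qed.

(** Only the first clock depends on [x], hence the arbitrary argument 0. *)
Definition other_clocks : seq nat :=
  [seq code_rat (init_clock 0 i.+1) | i <- iota 0 (m + m)].

Lemma code_init_clocks x : [seq code_rat q | q <- init_clocks x] =
  code_rat (2^-1 ^+ x) :: other_clocks.
Proof.
have -> : init_clocks x = [seq init_clock x i | i <- iota 0 k] :> seq rat.
  apply: (@eq_from_nth _ 0); first by rewrite size_tuple size_map size_iota.
  move=> i; rewrite size_tuple => ik.
  rewrite (nth_map 0%N) ?size_iota// nth_iota// add0n.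
  by rewrite -(tnth_nth 0 (init_clocks x) (Ordinal ik)) tnth_mktuple.
rewrite -map_comp -[k]addn1 addnC iotaD map_cat; congr (_ :: _).
by rewrite /other_clocks -[(0 + 1)%N]addn0 iotaDl -map_comp.
Qed.

Lemma init_state x : let s := rat_state R (start m' D0) (init_clocks x) in
  let mu := upd (fun=> 0%N) 0 x in
  [/\ is_state A s, s.1 = start m' D0, tnth s.2 zc = 0 &
    forall r : 'I_m, tnth s.2 (clk false r) = r%:R + code_val mu r].
Proof.
move=> s mu.
have E (i : 'I_k) : tnth s.2 i = ratr (init_clock x i) by rewrite !tnth_mktuple.
split=> //.
- apply/stateE; split=> // i; rewrite [X in tnth X _]/s.2 E ler0q /init_clock.
  by case: ifP => _; [rewrite exprn_ge0|case: ifP].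
- by rewrite E /init_clock /= ltnNge leq_addr /= rmorph0.
- move=> r; rewrite E val_clk addn0 /init_clock /code_val /mu /upd ltn_ord.
  case: eqP => [->|_]; first by rewrite rmorphXn /= fmorphV /= ratr_nat add0r.
  by rewrite ratr_nat expr0 natr1.
Qed.

Lemma game_diamond : one_and_half_player G.
Proof.
by move=> l; rewrite /= /owner_at; case: (dec D0 l) => [i|[[pc p] [j|[[[b q] sg] z]]]].
Qed.

Lemma reach_iff x : reach_problem G [set lose m' D0]%SET
    (rat_state R (start m' D0) (init_clocks x)) CLe (1 / 3) <->
  ~ halts D (upd (fun=> 0%N) 0 x).
Proof.
have [hA h1 z0 hx] := init_state x; set s := rat_state _ _ _ in hA h1 z0 hx *.
split=> [[lamD [hD H]] halt|nh].
  (* No location belongs to Player Box, so any function is a strategy for that player and can serve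
     as the opponent. *)
  have hB : is_strategy G PBox lamD.
    split=> [s' h [_ /game_diamond]//|s' es D1].
    have -> : D1 = set0%classic.
      by apply/seteqP; split=> // ts [_ /game_diamond].
    split; first exact: measurable_fun_set0.
    by move=> e; rewrite set0I.
  have [P [ind le]] := H lamD hB.
  have := lower_bound hD ind regs h1 hA z0 hx halt.
  by move: le => /=; rewrite leNgt => /negP.
pose c0 := Spot (Ordinal D0) (upd (fun=> 0%N) 0 x) false (inl ord_max) : spot D m'.
have good0 : s_good D0 c0 s.
  split=> //.
    split=> [|r|r] /=; first by rewrite z0 subrr.
      by rewrite hx z0 addr0.
    by rewrite leqNgt ltn_ord.
  by move=> N; rewrite ltnNge; apply/negP => h; apply: nh; exists N.
exists (lam_good D0 c0 s); split; first exact: lam_good_strategy.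
move=> lamB _; exists (good_prob D0 c0 s); split; first exact: good_induced.
exact: good_lost.
Qed.

End Reduction.

(* [presents d G]: the number d presents the delay measures of G. *)
Theorem theorem2 (R : realType)
    (presents : forall n k : nat, nat -> stg R n k -> Prop)
    (uniform_presentable : exists d0 : nat,
       forall (n k : nat) (G : stg R n k),
         uniform_stg G -> presents n k d0 G) :
  ~ exists M : seq instr,
      forall (n k : nat) (G : stg R n k) (d : nat) (T : {set 'I_n.+1})
        (l0 : 'I_n.+1) (v0 : k.-tuple rat) (c : cmp) (p : rat),
        (4 <= k)%N ->
        one_and_half_player G ->
        presents n k d G ->
        is_state (aut G) (rat_state R l0 v0) ->
        0 < p < 1 ->
        answers M (code_instance G d T l0 v0 c p)
          (reach_problem G T (rat_state R l0 v0) c (ratr p)).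
Proof.
have p01 : (0 < 1 / 3 :> rat) && (1 / 3 < 1 :> rat) by apply/andP; split; lra.
case: uniform_presentable => d0 hd0 [M hM].
have [b hb] := regs_bound M.
(* This gives [b + 5] registers, enough for those of M, below [b], and those of the input program,
   below 5. *)
pose m' := (b + 3)%N.
(* Presentation of the measures, code of the target set containing only location 0, and number 2 of
   the initial location. *)
pose hs := [:: d0; CodeSeq.code [:: 0%N]; 2%N].
pose tl := [:: nat_of_cmp CLe; code_rat (1 / 3)].
have [D [D0 regsD hD]] := diag_machine M (runs_input hs (other_clocks m') tl).
have regs : all (fun i => instr_reg i < m'.+2)%N D.
  apply: regsD => //.
    by apply: sub_all (small_input hs (other_clocks m') tl 0%N) => i; rewrite /m'; lia.
  by apply: sub_all hb => i; rewrite /m'; lia.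
pose G := @game R D m' D0.
have [yes no] := hD (code_stg G).
have inst : code_instance G d0 [set lose m' D0]%SET (start m' D0)
    (init_clocks m' (code_stg G)) CLe (1 / 3) =
    input_code hs (other_clocks m') tl (code_stg G).
  rewrite /code_instance /input_code code_init_clocks code_rat_pow val_start.
  have -> : code_set [set lose m' D0]%SET = CodeSeq.code [:: 0%N].
    by rewrite /code_set enum_set1; congr (CodeSeq.code [:: _]); exact: val_lose.
  by [].
have k4 : (4 <= (m'.+2 + m'.+2).+1)%N by rewrite /m'; lia.
have [hA _ _ _] := @init_state R D m' D0 (code_stg G).
have uG : uniform_stg G by move=> s; exact: uniform_game_uniform.
have := hM _ _ G d0 [set lose m' D0]%SET _ _ CLe (1 / 3) k4 (@game_diamond R D m' D0)
  (hd0 _ _ _ uG) hA p01.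
have -> : ratr (1 / 3 : rat) = 1 / 3 :> R by rewrite fmorph_div /= rmorph1 ratr_nat.
rewrite inst => -[ans1 ans0].
have iff := @reach_iff R D m' D0 regs (code_stg G).
(* If D halts on the code of its own game, then M answers 0 and D diverges; if it diverges, then M
   answers 1 and D halts. *)
have [h|h] := pselect (halts D (upd (fun=> 0%N) 0 (code_stg G))).
  exact: (no (ans0 (fun r => iff.1 r h)) h).
exact: (h (yes (ans1 (iff.2 h)))).
Qed.
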